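(* Let $\delta\in(0,1)$. For each $n$, let $d=\lfloor\delta n\rfloor$, let $A_1,\dotsc,A_{n+1}$ be i.i.d. standard Gaussian random vectors in $\mathbb{R}^d$, and let $P_{n+1}=\operatorname{conv}(A_1,\dotsc,A_{n+1})$. Then \[ \mathbb{P}\bigl(\operatorname{diam}(P_{n+1})\ge\sqrt d\bigr)\ge 1-e^{-nd/32}, \] and there exist constants $0<c,c'<1$ depending only on $\delta$ such that \[ \lim_{n\to\infty}\mathbb{P}\bigl(\operatorname{vf}(P_{n+1})\le c^d\bigr)\ge c'. \] (Hence the measure of conditioning $\kappa=\operatorname{vf}(P_{n+1})/\operatorname{diam}(P_{n+1})$ is exponentially small in $d$ with constant probability.)
   Context: For a polytope $P\subseteq\mathbb{R}^d$ with $\dim(\operatorname{aff}P)\ge 1$, the vertex-facet distance is $\operatorname{vf}(P)=\min_{F}\operatorname{dist}(\operatorname{aff}(F),\operatorname{vertices}(P)\setminus F)$, the minimum over facets $F$ of $P$, where $\operatorname{dist}(X,Y)=\inf_{x\in X,y\in Y}\|x-y\|$. $\operatorname{diam}(P)$ is the Euclidean diameter. *)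

(* Defs.v *)
From HB Require Import structures.
From mathcomp Require Export all_boot all_order all_algebra.
From mathcomp Require Export all_classical all_reals all_analysis.

Set Implicit Arguments.
Unset Strict Implicit.
Unset Printing Implicit Defensive.

Import Order.TTheory GRing.Theory Num.Theory.
Import numFieldTopology.Exports numFieldNormedType.Exports.

Local Open Scope classical_set_scope.
Local Open Scope ring_scope.

Section Polytopes.
Context {R : realType} {d : nat}.
Implicit Types (X Y P F : set 'rV[R]_d) (x y u v : 'rV[R]_d).

Definition dot u v : R := \sum_(j < d) u 0 j * v 0 j.

(* The library norm on matrices is the sup norm, hence a separate constant. *)
Definition enorm u : R := Num.sqrt (dot u u).

Definition conv_hull X : set 'rV[R]_d :=
  [set x | exists k (a : 'I_k -> R) (p : 'I_k -> 'rV[R]_d),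
    [/\ forall i, 0 <= a i, \sum_i a i = 1, forall i, X (p i) &
        x = \sum_i a i *: p i]].

Definition aff_hull X : set 'rV[R]_d :=
  [set x | exists k (a : 'I_k -> R) (p : 'I_k -> 'rV[R]_d),
    [/\ \sum_i a i = 1, forall i, X (p i) & x = \sum_i a i *: p i]].

(* The affine hull of X is a translate of a linear space of dimension k, the
   row space of W.  In particular X is nonempty: the convention dim set0 = -1
   is rendered by [has_dim set0 k] being false for every k. *)
Definition has_dim X (k : nat) : Prop :=
  exists (x0 : 'rV[R]_d) (W : 'M[R]_(k, d)),
    row_free W /\ aff_hull X = [set x0 + u *m W | u in [set: 'rV[R]_k]].

Definition is_face P F : Prop :=
  exists (u : 'rV[R]_d) (b : R),
    (forall x, P x -> dot u x <= b) /\ F = P `&` [set x | dot u x = b].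

Definition is_facet P F : Prop :=
  is_face P F /\ exists k, has_dim P k.+1 /\ has_dim F k.

Definition vertices P : set 'rV[R]_d := [set v | is_face P [set v]].

Definition dist X Y : R :=
  inf [set r | exists x y, [/\ X x, Y y & r = enorm (x - y)]].

Definition diam P : R :=
  sup [set r | exists x y, [/\ P x, P y & r = enorm (x - y)]].

(* For a polytope of dimension at least 1 the set of values is finite and
   nonempty, so this infimum is the minimum over the facets.  If P has
   dimension 0, where the quantity is not defined, this is inf set0 = 0. *)
Definition vf P : R :=
  inf [set dist (aff_hull F) (vertices P `\` F) | F in [set F | is_facet P F]].

End Polytopes.

Section Gaussian.
Context {disp : measure_display} {T : measurableType disp} {R : realType}.
Variable Pr : probability T R.

(* Mutual independence of a finite family of U-valued random elements, where S
   is the sigma-algebra on U: product rule over every subfamily. *)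
Definition mutually_independent (I : finType) (U : Type) (S : set (set U))
    (X : I -> T -> U) : Prop :=
  forall (J : {set I}) (B : I -> set U), (forall i, S (B i)) ->
    Pr [set w | forall i, i \in J -> B i (X i w)] =
    (\prod_(i in J) Pr (X i @^-1` B i))%E.

Definition std_gaussian_var (Z : T -> R) : Prop :=
  measurable_fun setT Z /\
  forall B : set R, measurable B -> Pr (Z @^-1` B) = normal_prob 0 1 B.

Definition std_gaussian_vec (d : nat) (X : T -> 'rV[R]_d) : Prop :=
  (forall j, std_gaussian_var (fun w => X w 0 j)) /\
  mutually_independent (measurable : set (set R))
    (fun (j : 'I_d) w => X w 0 j).

Definition iid_std_gaussian (m d : nat) (A : 'I_m -> T -> 'rV[R]_d) : Prop :=
  (forall i, std_gaussian_vec (A i)) /\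
  mutually_independent <<s [set V : set 'rV[R]_d | open V] >> A.

End Gaussian.

Definition random_polytope {T : Type} {R : realType} {m d : nat}
    (A : 'I_m -> T -> 'rV[R]_d) (w : T) : set 'rV[R]_d :=
  conv_hull (range (fun i => A i w)).

Definition floor_dim {R : realType} (delta : R) (n : nat) : nat :=
  `|Num.floor (delta * n%:R)|%N.

(* Main.v *)
(** The diameter is at least the distance between the points of any of the
    disjoint pairs (A_(2k), A_(2k+1)).  These distances are independent, and the
    exponential Markov inequality applied to the product of the
    exp(-|A_(2k) - A_(2k+1)|^2 / 4) bounds the probability that all of them are
    less than sqrt d.

    For the vertex-facet distance the probability even tends to 1.  Split off the
    last point a from the hull Q of the first m = n points, m being proportional
    to d.
    - With high probability Q contains a ball of constant radius around the mean g
      of its points: otherwise the values <u, A_i> concentrate in l^1 for some unit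
      vector u, which is excluded by a net of roundings of the vectors u.
    - Such a Q has exponentially many facets whose unit normals are pairwise
      separated by a constant angle.  Most grid vectors v of a large constant
      length lie outside Q - g.  Separating such a v from Q - g and pivoting gives a
      facet seen by v, and a small cap of normals can only account for few v.
    - Given Q, the point a lies with high probability beneath one of these facets
      and within s = c^d of its hyperplane.  Replace the indicator of the slab of a
      facet by a Fejer kernel in <a, u>.  Project the normals on the span of few
      orthonormal vectors, chosen greedily so that the residuals w of the normals
      are nearly orthogonal on average.  The average of the kernels is close in L^2
      to its conditional expectation given the projection of a, since the
      covariance of two kernels is controlled by the inner product of the two
      residuals, and this conditional expectation is bounded below.
    - A facet with a beneath it is still a facet of conv(Q, a), and a is a vertex
      because <a, A_i> < |a|^2 for all i. *)
Require Import Defs.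
From HB Require Import structures.
From mathcomp Require Import measurable_realfun.
From mathcomp Require Import ring lra zify.
Import Order.TTheory GRing.Theory Num.Theory.
Import numFieldTopology.Exports numFieldNormedType.Exports.
Local Open Scope classical_set_scope.
Local Open Scope ring_scope.

Set Implicit Arguments.
Unset Strict Implicit.
Unset Printing Implicit Defensive.

(** * Gaussian integrals *)

Section gauss1.
Context {R : realType}.
Local Notation mu := (@lebesgue_measure R).
Local Notation N01 := (@normal_prob R 0 1).

(** The normals are separated by a constant angle only, so the covariance of two slab indicators may
    be comparable to the product of their probabilities, and a direct second moment bound does not
    make the failure probability small. The correlation comes from few common directions; their
    number stays bounded as d grows, and once they are projected away the residuals are nearly
    orthogonal on average. The Fejer kernel is used because it is a nonnegative trigonometric
    polynomial: its means and covariances are finite sums of values exp(-|v|^2/2) of a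
    characteristic function, so neither densities on R^d nor conditional expectations have to be
    constructed. In the same spirit, volumes become numbers of grid points, and nets consist of
    integer vectors. Roundings are chosen after the random points, yet they fall into a net fixed
    beforehand; this takes the place of operator norm bounds for Gaussian matrices. Independence of
    the last point is used through Fubini on a product space, to which the event has to be
    transferred; hence the measurability of [vf] in the coordinates. *)

Lemma ge0_integral_normal_prob (f : R -> \bar R) :
  measurable_fun setT f -> (forall x, 0 <= f x)%E ->
  (\int[N01]_x f x = \int[mu]_x (f x * (normal_pdf 0 1 x)%:E))%E.
Proof.
move=> mf f0.
have dom : N01 `<< mu by exact: normal_prob_dominates.
rewrite -(Radon_Nikodym_SigmaFinite.change_of_variables dom f0 measurableT mf).
apply: ae_eq_integral => //.
- apply: emeasurable_funM => //.
  have := Radon_Nikodym_SigmaFinite.f_integrable dom.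
  by move/(measurable_int mu).
- apply: emeasurable_funM => //; apply/measurable_EFinP.
  exact: measurable_normal_pdf.
(* A Radon-Nikodym derivative is determined only almost everywhere; it agrees with [normal_pdf]
   because both have the same integrals over measurable sets. *)
- apply: ae_eqe_mul2l => /=.
  apply: integral_ae_eq => //=.
  + exact: Radon_Nikodym_SigmaFinite.f_integrable.
  + by apply/measurable_EFinP; exact: measurable_normal_pdf.
  + move=> E _ mE; rewrite -Radon_Nikodym_SigmaFinite.f_integral//.
Qed.

(** Completing the square: the integrand times the density is a constant times the normal density of
    mean s/(1+b) and variance 1/(1+b). The case [b = 0] is the moment generating function, the case
    [s = 0] the Laplace transform of a square. *)
Lemma normal_quad_integral (b s : R) : -1 < b ->
  (\int[N01]_x (expR (- (b * x ^+ 2 / 2) + s * x))%:E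
   = ((Num.sqrt (1 + b))^-1 * expR (s ^+ 2 / (2 * (1 + b))))%:E)%E.
Proof.
move=> b1; have b10 : 0 < 1 + b by lra.
rewrite ge0_integral_normal_prob; last 2 first.
- apply/measurable_EFinP; apply: measurableT_comp => //.
  apply: measurable_funD; last by apply: measurable_funM.
  apply: measurable_funN. 
  do 2 apply: measurable_funM => //.
- by move=> x; rewrite lee_fin expR_ge0.
set sg := (Num.sqrt (1 + b))^-1.
have sg0 : 0 < sg by rewrite invr_gt0 sqrtr_gt0.
have sg2 : sg ^+ 2 = (1 + b)^-1 by rewrite exprVn sqr_sqrtr// ltW.
have E x : expR (- (b * x ^+ 2 / 2) + s * x) * normal_pdf 0 1 x =
   (sg * expR (s ^+ 2 / (2 * (1 + b)))) * normal_pdf (s / (1 + b)) sg x.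
  rewrite !normal_pdfE ?gt_eqF// /normal_peak /normal_fun.
  have -> : Num.sqrt (sg ^+ 2 * pi *+ 2) = sg * Num.sqrt (1 ^+ 2 * pi *+ 2) :> R.
    by rewrite -mulrnAr sqrtrM ?sqr_ge0// sqrtr_sqr gtr0_norm// expr1n mul1r.
  set c := Num.sqrt (1 ^+ 2 * pi *+ 2).
  have c0 : c != 0.
    rewrite gt_eqF// sqrtr_gt0 expr1n mul1r pmulrn_lgt0//; exact: pi_gt0.
  rewrite mulrCA -expRD.
  rewrite [RHS](_ : _ = c^-1 * (expR (s ^+ 2 / (2 * (1 + b))) * expR (- (x - s / (1 + b)) ^+ 2 / (sg ^+ 2 *+ 2)))); last first.
    by field; rewrite c0 (gt_eqF sg0).
  rewrite -expRD; congr (_ * expR _); rewrite sg2; field.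
  by rewrite gt_eqF.
under eq_integral do rewrite -EFinM E EFinM.
rewrite ge0_integralZl//; first by rewrite integral_normal_pdf mule1.
  by apply/measurable_EFinP; exact: measurable_normal_pdf.
  by move=> x _; rewrite lee_fin normal_pdf_ge0.
by rewrite lee_fin mulr_ge0 ?expR_ge0 ?(ltW sg0).
Qed.

Lemma normal_prob_itv_ge (a b K : R) : a <= b -> 
  (forall x, a <= x <= b -> K <= normal_pdf 0 1 x) -> 0 <= K ->
  ((K * (b - a))%:E <= N01 `[a, b])%E.
Proof.
move=> ab HK K0; rewrite /normal_prob.
apply: (@le_trans _ _ (\int[mu]_(x in `[a, b]) (K%:E))%E).
  rewrite integral_cst//= lebesgue_measure_itv/= lte_fin.
  have [ab'|ba] := ltP a b; first by rewrite -EFinB -EFinM.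
  have -> : b - a = 0 by lra.
  by rewrite mulr0 mule0.
apply: ge0_le_integral => //.
by apply/measurable_EFinP/measurable_funTS; exact: measurable_normal_pdf.
Qed.

End gauss1.

(** * The characteristic function of the normal law *)

Section cosgauss.
Context {R : realType}.
Local Notation mu := (@lebesgue_measure R).
Local Notation N01 := (@normal_prob R 0 1).
Local Notation phi := (@normal_pdf R 0 1).

Lemma normal_pdf01E x : phi x = normal_peak 1 * expR (- (x ^+ 2 / 2)).
Proof.
rewrite normal_pdfE ?oner_eq0// /normal_fun subr0 expr1n.
by congr (_ * expR _); field.
Qed.

Lemma integrable_exp_normal_pdf (s : R) :
  mu.-integrable setT (EFin \o (fun x => expR (s * x) * phi x)).
Proof.
apply/integrableP; split.
  apply/measurable_EFinP; apply: measurable_funM; last exact: measurable_normal_pdf.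
  by apply: measurableT_comp => //; apply: measurable_funM.
rewrite (_ : (\int[mu]_x _)%E = (\int[N01]_x (expR (- (0 * x ^+ 2 / 2) + s * x))%:E)%E).
  by rewrite normal_quad_integral ?ltry//; lra.
rewrite ge0_integral_normal_prob; last 2 first.
- apply/measurable_EFinP; apply: measurableT_comp => //.
  apply: measurable_funD; last by apply: measurable_funM.
  apply: measurable_funN. 
  do 2 apply: measurable_funM => //.
- by move=> x; rewrite lee_fin expR_ge0.
apply: eq_integral => x _ /=; rewrite mul0r mul0r oppr0 add0r ger0_norm ?EFinM//.
by rewrite mulr_ge0 ?expR_ge0 ?normal_pdf_ge0.
Qed.

Lemma absr_le_expR (x : R) : `|x| <= expR x + expR (- x).
Proof.
have H (y : R) : y <= expR y by apply: le_trans (expR_ge1Dx y); rewrite lerDr.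
rewrite ler_norml; have := H x; have := H (- x); have := expR_gt0 x; have := expR_gt0 (- x).
by move=> *; apply/andP; split; lra.
Qed.

(** The dominating function for differentiating the characteristic function under the integral; it
    is itself dominated through |x| <= exp x + exp(-x). *)
Lemma integrable_abs_normal_pdf :
  mu.-integrable setT (EFin \o (fun x => `|x| * phi x)).
Proof.
have i1 := integrable_exp_normal_pdf 1; have i2 := integrable_exp_normal_pdf (-1).
have := integrableD measurableT i1 i2.
apply: le_integrable => //.
  apply/measurable_EFinP; apply: measurable_funM; last exact: measurable_normal_pdf.
  exact: normr_measurable.
move=> x _ /=; rewrite lee_fin -mulrDl normrM normr_id (ger0_norm (normal_pdf_ge0 _ _ _)).
rewrite (ger0_norm (mulr_ge0 _ _)) ?addr_ge0 ?expR_ge0 ?normal_pdf_ge0//.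
by rewrite ler_wpM2r ?normal_pdf_ge0// mul1r mulN1r absr_le_expR.
Qed.

Lemma is_derive_phi (x : R) : is_derive x 1 phi (- (x * phi x)).
Proof.
rewrite (_ : phi = (fun y => normal_peak 1 * expR (- (y ^+ 2 / 2)))); last first.
  by apply/funext => y; rewrite normal_pdf01E.
apply: is_derive_eq.
rewrite /GRing.scale /=.
by rewrite !mulr0 !mulr1 add0r; field.
Qed.

Let F t x := sin (t * x) * phi x.
Let F' t x := t * (cos (t * x) * phi x) - x * sin (t * x) * phi x.

Lemma is_derive_sinphi t (x : R) : is_derive x 1 (F t) (F' t x).
Proof.
have h := is_derive_phi x.
apply: is_derive_eq.
rewrite /GRing.scale /= /F'; ring.
Qed.

Lemma measurable_sin_mul (t : R) : measurable_fun setT (fun x : R => sin (t * x)).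
Proof.
apply: measurableT_comp; last exact: measurable_funM.
by apply: continuous_measurable_fun; exact: continuous_sin.
Qed.

Lemma measurable_cos_mul (t : R) : measurable_fun setT (fun x : R => cos (t * x)).
Proof.
apply: measurableT_comp; last exact: measurable_funM.
by apply: continuous_measurable_fun; exact: continuous_cos.
Qed.

Lemma integrable_cosphi t : mu.-integrable setT (EFin \o (fun x => cos (t * x) * phi x)).
Proof.
apply: le_integrable (@integrable_normal_pdf R 0 1) => //.
  apply/measurable_EFinP; apply: measurable_funM; last exact: measurable_normal_pdf.
  exact: measurable_cos_mul.
move=> x _ /=; rewrite lee_fin normrM ler_piMl// cos_max//.
Qed.

Lemma integrable_xsinphi t : mu.-integrable setT (EFin \o (fun x => x * sin (t * x) * phi x)).
Proof.
apply: le_integrable integrable_abs_normal_pdf => //.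
  apply/measurable_EFinP; apply: measurable_funM; last exact: measurable_normal_pdf.
  by apply: measurable_funM => //; exact: measurable_sin_mul.
move=> x _ /=; rewrite lee_fin !normrM normr_id ler_wpM2r// ler_piMr// sin_max//.
Qed.

(** By the fundamental theorem of calculus the integral over [-(n+1), n+1] is a boundary term, which
    vanishes in the limit with the Gaussian density; dominated convergence passes to the whole
    line. *)
Lemma integral_F' t : (\int[mu]_x F' t x)%R = 0.
Proof.
have iF : mu.-integrable setT (EFin \o F' t).
  have := integrableB measurableT (integrableZl measurableT t (integrable_cosphi t)) (integrable_xsinphi t).
  by apply: eq_integrable => // x _.
have mF : measurable_fun setT (EFin \o F' t) by apply: measurable_int iF.
pose D (n : nat) : set R := `[- (n.+1%:R : R), (n.+1%:R : R)]%classic.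
pose g (n : nat) := (EFin \o F' t) \_ (D n).
have mg n : measurable_fun setT (g n).
  by apply/measurable_restrict => //; rewrite /D ?setIT//; exact: measurable_funTS.
have [_ _ H] : [/\ mu.-integrable setT (EFin \o F' t),
   (\int[mu]_x `|g n x - (EFin \o F' t) x|)%E @[n --> \oo] --> 0%E &
   (\int[mu]_x g n x)%E @[n --> \oo] --> (\int[mu]_x (F' t x)%:E)%E ].
  apply: (@dominated_convergence _ _ _ mu setT measurableT g (EFin \o F' t) (fun x => `|(EFin \o F' t) x|%E)) => //.
  - apply: aeW => x _; apply: cvg_near_cst.
    near=> n; rewrite /g patchE mem_set//= /D/= in_itv/= -ler_norml.
    rewrite (@le_trans _ _ n%:R) ?ler_nat//; near: n; exact: nbhs_infty_ger.
  - exact: integrable_abse.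
  - apply: aeW => x n _ /=; rewrite /g patchE; case: ifP => // _.
    by rewrite abse0.
have E n : (\int[mu]_x g n x)%E = (F t n.+1%:R - F t (- n.+1%:R))%:E.
  rewrite -integral_mkcond EFinB.
  apply: continuous_FTC2.
  - by rewrite ltrNl (@lt_trans _ _ 0) ?oppr_lt0 ?ltr0n.
  - apply: continuous_subspaceT => x; rewrite /F'.
    have cphi : {for x, continuous phi} by apply: continuous_normal_pdf; rewrite oner_eq0.
    have cm : {for x, continuous (fun x : R => t * x)} by exact: mulrl_continuous.
    apply: cvgB.
      apply: cvgMr; apply: cvgM => //.
      by apply: (cvg_comp _ _ cm); exact: continuous_cos.
    apply: cvgM => //; apply: cvgM => //.
    by apply: (cvg_comp _ _ cm); exact: continuous_sin.
  - have cF (x : R) : F t y @[y --> x] --> F t x.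
      apply/differentiable_continuous/derivable1_diffP.
      by have [] := is_derive_sinphi t x.
    split.
    + by move=> x _; have [] := is_derive_sinphi t x.
    + by apply: cvg_at_right_filter; exact: cF.
    + by apply: cvg_at_left_filter; exact: cF.
  - by move=> x _; rewrite derive1E; have [_ ->] := is_derive_sinphi t x.
have H0 : (F t n.+1%:R - F t (- n.+1%:R)) @[n --> \oo] --> (0 : R).
  apply: norm_cvg0.
  have hc : (4 * normal_peak 1) * harmonic n @[n --> \oo] --> (4 * normal_peak 1) * (0:R).
    by apply: cvgMr; exact: cvg_harmonic.
  rewrite mulr0 in hc.
  apply: (squeeze_cvgr _ (cvg_cst 0) hc).
  apply: nearW => n /=; rewrite normr_ge0 /=.
  have b (y : R) : y ^+ 2 = n.+1%:R ^+ 2 -> `|F t y| <= 2 * normal_peak 1 * harmonic n.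
    move=> y2; rewrite /F normrM (ger0_norm (normal_pdf_ge0 _ _ _)) normal_pdf01E y2.
    rewrite (@le_trans _ _ (1 * (normal_peak 1 * (2 * harmonic n))))//.
      apply: ler_pM => //; rewrite ?mulr_ge0 ?normal_peak_ge0 ?expR_ge0 ?sin_max//.
      rewrite ler_wpM2l ?normal_peak_ge0// expRN /harmonic/=.
      have h := expR_ge1Dx (n.+1%:R ^+ 2 / 2 : R).
      have n1 : 1 <= n.+1%:R :> R by rewrite ler1n.
      rewrite -div1r ler_pdivrMr ?expR_gt0// mulrAC ler_pdivlMr ?ltr0n// mul1r.
      by nra.
    by rewrite mul1r; lra.
  apply: le_trans (ler_normB _ _) _.
  apply: le_trans (lerD (b _ (erefl _)) (b (- n.+1%:R) (sqrrN _))) _.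
  by rewrite -mulrDl -mulrDl -natrD.
have : (\int[mu]_x (F' t x)%:E)%E = 0%E.
  apply: (cvg_unique _ H) => //.
  have -> : (fun n => \int[mu]_x g n x)%E = (fun n => (F t n.+1%:R - F t (- n.+1%:R))%:E).
    by apply/funext => n; rewrite E.
  by apply: cvg_EFin => //; exact: nearW.
by rewrite /Rintegral => ->.
Unshelve. all: by end_near.
Qed.

Let g t := (\int[mu]_x (cos (t * x) * phi x))%R.

(** Differentiation under the integral gives minus the integral of x sin(t x) times the density, and
    [integral_F'] is the integration by parts that turns it into -t g(t). *)
Lemma is_derive_cosgauss (t : R) : is_derive t 1 g (- (t * g t)).
Proof.
pose f (t x : R) := cos (t * x) * phi x.
have df (u x : R) : is_derive u 1 (f^~ x) (- (x * sin (u * x) * phi x)).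
  rewrite /f; apply: is_derive_eq; rewrite /GRing.scale/=.
  by rewrite !mulr0 !mulr1; ring.
have d1 u x : partial1of2 f u x = - (x * sin (u * x) * phi x).
  by rewrite partial1of2E; have [_ ->] := df u x.
have Ia : `](t - 1), (t + 1)[%classic t by rewrite /= in_itv/=; apply/andP; split; lra.
have intf (u : R) : `](t - 1), (t + 1)[%classic u -> mu.-integrable setT (EFin \o f u).
  by move=> _; exact: integrable_cosphi.
have derf u x : `](t - 1), (t + 1)[%classic u -> setT x -> derivable (f^~ x) u 1.
  by move=> _ _; have [] := df u x.
have Gub u x : `](t - 1), (t + 1)[%classic u -> setT x -> `|partial1of2 f u x| <= `|x| * phi x.
  move=> _ _; rewrite d1 normrN !normrM (ger0_norm (normal_pdf_ge0 _ _ _)).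
  by rewrite ler_wpM2r ?normal_pdf_ge0// ler_piMr// sin_max.
have G0 (x : R) : 0 <= `|x| * phi x by rewrite mulr_ge0// normal_pdf_ge0.
have := @derivable_under_integral _ _ _ mu f setT measurableT t _ _ Ia intf derf _ G0 integrable_abs_normal_pdf Gub.
have := @differentiation_under_integral _ _ _ mu f setT measurableT t _ _ Ia intf derf _ G0 integrable_abs_normal_pdf Gub.
rewrite derive1E => H1 H2; apply: DeriveDef => //; rewrite H1.
under eq_Rintegral do rewrite d1.
have := integral_F' t.
rewrite /F' RintegralB//; last 2 first.
- exact: (integrableZl measurableT t (integrable_cosphi t)).
- exact: integrable_xsinphi.
rewrite RintegralZl//; last exact: integrable_cosphi.
rewrite -/(g t) => /eqP; rewrite subr_eq0 => /eqP ->.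
under eq_Rintegral do rewrite -mulN1r.
rewrite RintegralZl ?mulN1r//; exact: integrable_xsinphi.
Qed.

(** The equation g' = -t g makes g(t) exp(t^2/2) constant, and g(0) = 1. *)
Lemma cosgaussE (t : R) : g t = expR (- (t ^+ 2 / 2)).
Proof.
have hd (u : R) : is_derive u 1 (fun t => g t * expR (t ^+ 2 / 2)) 0.
  have h := is_derive_cosgauss u.
  apply: is_derive_eq; rewrite /GRing.scale/=.
  by rewrite !mulr0 !mulr1 add0r; field.
have := @is_derive_0_is_cst _ _ t 0 hd.
rewrite [in RHS]expr0n/= mul0r expR0 mulr1.
have -> : g 0 = 1.
  rewrite /g; under eq_Rintegral do rewrite mul0r cos0 mul1r.
  by rewrite /Rintegral integral_normal_pdf.
have e0 : expR (t ^+ 2 / 2) != 0 by rewrite gt_eqF ?expR_gt0.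
by move=> h; apply: (mulIf e0); rewrite h expRN mulVf.
Qed.

Lemma singauss0 t : (\int[mu]_x (sin (t * x) * phi x))%R = 0.
Proof.
set h := fun x : R => sin (t * x) * phi x.
have mh : measurable_fun setT h.
  by apply: measurable_funM; [exact: measurable_sin_mul|exact: measurable_normal_pdf].
have hN (x : R) : h (- x) = - h x.
  by rewrite /h mulrN sinN !normal_pdf01E sqrrN mulNr.
have ih : mu.-integrable setT (EFin \o h).
  apply: le_integrable (@integrable_normal_pdf R 0 1) => //.
    exact/measurable_EFinP.
  by move=> x _ /=; rewrite lee_fin normrM ler_piMl// sin_max.
have E : (\int[mu]_x (h x)%:E = \int[mu]_x (h (- x))%:E)%E.
  transitivity (\int[pushforward mu (-%R : _ -> measurableTypeR R)]_x (h x)%:E)%E.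
    by apply: eq_measure_integral => //= A mA _; exact/esym/lebesgue_measureN.
  have mN : measurable_fun setT (-%R : R -> R) by exact: measurable_funN.
  have mh' : measurable_fun setT (EFin \o h) by exact/measurable_EFinP.
  rewrite integral_pushforward//=.
  have := integrableN ih; apply: eq_integrable => // x _.
  by rewrite /= hN.
have E2 : (\int[mu]_x h x)%R = (\int[mu]_x (-1 * h x))%R.
  rewrite /Rintegral E; congr fine; apply: eq_integral => x _.
  by rewrite hN mulN1r.
move: E2; rewrite RintegralZl// mulN1r.
move: (Rintegral _ _ _) => z hz; lra.
Qed.

End cosgauss.

(** * Families of independent standard Gaussian variables *)

(** Choosing [B i] to be the whole line for some indices gives the product rule on subfamilies, so
    this one identity contains both independence and the standard normal law of every coordinate. *)
Definition std_family {disp} {T : measurableType disp} {R : realType}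
    (Pr : probability T R) (I : finType) (X : I -> T -> R) : Prop :=
  (forall i, measurable_fun setT (X i)) /\
  forall B : I -> set R, (forall i, measurable (B i)) ->
    Pr [set w | forall i, B i (X i w)] = (\prod_i normal_prob 0 1 (B i))%E.

(** Boxes are closed under intersection and generate the product sigma-algebra on functions, so two
    laws that agree on them are equal. *)
Definition boxes (R : realType) (I : finType) : set (set (I -> R)) :=
  [set E | exists B : I -> set R, (forall i, measurable (B i)) /\
    E = [set f | forall i, B i (f i)]].

Definition coords (R : realType) (I : finType) := g_sigma_algebraType (@boxes R I).

(** * Joint laws, and independence as a product space *)

Section law.
Context {R : realType} {I : finType}.
Local Notation gI := (@coords R I).

Lemma measurable_coord (i : I) : measurable_fun setT (fun f : gI => (f i : R)).
Proof.
move=> _ B mB; rewrite setTI; apply: sub_sigma_algebra.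
exists (fun j => if j == i then B else setT); split.
  by move=> j; case: ifP.
apply/seteqP; split => f /=.
  by move=> Bf j; case: eqP => // ->.
by move=> /(_ i); rewrite eqxx.
Qed.

Lemma measurable_to_coords disp (T : measurableType disp) (X : I -> T -> R) :
  (forall i, measurable_fun setT (X i)) ->
  measurable_fun setT (fun w => (fun i => X i w) : gI).
Proof.
move=> mX; apply: (@measurability _ _ _ gI _ _ (@boxes R I)) => //.
move=> _ [_ [B [mB ->] <-]].
rewrite setTI (_ : _ @^-1` _ = \bigcap_(i in [set: I]) (X i @^-1` B i)).
  apply: fin_bigcap_measurable => // i _.
  by rewrite -[X in measurable X]setTI; exact: mX.
by apply/seteqP; split => w /= h i; [move=> _|]; exact: h.
Qed.

Section two.
Context d1 (T1 : measurableType d1) (P1 : probability T1 R) (X1 : I -> T1 -> R)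
  d2 (T2 : measurableType d2) (P2 : probability T2 R) (X2 : I -> T2 -> R).
Hypotheses (s1 : std_family P1 X1) (s2 : std_family P2 X2).

Let Y1 : {mfun T1 >-> gI} := HB.pack (fun w => (fun i => X1 i w) : gI)
  (isMeasurableFun.Build _ _ _ _ _ (measurable_to_coords s1.1)).
Let Y2 : {mfun T2 >-> gI} := HB.pack (fun w => (fun i => X2 i w) : gI)
  (isMeasurableFun.Build _ _ _ _ _ (measurable_to_coords s2.1)).

(** Uniqueness of measures on the boxes. It allows any event in the coordinates to be moved to
    another probability space, in particular to a product space. *)
Lemma std_law (E : set gI) : measurable E ->
  P1 [set w | E (fun i => X1 i w)] = P2 [set w | E (fun i => X2 i w)].
Proof.
move=> mE.
apply: (@measure_unique _ _ gI (@boxes R I) (fun=> setT) _ _ _ _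
   (distribution P1 Y1) (distribution P2 Y2)) => //.
- move=> _ _ [B [mB ->]] [C [mC ->]]; exists (fun i => B i `&` C i); split.
    by move=> i; exact: measurableI.
  apply/seteqP; split => f /=; first by move=> [Bf Cf] i; split.
  by move=> BCf; split=> i; have [] := BCf i.
- by move=> _; exists (fun=> setT); split => //; apply/seteqP; split.
- by apply/seteqP; split => // f _; exists 0%N.
- move=> _ [B [mB ->]]; 
  exact: etrans (s1.2 B mB) (esym (s2.2 B mB)).
- by move=> _; rewrite (le_lt_trans (probability_le1 (distribution P1 Y1) measurableT)) ?ltry.
Qed.

Lemma std_ge0_integral (F : gI -> \bar R) : measurable_fun setT F ->
  (forall x, 0 <= F x)%E ->
  (\int[P1]_w F (fun i => X1 i w) = \int[P2]_w F (fun i => X2 i w))%E.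
Proof.
move=> mF F0.
have := @ge0_integral_distribution _ _ _ _ _ P1 Y1 F mF F0.
have := @ge0_integral_distribution _ _ _ _ _ P2 Y2 F mF F0.
rewrite /= => <- <-.
apply: eq_measure_integral => A mA _; exact: std_law.
Qed.

Lemma std_Rintegral (F : gI -> R) (M : R) : measurable_fun setT F ->
  (forall x, `|F x| <= M) ->
  (\int[P1]_w F (fun i => X1 i w) = \int[P2]_w F (fun i => X2 i w)).
Proof.
move=> mF FM; rewrite /Rintegral; congr fine.
have mF' : measurable_fun setT (EFin \o F) by exact/measurable_EFinP.
have int d (T : measurableType d) (P : probability T R) (Y : {mfun T >-> gI}) :
   P.-integrable setT ((EFin \o F) \o Y).
  apply: (@le_integrable _ _ _ _ _ _ _ (cst M%:E)) => //.
  - exact: measurableT_comp.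
  - move=> w _ /=; rewrite lee_fin; apply: le_trans (ler_norm M); exact: FM.
  - exact: finite_measure_integrable_cst.
have := @integral_distribution _ _ _ _ _ P1 Y1 (EFin \o F) mF' (int _ _ _ _).
have := @integral_distribution _ _ _ _ _ P2 Y2 (EFin \o F) mF' (int _ _ _ _).
rewrite /= => <- <-.
apply: eq_measure_integral => A mA _; exact: std_law.
Qed.

End two.

(** Reading the coordinates in [J] off the first factor and the others off the second leaves the
    joint law unchanged. Together with [std_law] this turns the independence of two groups of
    coordinates into Fubini. *)
Lemma std_split d (T : measurableType d) (P : probability T R) (X : I -> T -> R)
    (J : pred I) : std_family P X ->
  std_family (P \x P)%E (fun i w => if J i then X i w.1 else X i w.2).
Proof.
move=> [mX sX]; split.
  by move=> i; case: (J i); apply: measurableT_comp.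
move=> B mB.
pose B1 i := if J i then B i else setT.
pose B2 i := if J i then setT else B i.
have m1 i : measurable (B1 i) by rewrite /B1; case: ifP.
have m2 i : measurable (B2 i) by rewrite /B2; case: ifP.
have mE (C : I -> set R) : (forall i, measurable (C i)) ->
    measurable [set w | forall i, C i (X i w)].
  move=> mC; rewrite (_ : [set w | _] = \bigcap_(i in [set: I]) (X i @^-1` C i)).
    apply: fin_bigcap_measurable => // i _.
    by rewrite -[X in measurable X]setTI; exact: mX.
  by apply/seteqP; split => w /= h i; [move=> _|]; exact: h.
rewrite (_ : [set w | _] = [set w | forall i, B1 i (X i w)] `*` [set w | forall i, B2 i (X i w)]).
  apply: etrans (product_measure1E P P (mE _ m1) (mE _ m2)) _.
  apply: etrans (congr2 mule (sX _ m1) (sX _ m2)) _.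
  rewrite -big_split/=; apply: eq_bigr => i _.
  by rewrite /B1 /B2; case: ifP => _; rewrite probability_setT ?mule1 ?mul1e.
apply/seteqP; split => -[x y] /=.
  move=> h; split => i; have := h i; rewrite /B1 /B2; by case: ifP.
by move=> [h1 h2] i; have := h1 i; have := h2 i; rewrite /B1 /B2; case: ifP.
Qed.

End law.

Section bounded.
Context {R : realType}.

Lemma bounded_integrable d (T : measurableType d) (P : probability T R) (f : T -> R) (M : R) :
  measurable_fun setT f -> (forall x, `|f x| <= M) -> P.-integrable setT (EFin \o f).
Proof.
move=> mf fM; apply: (@le_integrable _ _ _ _ _ _ _ (cst M%:E)) => //.
- exact/measurable_EFinP.
- by move=> w _ /=; rewrite lee_fin; apply: le_trans (ler_norm M); exact: fM.
- exact: finite_measure_integrable_cst.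
Qed.

Lemma Rint_cst d (T : measurableType d) (P : probability T R) (M : R) :
  \int[P]_x (cst M x) = M.
Proof. by rewrite /Rintegral; have := expectation_cst P M; rewrite unlock => ->. Qed.

Lemma bounded_Rintegral_norm d (T : measurableType d) (P : probability T R) (f : T -> R) (M : R) :
  measurable_fun setT f -> (forall x, `|f x| <= M) -> `|\int[P]_x f x| <= M.
Proof.
move=> mf fM; have i := bounded_integrable P mf fM.
apply: le_trans (le_normr_Rintegral measurableT i) _.
have -> : M = \int[P]_x (cst M x).
  exact/esym/Rint_cst.
apply: le_Rintegral => //.
- exact: integrable_abse i.
- exact: finite_measure_integrable_cst.
Qed.

Lemma bounded_fubini d1 (T1 : measurableType d1) (P1 : probability T1 R)
    d2 (T2 : measurableType d2) (P2 : probability T2 R) (f : T1 * T2 -> R) (M : R) :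
  measurable_fun setT f -> (forall x, `|f x| <= M) ->
  \int[(P1 \x P2)%E]_z f z = \int[P1]_x (\int[P2]_y f (x, y)).
Proof.
move=> mf fM.
have i := bounded_integrable (P1 \x P2)%E mf fM.
rewrite {1}/Rintegral -(integral12_prod_meas1 i); congr fine.
apply: eq_integral => x _; rewrite /fubini_F /Rintegral fineK//.
have mfx : measurable_fun setT (fun y => f (x, y)).
  by apply: measurableT_comp mf _; exact: measurable_pair1.
have := bounded_integrable P2 mfx (fun y => fM (x, y)).
exact: integrable_fin_num.
Qed.

(** Adding the bound [M] makes the integrand nonnegative, so that the formula for nonnegative
    functions applies; the contribution of [M] is then subtracted. *)
Lemma Rintegral_normal_prob (f : R -> R) (M : R) :
  measurable_fun setT f -> (forall x, `|f x| <= M) ->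
  \int[normal_prob 0 1]_x f x =
  \int[@lebesgue_measure R]_x (f x * normal_pdf 0 1 x).
Proof.
move=> mf fM.
have i := bounded_integrable (normal_prob 0 1) mf fM.
have ic : (@normal_prob R 0 1).-integrable setT (EFin \o cst M).
  exact: finite_measure_integrable_cst.
have mfp : measurable_fun setT (fun x => f x * normal_pdf 0 1 x).
  by apply: measurable_funM => //; exact: measurable_normal_pdf.
have iM : (@lebesgue_measure R).-integrable setT (EFin \o (fun x => M * normal_pdf 0 1 x)).
  exact: (integrableZl measurableT M (@integrable_normal_pdf R 0 1)).
have M0 : 0 <= M by apply: le_trans (fM 0).
have ifp : (@lebesgue_measure R).-integrable setT (EFin \o (fun x => f x * normal_pdf 0 1 x)).
  apply: le_integrable iM => //; first exact/measurable_EFinP.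
  move=> x _ /=; rewrite lee_fin !normrM (ger0_norm M0) ler_wpM2r//.
have mfM : measurable_fun setT (fun x => (f x + M)%:E).
  by apply/measurable_EFinP; exact: measurable_funD.
have fM0 x : (0 <= (f x + M)%:E)%E.
  by rewrite lee_fin; have := fM x; rewrite ler_norml => /andP[]; lra.
have : \int[@normal_prob R 0 1]_x (f x + M) =
    \int[@lebesgue_measure R]_x (f x * normal_pdf 0 1 x + M * normal_pdf 0 1 x).
  rewrite /Rintegral (ge0_integral_normal_prob mfM fM0); congr fine.
  by apply: eq_integral => x _; rewrite -EFinM mulrDl.
rewrite RintegralD// RintegralD// RintegralZl//; last exact: integrable_normal_pdf.
rewrite (_ : \int[@normal_prob R 0 1]_x M = M); last exact: Rint_cst.
by rewrite [X in _ = _ + M * X]/Rintegral integral_normal_pdf mulr1 => /eqP H; apply/eqP; rewrite (inj_eq (addIr M)) in H.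
Qed.

Lemma normal_cos (t b : R) :
  \int[normal_prob 0 1]_x cos (t * x + b) = expR (- (t ^+ 2 / 2)) * cos b.
Proof.
rewrite (@Rintegral_normal_prob _ 1); last 2 first.
- apply: (@measurableT_comp _ _ _ _ _ _ (@cos R)).
    by apply: continuous_measurable_fun; exact: continuous_cos.
  by apply: measurable_funD => //; exact: measurable_funM.
- by move=> x; exact: cos_max.
transitivity (\int[@lebesgue_measure R]_x
    (cos b * (cos (t * x) * normal_pdf 0 1 x) - sin b * (sin (t * x) * normal_pdf 0 1 x))).
  by apply: eq_Rintegral => x _; rewrite cosD; ring.
have isn : (@lebesgue_measure R).-integrable setT (EFin \o (fun x => sin (t * x) * normal_pdf 0 1 x)).
  apply: le_integrable (@integrable_normal_pdf R 0 1) => //.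
    apply/measurable_EFinP; apply: measurable_funM; last exact: measurable_normal_pdf.
    exact: measurable_sin_mul.
  by move=> x _ /=; rewrite lee_fin normrM ler_piMl// sin_max.
have ics := integrable_cosphi t.
rewrite RintegralB//; last 2 first.
- exact: (integrableZl measurableT (cos b) ics).
- exact: (integrableZl measurableT (sin b) isn).
rewrite RintegralZl// RintegralZl// cosgaussE singauss0 mulr0 subr0 mulrC//.
Qed.

Section onecoord.
Context d (T : measurableType d) (P : probability T R) (I : finType) (X : I -> T -> R).
Hypothesis sX : std_family P X.

Lemma std_coord_law (i : I) (B : set R) : measurable B -> P (X i @^-1` B) = normal_prob 0 1 B.
Proof.
move=> mB; have := sX.2 (fun j => if j == i then B else setT).
rewrite (_ : [set w | _] = X i @^-1` B); last first.
  apply/seteqP; split => w /=; first by move=> /(_ i); rewrite eqxx.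
  by move=> Bw j; case: eqP => // ->.
move=> ->; last by move=> j; case: ifP.
rewrite (bigD1 i)//= eqxx big1 ?mule1// => j /negbTE ->.
by rewrite probability_setT.
Qed.

Let mXi i : measurable_fun setT (X i : T -> measurableTypeR R).
Proof. exact: sX.1. Qed.

Let Xi i : {mfun T >-> measurableTypeR R} :=
  HB.pack (X i : T -> measurableTypeR R) (isMeasurableFun.Build _ _ _ _ _ (@mXi i)).

Lemma std_coord_ge0_integral (i : I) (F : R -> \bar R) :
  measurable_fun setT F -> (forall x, 0 <= F x)%E ->
  (\int[P]_w F (X i w) = \int[normal_prob 0 1]_x F x)%E.
Proof.
move=> mF F0; have := @ge0_integral_distribution _ _ _ _ _ P (Xi i) F mF F0.
rewrite /= => <-. apply: eq_measure_integral => A mA _; exact: std_coord_law.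
Qed.

Lemma std_coord_Rintegral (i : I) (F : R -> R) (M : R) :
  measurable_fun setT F -> (forall x, `|F x| <= M) ->
  \int[P]_w F (X i w) = \int[normal_prob 0 1]_x F x.
Proof.
move=> mF FM; rewrite /Rintegral; congr fine.
have mF' : measurable_fun setT (EFin \o F) by exact/measurable_EFinP.
have mFX : measurable_fun setT (F \o Xi i) by exact: (measurableT_comp mF (sX.1 i)).
have := @integral_distribution _ _ _ _ _ P (Xi i) (EFin \o F) mF' (bounded_integrable P mFX (fun w => FM (Xi i w))).
rewrite /= => <-; apply: eq_measure_integral => A mA _; exact: std_coord_law.
Qed.

End onecoord.

(** One factor is split off at a time: its coordinate is read off the first component of the product
    space, all others off the second. *)
Lemma std_prod_integral (I : finType) d (T : measurableType d) (P : probability T R) 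
   (X : I -> T -> R) (f : I -> R -> R) (r : seq I) : uniq r ->
  std_family P X -> (forall i, measurable_fun setT (f i)) -> (forall i x, 0 <= f i x) ->
  (\int[P]_w (\prod_(i <- r) f i (X i w))%:E = \prod_(i <- r) \int[normal_prob 0 1]_x (f i x)%:E)%E.
Proof.
move=> ur sX mf f0; elim: r ur => [_|i0 r IH /andP[i0r ur]].
  under eq_integral do rewrite big_nil.
  rewrite big_nil; have := expectation_cst P 1; by rewrite unlock.
rewrite big_cons -IH//.
pose F (x : coords R I) := (\prod_(i <- i0 :: r) f i (x i))%:E.
have mprod (s : seq I) : measurable_fun setT (fun x : coords R I => \prod_(i <- s) f i (x i)).
  apply: measurable_prod => i _ ; apply: measurableT_comp => //; exact: measurable_coord.
have mF : measurable_fun setT F by apply/measurable_EFinP; exact: mprod.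
have F0 x : (0 <= F x)%E by rewrite lee_fin prodr_ge0.
have sY := std_split (pred1 i0) sX.
rewrite (std_ge0_integral sX sY mF F0).
have mX := sX.1.
rewrite (@fubini_tonelli1 _ _ _ _ _ P P); last 2 first.
- apply: (measurableT_comp mF); apply: (measurable_to_coords sY.1).
- by move=> z; exact: F0.
rewrite /fubini_F /F.
have mr : measurable_fun setT (fun w => (\prod_(i <- r) f i (X i w))%:E).
  apply/measurable_EFinP; apply: measurable_prod => i _.
  exact: measurableT_comp.
have r0 w : (0 <= (\prod_(i <- r) f i (X i w))%:E)%E by rewrite lee_fin prodr_ge0.
transitivity (\int[P]_x ((f i0 (X i0 x))%:E * \int[P]_w (\prod_(i <- r) f i (X i w))%:E))%E.
  apply: eq_integral => x _; rewrite -ge0_integralZl ?lee_fin//.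
  apply: eq_integral => y _; rewrite big_cons/= eqxx -EFinM; congr (_ * _)%:E.
  apply: eq_big_seq => j jr; case: eqP => // ji; by rewrite -ji jr in i0r.
rewrite ge0_integralZr//; last 3 first.
- by apply/measurable_EFinP; exact: measurableT_comp.
- by move=> x _; rewrite lee_fin.
- by apply: integral_ge0.
congr (_ * _)%E.
apply: (std_coord_ge0_integral sX i0 (F := EFin \o f i0)) => //.
exact/measurable_EFinP.
by move=> x; rewrite lee_fin f0.
Qed.

(** The phase [b] is arbitrary because of the induction: integrating the tail first leaves the head
    coordinate as part of the phase. *)
Lemma std_cos (I : finType) d (T : measurableType d) (P : probability T R) 
   (X : I -> T -> R) (v : I -> R) (b : R) (r : seq I) : uniq r ->
  std_family P X -> 
  \int[P]_w cos (\sum_(i <- r) v i * X i w + b) = expR (- ((\sum_(i <- r) v i ^+ 2) / 2)) * cos b.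
Proof.
move=> ur sX; elim: r ur b => [_ b|i0 r IH /andP[i0r ur] b].
  under eq_Rintegral do rewrite big_nil add0r.
  rewrite big_nil mul0r oppr0 expR0 mul1r; exact: Rint_cst.
pose F (x : coords R I) := cos (\sum_(i <- i0 :: r) v i * x i + b).
have mcos : measurable_fun setT (@cos R).
  by apply: continuous_measurable_fun; exact: continuous_cos.
have mF : measurable_fun setT F.
  apply: (measurableT_comp mcos); apply: measurable_funD => //.
  apply: measurable_sum => i; apply: measurable_funM => //; exact: measurable_coord.
have F1 x : `|F x| <= 1 by exact: cos_max.
have sY := std_split (pred1 i0) sX.
rewrite (std_Rintegral sX sY mF F1).
have mX := sX.1.
rewrite (@bounded_fubini _ _ P _ _ P _ 1); last 2 first.
- apply: (measurableT_comp mF); apply: (measurable_to_coords sY.1).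
- by move=> z; exact: F1.
rewrite /F.
transitivity (\int[P]_x (expR (- ((\sum_(i <- r) v i ^+ 2) / 2)) * cos (v i0 * X i0 x + b))).
  apply: eq_Rintegral => x _; rewrite -(IH ur); apply: eq_Rintegral => y _.
  congr cos; rewrite big_cons/= eqxx [RHS]addrCA -addrA; congr (_ + (_ + _)).
  apply: eq_big_seq => j jr; case: eqP => // ji; by rewrite -ji jr in i0r.
rewrite RintegralZl//; last first.
  apply: (@bounded_integrable _ _ _ _ 1) => [|x]; last exact: cos_max.
  apply: (measurableT_comp mcos); apply: measurable_funD => //; exact: measurable_funM.
rewrite (std_coord_Rintegral sX i0 (F := fun y => cos (v i0 * y + b)) (M := 1)); last 2 first.
- apply: (measurableT_comp mcos); apply: measurable_funD => //; exact: measurable_funM.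
- by move=> x; exact: cos_max.
rewrite normal_cos mulrA -expRD big_cons; congr (expR _ * _).
by rewrite mulrDl opprD addrC.
Qed.

End bounded.

(** * Faces of a polytope and measurability of vf *)

Section dots.
Context {R : realType} {d : nat}.
Implicit Types u v w : 'rV[R]_d.

Lemma dotC u v : dot u v = dot v u.
Proof. by apply: eq_bigr => i _; rewrite mulrC. Qed.

Lemma dotDr u v w : dot u (v + w) = dot u v + dot u w.
Proof. by rewrite -big_split; apply: eq_bigr => i _; rewrite mxE mulrDr. Qed.

Lemma dotZr (a : R) u v : dot u (a *: v) = a * dot u v.
Proof. by rewrite mulr_sumr; apply: eq_bigr => i _; rewrite mxE mulrCA. Qed.

Lemma dotNr u v : dot u (- v) = - dot u v.
Proof. by rewrite -scaleN1r dotZr mulN1r. Qed.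

Lemma dotBr u v w : dot u (v - w) = dot u v - dot u w.
Proof. by rewrite dotDr dotNr. Qed.

Lemma dot0r u : dot u 0 = 0.
Proof. by apply: big1 => i _; rewrite mxE mulr0. Qed.

Lemma dotDl u v w : dot (v + w) u = dot v u + dot w u.
Proof. by rewrite !(dotC _ u) dotDr. Qed.

Lemma dotZl (a : R) u v : dot (a *: v) u = a * dot v u.
Proof. by rewrite !(dotC _ u) dotZr. Qed.

Lemma dotNl u v : dot (- v) u = - dot v u.
Proof. by rewrite !(dotC _ u) dotNr. Qed.

Lemma dotBl u v w : dot (v - w) u = dot v u - dot w u.
Proof. by rewrite !(dotC _ u) dotBr. Qed.

Lemma dot0l u : dot 0 u = 0.
Proof. by rewrite dotC dot0r. Qed.

Lemma dot_sumr (I : Type) (r : seq I) (P : pred I) (F : I -> 'rV[R]_d) u :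
  dot u (\sum_(i <- r | P i) F i) = \sum_(i <- r | P i) dot u (F i).
Proof. exact: (big_morph (dot u) (dotDr u) (dot0r u)). Qed.

Lemma dot_suml (I : Type) (r : seq I) (P : pred I) (F : I -> 'rV[R]_d) u :
  dot (\sum_(i <- r | P i) F i) u = \sum_(i <- r | P i) dot (F i) u.
Proof. by rewrite dotC dot_sumr; apply: eq_bigr => i _; rewrite dotC. Qed.

Lemma dot_ge0 u : 0 <= dot u u.
Proof. by apply: sumr_ge0 => i _; rewrite -expr2 sqr_ge0. Qed.

Lemma dot_eq0 u : (dot u u == 0) = (u == 0).
Proof.
apply/idP/eqP => [|->]; last by rewrite dot0l.
rewrite psumr_eq0 => [/allP h|i _]; last by rewrite -expr2 sqr_ge0.
apply/rowP => j; rewrite mxE; have := h j (mem_index_enum j).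
by rewrite mulf_eq0 orbb => /eqP.
Qed.

Lemma enorm_ge0 u : 0 <= enorm u. Proof. exact: sqrtr_ge0. Qed.

Lemma dot_delta u (j : 'I_d) : dot u (delta_mx 0 j) = u 0 j.
Proof.
rewrite /dot (bigD1 j)//= mxE !eqxx mulr1 big1 ?addr0// => i /negbTE ij.
by rewrite mxE ij mulr0.
Qed.

Lemma dot_mulmx u v : dot u v = (u *m v^T) 0 0.
Proof. by rewrite mxE; apply: eq_bigr => i _; rewrite mxE. Qed.

End dots.

Section faces.
Context {R : realType} {d n : nat}.
Variable p : 'I_n -> 'rV[R]_d.
Local Notation P := (conv_hull (range p)).

(** The coefficients are functions on all of ['I_n] that vanish off [J], so that hulls of different
    index sets use sums over the same type. *)
Definition convJ (J : {set 'I_n}) : set 'rV[R]_d :=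
  [set x | exists a : 'I_n -> R, [/\ forall i, 0 <= a i, forall i, i \notin J -> a i = 0,
     \sum_i a i = 1 & x = \sum_i a i *: p i]].

Definition affJ (J : {set 'I_n}) : set 'rV[R]_d :=
  [set x | exists a : 'I_n -> R, [/\ forall i, i \notin J -> a i = 0,
     \sum_i a i = 1 & x = \sum_i a i *: p i]].

Lemma conv_hull_range : P = convJ [set: 'I_n]%SET.
Proof.
apply/seteqP; split => x.
  move=> [k [a [q [a0 a1 qX xE]]]].
  have /choice [f fE] : forall i : 'I_k, exists j : 'I_n, p j = q i.
    by move=> i; have [j _ <-] := qX i; exists j.
  exists (fun j => \sum_(i | f i == j) a i); split.
  - by move=> j; apply: sumr_ge0.
  - by move=> j; rewrite inE.
  - rewrite -a1 [RHS](partition_big f xpredT)//=.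
  - rewrite xE [LHS](partition_big f xpredT)//=; apply: eq_bigr => j _.
    rewrite scaler_suml; apply: eq_bigr => i /eqP <-; by rewrite fE.
move=> [a [a0 _ a1 xE]]; exists n, a, p; split => // i; by exists i.
Qed.

Lemma p_conv i : P (p i).
Proof.
rewrite conv_hull_range; exists (fun j => (j == i)%:R); split.
- by move=> j; rewrite ler0n.
- by move=> j; rewrite inE.
- by rewrite (bigD1 i)//= eqxx big1 ?addr0// => j /negbTE ->.
- by rewrite (bigD1 i)//= eqxx scale1r big1 ?addr0// => j /negbTE ->; rewrite scale0r.
Qed.

Lemma p_convJ (J : {set 'I_n}) i : i \in J -> convJ J (p i).
Proof.
move=> iJ; exists (fun j => (j == i)%:R); split.
- by move=> j; rewrite ler0n.
- by move=> j; case: eqP => // ->; rewrite iJ.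
- by rewrite (bigD1 i)//= eqxx big1 ?addr0// => j /negbTE ->.
- by rewrite (bigD1 i)//= eqxx scale1r big1 ?addr0// => j /negbTE ->; rewrite scale0r.
Qed.

Lemma aff_hull_convJ (J : {set 'I_n}) : aff_hull (convJ J) = affJ J.
Proof.
apply/seteqP; split => x.
  move=> [k [a [q [a1 qX xE]]]].
  have /choice [c cE] := qX.
  exists (fun j => \sum_i a i * c i j); split.
  - by move=> j jJ; apply: big1 => i _; have [_ -> //] := cE i; rewrite mulr0.
  - rewrite exchange_big/= -a1; apply: eq_bigr => i _; rewrite -mulr_sumr.
    by have [_ _ -> _] := cE i; rewrite mulr1.
  - rewrite xE; under [RHS]eq_bigr do rewrite scaler_suml.
    rewrite exchange_big/=; apply: eq_bigr => i _; have [_ _ _ ->] := cE i.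
    by rewrite scaler_sumr; apply: eq_bigr => j _; rewrite scalerA.
move=> [a [a0 a1 xE]].
have [i0 i0J] : exists i0, i0 \in J.
  apply/existsP; apply: contraT; rewrite negb_exists => /forallP h.
  have : \sum_i a i = 0 by apply: big1 => i _; apply: a0; exact: h.
  by rewrite a1 => /eqP; rewrite oner_eq0.
exists n, a, (fun i => if i \in J then p i else p i0); split => //.
  by move=> i; case: ifP => // iJ; exact: p_convJ.
rewrite xE; apply: eq_bigr => i _; case: ifPn => // iJ; by rewrite a0 // !scale0r.
Qed.

(** A face is encoded by the set of all indices of points on its supporting hyperplane. There are
    finitely many candidates [J], so events about faces become finite unions. *)
Definition exposes (u : 'rV[R]_d) (b : R) (J : {set 'I_n}) : Prop :=
  (forall i, i \in J -> dot u (p i) = b) /\ (forall i, i \notin J -> dot u (p i) < b).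

Lemma exposes_face u b J : exposes u b J ->
  (forall x, P x -> dot u x <= b) /\ P `&` [set x | dot u x = b] = convJ J.
Proof.
move=> [eJ ltJ].
have le i : dot u (p i) <= b.
  by have [/eJ -> //|/ltJ /ltW] := boolP (i \in J).
rewrite conv_hull_range; split.
  move=> x [a [a0 _ a1 ->]]; rewrite dot_sumr -[b]mul1r -a1 mulr_suml.
  by apply: ler_sum => i _; rewrite dotZr ler_wpM2l.
apply/seteqP; split => x.
  move=> [[a [a0 _ a1 ->]]] /= E; exists a; split => // i iJ.
  (* A point of the hull on the hyperplane puts no weight off [J]: the weighted gaps are nonnegative
     and sum to 0. *)
  have h : \sum_i a i * (b - dot u (p i)) = 0.
    under eq_bigr do rewrite mulrBr.
    rewrite sumrB -mulr_suml a1 mul1r -E dot_sumr.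
    by under [X in _ - X]eq_bigr do rewrite -dotZr; rewrite subrr.
  have := psumr_eq0P _ h => /(_ _ i isT).
  have c j : true -> 0 <= a j * (b - dot u (p j)) by move=> _; rewrite mulr_ge0// subr_ge0.
  move=> /(_ c) /eqP; rewrite mulf_eq0 subr_eq0 => /orP[/eqP//|/eqP bE].
  by have := ltJ _ iJ; rewrite -bE ltxx.
move=> [a [a0 aJ a1 ->]]; split; first by exists a; split => // i; rewrite inE.
rewrite /= dot_sumr -[RHS]mul1r -a1 mulr_suml; apply: eq_bigr => i _; rewrite dotZr.
by have [/eJ -> //|/aJ ->] := boolP (i \in J); rewrite !mul0r.
Qed.

Lemma face_exposes F : is_face P F ->
  exists u b J, exposes u b J /\ F = convJ J.
Proof.
move=> [u [b [le ->]]]; exists u, b, [set i | dot u (p i) == b]%SET.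
have e : exposes u b [set i | dot u (p i) == b]%SET.
  split => i; rewrite inE; first by move/eqP.
  by move=> ne; rewrite lt_neqAle ne le//; exact: p_conv.
by split => //; have [_ ->] := exposes_face e.
Qed.

Lemma exposes_is_face u b J : exposes u b J -> is_face P (convJ J).
Proof. by move=> e; have [h1 h2] := exposes_face e; exists u, b; rewrite h2. Qed.

Lemma exposes_mem u b J i : exposes u b J -> convJ J (p i) <-> i \in J.
Proof.
move=> e; split; last exact: p_convJ.
have [_ <-] := exposes_face e; move=> [_ /= E]; apply: contraT => /(e.2 _).
by rewrite E ltxx.
Qed.

(** The points need not be distinct, so a vertex is exposed by a set of indices whose points all
    coincide. *)
Definition is_vert (i : 'I_n) : Prop :=
  exists u b J, [/\ exposes u b J, i \in J & forall j, j \in J -> p j = p i].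

Lemma verticesE x : vertices P x <-> exists2 i, x = p i & is_vert i.
Proof.
split.
  move=> /face_exposes [u [b [J [e E]]]].
  have : [set x] x by [].
  rewrite E => -[a [a0 aJ a1 xE]].
  have [i iJ] : exists i0, i0 \in J.
    apply/existsP; apply: contraT; rewrite negb_exists => /forallP h.
    have : \sum_i a i = 0 by apply: big1 => i _; apply: aJ; exact: h.
    by rewrite a1 => /eqP; rewrite oner_eq0.
  have pj j : j \in J -> p j = x by move=> /p_convJ; rewrite -E.
  exists i; first by rewrite pj.
  by exists u, b, J; split => // j /pj ->; rewrite pj.
move=> [i -> [u [b [J [e iJ h]]]]].
suff : [set p i] = convJ J by move=> /= E; rewrite /vertices /= E; exact: exposes_is_face e.
apply/seteqP; split => y; first by move=> ->; exact: p_convJ.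
move=> [a [a0 aJ a1 ->]] /=.
rewrite -[RHS]scale1r -a1 scaler_suml; apply: eq_bigr => j _.
by have [/h -> //|/aJ ->] := boolP (j \in J); rewrite !scale0r.
Qed.

Lemma enorm_dist_bound (X Y : set 'rV[R]_d) :
  has_lbound [set r | exists x y, [/\ X x, Y y & r = enorm (x - y)]].
Proof. by exists 0 => _ [x [y [_ _ ->]]]; exact: enorm_ge0. Qed.

Lemma dist_ge0 (X Y : set 'rV[R]_d) : 0 <= dist X Y.
Proof.
rewrite /dist; set S := [set _ | _].
have [->|S0] := eqVneq S set0; first by rewrite inf0.
apply: lb_le_inf; first exact/set0P.
by move=> _ [x [y [_ _ ->]]]; exact: enorm_ge0.
Qed.

(** The first alternative comes from [inf set0 = 0]: the distance to an empty set counts as 0, which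
    is below [r]. *)
Lemma dist_lt (X Y : set 'rV[R]_d) (r : R) : 0 < r -> X !=set0 ->
  dist X Y < r <-> (forall y, ~ Y y) \/ exists x y, [/\ X x, Y y & enorm (x - y) < r].
Proof.
move=> r0 [x0 Xx0]; split.
  move=> h; have [[y Yy]|Y0] := pselect (Y !=set0); last first.
    by left => y Yy; apply: Y0; exists y.
  right; have := h; move/inf_lt => [].
    by exists (enorm (x0 - y)), x0, y.
  by move=> _ [x [z [Xx Yz ->]]] lt; exists x, z.
move=> [Y0|[x [y [Xx Yy lt]]]].
  rewrite /dist (_ : [set _ | _] = set0) ?inf0//.
  by apply/seteqP; split => // r' [x [y [_ Yy _]]]; exact: (Y0 y).
by apply: le_lt_trans lt; apply: ge_inf; [exact: enorm_dist_bound|exists x, y].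
Qed.

Definition facetJ (J : {set 'I_n}) : Prop :=
  (exists u b, exposes u b J) /\
  exists k, has_dim (convJ [set: 'I_n]%SET) k.+1 /\ has_dim (convJ J) k.

(** The purpose is measurability: a strict bound on an infimum is an existence statement, and after
    the encoding by index sets it ranges over finitely many [J] and [i]. Both degenerate
    alternatives come from [inf set0 = 0]. *)
Lemma vf_lt (r : R) : 0 < r ->
  vf P < r <->
  (forall J, ~ facetJ J) \/
  exists2 J, facetJ J &
   (forall i, i \notin J -> ~ is_vert i) \/
   exists i, [/\ i \notin J, is_vert i & exists2 x, affJ J x & enorm (x - p i) < r].
Proof.
move=> r0.
have facetE F : is_facet P F <-> exists2 J, F = convJ J & facetJ J.
  rewrite /is_facet /facetJ -conv_hull_range; split.
    by move=> [/face_exposes [u [b [J [e ->]]]] H]; exists J => //; split; first by exists u, b.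
  by move=> [J -> [[u [b e]] H]]; split; first exact: exposes_is_face e.
have dlt J : facetJ J -> dist (aff_hull (convJ J)) (vertices P `\` convJ J) < r <->
   (forall i, i \notin J -> ~ is_vert i) \/
   exists i, [/\ i \notin J, is_vert i & exists2 x, affJ J x & enorm (x - p i) < r].
  move=> [[u [b e]] [k [_ [x0 [W [_ E]]]]]].
  have ne : affJ J !=set0.
    rewrite -aff_hull_convJ E; exists (x0 + 0 *m W); by exists 0.
  rewrite aff_hull_convJ; split.
    move/(dist_lt _ r0 ne) => [h|[x [y [xJ [/verticesE [i -> vi] nJ] lt]]]].
      left => i iJ vi; apply: (h (p i)); split; first by apply/verticesE; exists i.
      by move/(exposes_mem i e); exact/negP.
    right; exists i; split => //; last by exists x.
    by apply/negP => iJ; apply: nJ; exact: p_convJ.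
  move=> H; apply/(dist_lt _ r0 ne); case: H => [h|[i [iJ vi [x xJ lt]]]].
    left => y [/verticesE [i -> vi] nJ]; apply: (h i) => //.
    by apply/negP => iJ; apply: nJ; exact: p_convJ.
  right; exists x, (p i); split => //; split; first by apply/verticesE; exists i.
  by move/(exposes_mem i e); exact/negP.
rewrite /vf; set S := [set _ | _ in _].
have lb : has_lbound S by exists 0 => _ [F _ <-]; exact: dist_ge0.
split.
  move=> h; have [[s Ss]|S0] := pselect (S !=set0); last first.
    left => J fJ; apply: S0; exists (dist (aff_hull (convJ J)) (vertices P `\` convJ J)).
    by exists (convJ J) => //; apply/facetE; exists J.
  right; have [|y [F /facetE [J -> fJ] yE] lt] := inf_lt _ h; first by exists s.
  rewrite -yE in lt.
  by exists J => //; apply/dlt.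
move=> [h|[J fJ H]].
  rewrite (_ : S = set0) ?inf0//; apply/seteqP; split => // r' [F /facetE [J _ fJ] _].
  exact: (h J).
apply: (@le_lt_trans _ _ (dist (aff_hull (convJ J)) (vertices P `\` convJ J))).
  by apply: ge_inf => //; exists (convJ J) => //; apply/facetE; exists J.
exact/dlt.
Qed.

End faces.

(** * Dimension as a matrix rank *)

Section hasdim.
Context {R : realType} {d n : nat}.
Variable p : 'I_n -> 'rV[R]_d.

(** Indices off [J] give zero rows, so the matrix has the same format for every [J]. Its row space
    is the direction space of the affine hull. *)
Definition diffmx (J : {set 'I_n}) (i0 : 'I_n) : 'M[R]_(n, d) :=
  \matrix_i (if i \in J then p i - p i0 else 0).

Lemma affJ_diffmx (J : {set 'I_n}) i0 : i0 \in J ->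
  affJ p J = [set p i0 + u *m diffmx J i0 | u in [set: 'rV[R]_n]].
Proof.
move=> i0J; apply/seteqP; split => x.
  move=> [a [aJ a1 ->]]; exists (\row_i a i) => //.
  rewrite mulmx_sum_row -[p i0]scale1r -a1 scaler_suml -big_split/=.
  apply: eq_bigr => i _; rewrite mxE rowK.
  have [iJ|/aJ ->] := boolP (i \in J); last by rewrite !scale0r addr0.
  by rewrite -scalerDr addrC subrK.
move=> [u _ <-].
exists (fun i => (if i \in J then u 0 i else 0) + (1 - \sum_(j in J) u 0 j) * (i == i0)%:R).
split.
- move=> i iJ; rewrite (negbTE iJ); case: eqP => [ii|_]; first by rewrite ii i0J in iJ.
  by rewrite mulr0 addr0.
- rewrite big_split/= -mulr_sumr -big_mkcond/=.
  have -> : \sum_(i < n) (i == i0)%:R = 1 :> R.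
    by rewrite (bigD1 i0)//= eqxx big1 ?addr0// => i /negbTE ->.
  by rewrite mulr1 addrC subrK.
- have -> : u *m diffmx J i0 =
      \sum_(i in J) u 0 i *: p i - (\sum_(i in J) u 0 i) *: p i0.
    rewrite mulmx_sum_row scaler_suml -sumrB [RHS]big_mkcond/=.
    apply: eq_bigr => i _; rewrite rowK; case: ifP => _; last by rewrite scaler0.
    by rewrite scalerBr.
  under [RHS]eq_bigr do rewrite scalerDl.
  rewrite big_split/= [X in _ = _ + X](bigD1 i0)//= eqxx mulr1 [X in _ = _ + (_ + X)]big1; last first.
    by move=> i /negbTE ->; rewrite mulr0 scale0r.
  rewrite addr0 scalerBl scale1r addrCA; congr (_ + _).
  rewrite big_mkcond; apply: eq_bigr => i _; case: ifP => _ //.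
  by rewrite scale0r.
Qed.

(** Differences of points of an affine space lie in its direction space, so the row spaces of [W]
    and of the difference matrix contain each other. *)
Lemma has_dim_convJ (J : {set 'I_n}) i0 k : i0 \in J ->
  has_dim (convJ p J) k <-> \rank (diffmx J i0) = k.
Proof.
move=> i0J; set D := diffmx J i0; have E := affJ_diffmx i0J.
rewrite /has_dim aff_hull_convJ E -/D; split.
  move=> [x0 [W [fW H]]].
  move: fW; rewrite /row_free => /eqP <-.
  have inW (u : 'rV[R]_n) : exists v : 'rV[R]_k, p i0 + u *m D = x0 + v *m W.
    have : [set p i0 + u *m D | u in [set: 'rV[R]_n]] (p i0 + u *m D) by exists u.
    by rewrite H => -[v _ <-]; exists v.
  have inD (v : 'rV[R]_k) : exists u : 'rV[R]_n, p i0 + u *m D = x0 + v *m W.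
    have : [set x0 + u *m W | u in [set: 'rV[R]_k]] (x0 + v *m W) by exists v.
    by rewrite -H => -[u _ <-]; exists u.
  apply/eqP; rewrite eqn_leq !mxrankS//; apply/row_subP => i.
    have [v0] := inD 0; rewrite mul0mx addr0 => e0.
    have [u1] := inD (row i 1%:M); rewrite -row_mul mul1mx => e1.
    have -> : row i W = (u1 - v0) *m D.
      have -> : row i W = (p i0 + u1 *m D) - (p i0 + v0 *m D).
        by rewrite e1 e0 addrAC subrr add0r.
      by rewrite opprD addrACA subrr add0r mulmxBl.
    exact: submxMl.
  have [v0] := inW 0; rewrite mul0mx addr0 => e0.
  have [u1] := inW (row i 1%:M); rewrite -row_mul mul1mx => e1.
  have -> : row i D = (u1 - v0) *m W.
    have -> : row i D = (x0 + u1 *m W) - (x0 + v0 *m W).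
      by rewrite -e1 -e0 addrAC subrr add0r.
    by rewrite opprD addrACA subrr add0r mulmxBl.
  exact: submxMl.
move=> <-; exists (p i0), (row_base D); split; first exact: row_base_free.
apply/seteqP; split => x [u _ <-].
  have : (u *m D <= row_base D)%MS by rewrite eq_row_base submxMl.
  by move=> /submxP [v ->]; exists v.
have : (u *m row_base D <= D)%MS by rewrite -(eq_row_base D) submxMl.
by move=> /submxP [v ->]; exists v.
Qed.

Lemma has_dim_nonempty (J : {set 'I_n}) k : has_dim (convJ p J) k -> exists i, i \in J.
Proof.
move=> [x0 [W [_]]]; rewrite aff_hull_convJ => H.
have : [set x0 + u *m W | u in [set: 'rV[R]_k]] x0 by exists 0 => //; rewrite mul0mx addr0.
rewrite -H => -[a [aJ a1 _]].
apply/existsP; apply: contraT; rewrite negb_exists => /forallP h.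
have : \sum_i a i = 0 by apply: big1 => i _; apply: aJ; exact: h.
by rewrite a1 => /eqP; rewrite oner_eq0.
Qed.

End hasdim.

Lemma minor_rank (F : fieldType) (m n k : nat) (A : 'M[F]_(m, n)) (f : 'I_k -> 'I_m) (g : 'I_k -> 'I_n) :
  \det (mxsub f g A) != 0 -> (k <= \rank A)%N.
Proof.
rewrite -unitfE -unitmxE => /mxrank_unit <-.
have -> : mxsub f g A = rowsub f 1%:M *m A *m colsub g 1%:M.
  by rewrite mul_rowsub_mx mul1mx mulmx_colsub mulmx1 mxsubcr.
by apply: leq_trans (mxrankM_maxl _ _) _; exact: mxrankM_maxr.
Qed.

(** With [minor_rank] this characterises the rank by nonvanishing minors, which are polynomials in
    the entries; hence rank events are measurable. *)
Lemma rank_minor (F : fieldType) (m n : nat) (A : 'M[F]_(m, n)) :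
  exists (f : 'I_(\rank A) -> 'I_m) (g : 'I_(\rank A) -> 'I_n), \det (mxsub f g A) != 0.
Proof.
pose f := maxrankfun A; pose B := rowsub f A.
have rB : row_full B^T.
  by rewrite /row_full mxrank_tr; exact: maxrowsub_free.
exists f, (fullrankfun rB).
rewrite -unitfE -unitmxE -unitmx_tr.
have := fullrowsub_unit rB; congr (_ \in unitmx).
by apply/matrixP => i j; rewrite !mxE.
Qed.

Section measrank.
Context {disp} {T : measurableType disp} {R : realType}.

Lemma measurable_det (k : nat) (A : T -> 'M[R]_k) :
  (forall i j, measurable_fun setT (fun w => A w i j)) ->
  measurable_fun setT (fun w => \det (A w)).
Proof.
move=> mA; rewrite /determinant; apply: measurable_sum => s.
apply: measurable_funM => //; exact: measurable_prod.
Qed.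

Lemma measurable_neq0 (f : T -> R) : measurable_fun setT f -> measurable [set w | f w != 0].
Proof.
move=> mf; have -> : [set w | f w != 0] = setT `&` f @^-1` (~` [set 0]).
  by rewrite setTI; apply/seteqP; split => w /= /eqP.
by apply: mf => //; exact: measurableC.
Qed.

Lemma measurable_minor (m n k : nat) (A : T -> 'M[R]_(m, n)) :
  (forall i j, measurable_fun setT (fun w => A w i j)) ->
  measurable [set w | exists (f : 'I_k -> 'I_m) (g : 'I_k -> 'I_n), \det (mxsub f g (A w)) != 0].
Proof.
move=> mA.
have -> : [set w | exists (f : 'I_k -> 'I_m) (g : 'I_k -> 'I_n), \det (mxsub f g (A w)) != 0] =
  \bigcup_(fg in [set: {ffun 'I_k -> 'I_m} * {ffun 'I_k -> 'I_n}]) [set w | \det (mxsub fg.1 fg.2 (A w)) != 0].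
  apply/seteqP; split => w.
    move=> [f [g h]]; exists (finfun f, finfun g) => //=.
    by rewrite (_ : mxsub _ _ _ = mxsub f g (A w))//; apply/matrixP => i j; rewrite !mxE !ffunE.
  by move=> [[f g] _ h]; exists f, g.
apply: fin_bigcup_measurable => // -[f g] _; apply: measurable_neq0.
apply: measurable_det => i j; under eq_fun do rewrite mxE; exact: mA.
Qed.

Lemma measurable_rank (m n k : nat) (A : T -> 'M[R]_(m, n)) :
  (forall i j, measurable_fun setT (fun w => A w i j)) ->
  measurable [set w | \rank (A w) = k].
Proof.
move=> mA.
pose M k := [set w | exists (f : 'I_k -> 'I_m) (g : 'I_k -> 'I_n), \det (mxsub f g (A w)) != 0].
have -> : [set w | \rank (A w) = k] = M k `&` \bigcap_(j in [set j | (k < j)%N]) ~` M j.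
  apply/seteqP; split => w /=.
    move=> <-; split; first exact: rank_minor.
    by move=> j /= kj [f [g /minor_rank]]; rewrite leqNgt kj.
  move=> [[f [g /minor_rank h]] H]; apply/eqP; rewrite eqn_leq h andbT leqNgt.
  by apply/negP => kr; apply: (H _ kr); exact: rank_minor.
apply: measurableI; first exact: measurable_minor.
apply: bigcap_measurable => [|j _]; last by apply: measurableC; exact: measurable_minor.
by exists k.+1 => /=.
Qed.

End measrank.

(** * Countable descriptions of exposing functionals *)

Section density.
Context {R : realType}.

(** A strict inequality for a continuous function is open, so a real witness can be replaced by a
    rational one, and an uncountable union by a countable one. *)
Lemma rat_dense (n : nat) (f : 'rV[R]_n -> R) (u : 'rV[R]_n) (r e : R) :
  {for u, continuous f} -> f u < r -> 0 < e ->
  exists q : 'rV[rat]_n, f (map_mx ratr q) < r /\ forall j, `|ratr (q 0 j) - u 0 j| < e.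
Proof.
move=> cf fu e0.
have : \forall v \near u, f v < r by exact: (cvgr_lt _ cf _ fu).
move=> /nbhs_ballP [e1 /= e10 H].
pose e2 := Num.min e e1.
have e20 : 0 < e2 by rewrite lt_min e0.
have /choice [q qE] : forall j : 'I_n, exists q : rat, `|ratr q - u 0 j| < e2.
  move=> j; have : u 0 j - e2 < u 0 j + e2 by lra.
  move=> /rat_in_itvoo [q]; rewrite in_itv/= => qE; exists q.
  by rewrite ltr_distl.
exists (\row_j q j); split; last first.
  by move=> j; rewrite mxE; apply: lt_le_trans (qE j) _; rewrite ge_min lexx.
apply: H; split => // i j; rewrite !mxE (ord1 i) /ball/= distrC.
by apply: lt_le_trans (qE j) _; rewrite ge_min lexx orbT.
Qed.

End density.

Lemma coord_continuous' {R : realType} (n : nat) (j : 'I_n) : continuous (fun u : 'rV[R]_n => u 0 j).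
Proof. exact: coord_continuous. Qed.

Lemma continuous_sumr {R : realType} {V : topologicalType} (I : Type) (r : seq I) (P : pred I) (f : I -> V -> R) :
  (forall i, P i -> continuous (f i)) -> continuous (fun x => \sum_(i <- r | P i) f i x).
Proof.
move=> cf; elim: r => [|i r IH].
  have -> : (fun x => \sum_(i <- [::] | P i) f i x) = cst 0 by apply/funext => x; rewrite big_nil.
  exact: cst_continuous.
have [Pi|nPi] := boolP (P i).
  have -> : (fun x => \sum_(i <- i :: r | P i) f i x) = (fun x => f i x + \sum_(i <- r | P i) f i x).
    by apply/funext => x; rewrite big_cons Pi.
  by move=> x; apply: cvgD; [exact: cf|exact: IH].
have -> : (fun x => \sum_(i <- i :: r | P i) f i x) = (fun x => \sum_(i <- r | P i) f i x).
  by apply/funext => x; rewrite big_cons (negbTE nPi).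
exact: IH.
Qed.

Lemma continuous_dot {R : realType} (n : nat) (v : 'rV[R]_n) : continuous (fun u : 'rV[R]_n => dot u v).
Proof.
apply: continuous_sumr => i _ x.
by apply: continuousM; [exact: coord_continuous|exact: cst_continuous].
Qed.

Lemma continuous_dotD {R : realType} (n : nat) (v : 'rV[R]_n) (c : R) :
  continuous (fun u : 'rV[R]_n => dot u v + c).
Proof.
have h := @continuous_dot R n v => x.
apply: (@continuousD R R^o _ (fun u : 'rV[R]_n => dot u v) (fun=> c) x); [exact: h|exact: cst_continuous].
Qed.

Section expose.
Context {R : realType} {d n : nat}.
Variable p : 'I_n -> 'rV[R]_d.

(** Rescaling [u] makes all gaps off [J] at least 1. So [J] can be exposed exactly when this
    continuous nonnegative function has a zero. *)
Definition viol (J : {set 'I_n}) (i0 : 'I_n) (u : 'rV[R]_d) : R :=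
  \sum_(i < n) (if i \in J then `|dot u (p i - p i0)| else Num.max 0 (dot u (p i - p i0) + 1)).

Lemma viol_ge0 J i0 u : 0 <= viol J i0 u.
Proof. by apply: sumr_ge0 => i _; case: ifP => _ //; rewrite le_max lexx. Qed.

Lemma viol_eq0 (J : {set 'I_n}) i0 u : i0 \in J -> viol J i0 u = 0 -> exposes p u (dot u (p i0)) J.
Proof.
move=> i0J /psumr_eq0P => h.
have {}h i : (if i \in J then `|dot u (p i - p i0)| else Num.max 0 (dot u (p i - p i0) + 1)) = 0.
  by apply: h => // j _; case: ifP => _ //; rewrite le_max lexx.
split => i iJ; have := h i.
  by rewrite iJ => /normr0_eq0; rewrite dotBr => /eqP; rewrite subr_eq0 => /eqP.
rewrite (negbTE iJ) dotBr => e.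
have : dot u (p i) - dot u (p i0) + 1 <= 0 by rewrite -[leRHS]e le_max lexx orbT.
lra.
Qed.

Lemma exposes_viol (J : {set 'I_n}) i0 u b : i0 \in J -> exposes p u b J -> exists v, viol J i0 v = 0.
Proof.
move=> i0J [eJ ltJ].
pose e := \big[Num.min/1]_(i < n | i \notin J) (b - dot u (p i)).
have e0 : 0 < e.
  apply: lt_bigmin => // i iJ; rewrite subr_gt0; exact: ltJ.
exists (e^-1 *: u); apply: big1 => i _; rewrite dotZl dotBr (eJ _ i0J).
case: ifPn => iJ; first by rewrite eJ// subrr mulr0 normr0.
have h : 1 <= e^-1 * (b - dot u (p i)).
  rewrite mulrC ler_pdivlMr// mul1r; exact: bigmin_le_cond.
by apply/max_idPl; lra.
Qed.

Lemma continuous_viol J i0 : continuous (viol J i0).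
Proof.
have cd i : continuous (fun u : 'rV[R]_d => dot u (p i - p i0)).
  exact: continuous_dot.
apply: continuous_sumr => i _; case: (i \in J) => x.
  apply: (@continuous_comp _ _ _ (fun u : 'rV[R]_d => dot u (p i - p i0)) (fun x : R => `|x|)).
    exact: cd.
  exact: norm_continuous.
apply: (@continuous_max R _ (cst 0) (fun u : 'rV[R]_d => dot u (p i - p i0) + 1)).
  exact: cst_continuous.
by apply: continuousD; [exact: cd|exact: cst_continuous].
Qed.

(** The bound [k] confines the rational vectors to a compact box, on which the values of [viol] form
    a closed set; values arbitrarily close to 0 then force an actual zero. All quantifiers on the
    right are countable. *)
Lemma exposesP (J : {set 'I_n}) i0 : i0 \in J ->
  (exists u b, exposes p u b J) <->
  exists k : nat, forall l : nat, exists q : 'rV[rat]_d,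
    (forall j, `|ratr (q 0 j)| <= k%:R :> R) /\ viol J i0 (map_mx ratr q) < l.+1%:R^-1.
Proof.
move=> i0J; split.
  move=> [u [b /(exposes_viol i0J) [v v0]]].
  have [k kE] : exists k : nat, forall j, `|v 0 j| <= k%:R.
    exists (Num.bound (\sum_j `|v 0 j|)) => j.
    apply: le_trans (ltW (archi_boundP _)); last by apply: sumr_ge0.
    by rewrite (bigD1 j)//= lerDl sumr_ge0.
  (* The extra 1 absorbs the distance between [v] and its rational approximation. *)
  exists k.+1 => l.
  have vl : viol J i0 v < l.+1%:R^-1 by rewrite v0 invr_gt0 ltr0n.
  have [q [q1 q2]] := rat_dense (@continuous_viol J i0 v) vl ltr01.
  exists q; split => // j; have := q2 j; have := kE j.
  rewrite -natr1 -[X in `|X| <= _ + 1](subrK (v 0 j)) => h1 h2.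
  by apply: le_trans (ler_normD _ _) _; lra.
move=> [k H].
pose K := [set u : 'rV[R]_d | forall j, `[(- k%:R : R), (k%:R : R)]%classic (u 0 j)].
have cK : compact K.
  by apply: (@rV_compact _ _ (fun=> `[(- k%:R : R), (k%:R : R)]%classic)) => _; exact: segment_compact.
have cI : compact (viol J i0 @` K).
  by apply: continuous_compact => //; apply: continuous_subspaceT; exact: continuous_viol.
have clI := compact_closed (@Rhausdorff R) cI.
have [u _ uE] : (viol J i0 @` K) 0.
  apply: clI => A /nbhs_ballP [e /= e0 eA].
  have [l le] : exists l : nat, l.+1%:R^-1 < e.
    exists (Num.bound e^-1); rewrite invf_plt ?posrE//.
    apply: lt_le_trans (archi_boundP _) _; first by rewrite invr_ge0 ltW.
    by rewrite ler_nat.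
  have [q [q1 q2]] := H l.
  exists (viol J i0 (map_mx ratr q)); split.
    by exists (map_mx ratr q) => // j /=; rewrite mxE in_itv/= -ler_norml.
  apply: eA; rewrite /ball/= sub0r normrN ger0_norm ?viol_ge0//.
  exact: lt_trans le.
by exists u, (dot u (p i0)); exact: viol_eq0.
Qed.

Lemma affJ_rat (J : {set 'I_n}) i0 i (r : R) : i0 \in J ->
  (exists2 x, affJ p J x & enorm (x - p i) < r) <->
  exists q : 'rV[rat]_n, enorm (p i0 + map_mx ratr q *m diffmx p J i0 - p i) < r.
Proof.
move=> i0J; rewrite (affJ_diffmx _ i0J); split; last first.
  by move=> [q lt]; exists (p i0 + map_mx ratr q *m diffmx p J i0) => //; exists (map_mx ratr q).
move=> [_ [u _ <-]] lt.
pose f u := enorm (p i0 + u *m diffmx p J i0 - p i).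
suff cf : {for u, continuous f} by have [q [qE _]] := rat_dense cf lt ltr01; exists q.
pose g (u : 'rV[R]_n) := dot (p i0 + u *m diffmx p J i0 - p i) (p i0 + u *m diffmx p J i0 - p i).
suff cg : {for u, continuous g}.
  by apply: (@continuous_comp _ _ _ g Num.sqrt); [exact: cg|exact: sqrt_continuous].
move: u {lt}; apply: continuous_sumr => j _ x.
have c : continuous (fun u : 'rV[R]_n => (p i0 + u *m diffmx p J i0 - p i) 0 j).
  have -> : (fun u : 'rV[R]_n => (p i0 + u *m diffmx p J i0 - p i) 0 j) =
    (fun u : 'rV[R]_n => dot u (\row_k diffmx p J i0 k j) + (p i0 - p i) 0 j).
    apply/funext => u; rewrite !mxE addrAC addrC; congr (_ + _).
    by apply: eq_bigr => k _; rewrite !mxE.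
  exact: continuous_dotD.
by apply: continuousM; exact: c.
Qed.

End expose.

Section meas.
Context {disp} {T : measurableType disp} {R : realType} {d n : nat}.
Variable p : T -> 'I_n -> 'rV[R]_d.
Hypothesis mp : forall i j, measurable_fun setT (fun w => p w i 0 j).

Lemma measurable_fun_dot (u v : T -> 'rV[R]_d) :
  (forall j, measurable_fun setT (fun w => u w 0 j)) ->
  (forall j, measurable_fun setT (fun w => v w 0 j)) ->
  measurable_fun setT (fun w => dot (u w) (v w)).
Proof. by move=> mu mv; apply: measurable_sum => j; apply: measurable_funM. Qed.

Lemma measurable_lt (f : T -> R) (r : R) : measurable_fun setT f -> measurable [set w | f w < r].
Proof.
move=> mf; have -> : [set w | f w < r] = setT `&` f @^-1` `]-oo, r[%classic.
  by rewrite setTI; apply/seteqP; split => w /=; rewrite in_itv.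
exact: mf.
Qed.

Lemma measurable_diff i i0 j : measurable_fun setT (fun w => (p w i - p w i0) 0 j).
Proof. by under eq_fun do rewrite !mxE; apply: measurable_funB. Qed.

Lemma measurable_exposes (J : {set 'I_n}) i0 : i0 \in J ->
  measurable [set w | exists u b, exposes (p w) u b J].
Proof.
move=> i0J.
have -> : [set w | exists u b, exposes (p w) u b J] =
  \bigcup_k \bigcap_l \bigcup_(q in [set: 'rV[rat]_d])
    ([set w | forall j, `|ratr (q 0 j)| <= k%:R :> R] `&` [set w | viol (p w) J i0 (map_mx ratr q) < l.+1%:R^-1]).
  apply/seteqP; split => w.
    move=> /(exposesP (p w) i0J) [k H]; exists k => // l _.
    by have [q [q1 q2]] := H l; exists q.
  move=> [k _ H]; apply/(exposesP (p w) i0J); exists k => l.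
  by have [q _ [q1 q2]] := H l I; exists q.
apply: bigcupT_measurable => k; apply: bigcapT_measurable => l.
apply: countable_bigcupT_measurable => // q; apply: measurableI.
  have [h|h] := pselect (forall j, `|ratr (q 0 j)| <= k%:R :> R).
    by rewrite (_ : [set w | _] = setT)//; apply/seteqP; split.
  by rewrite (_ : [set w | _] = set0)//; apply/seteqP; split.
apply: measurable_lt; apply: measurable_sum => i.
have md : measurable_fun setT (fun w => dot (map_mx ratr q) (p w i - p w i0)).
  by apply: measurable_fun_dot => // j; exact: measurable_diff.
case: (i \in J); first exact: measurableT_comp.
by apply: measurable_maxr => //; exact: measurable_funD.
Qed.

Lemma measurable_has_dim (J : {set 'I_n}) k : measurable [set w | has_dim (convJ (p w) J) k].
Proof.
have [->|[i0 i0J]] := set_0Vmem J.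
  rewrite (_ : [set w | _] = set0)//; apply/seteqP; split => // w /=.
  by move=> /has_dim_nonempty [i]; rewrite inE.
have -> : [set w | has_dim (convJ (p w) J) k] = [set w | \rank (diffmx (p w) J i0) = k].
  by apply/seteqP; split => w /=; move/(has_dim_convJ (p w) k i0J).
apply: measurable_rank => i j.
under eq_fun do rewrite /diffmx mxE.
case: (i \in J); first exact: measurable_diff.
by under eq_fun do rewrite mxE; exact: measurable_cst.
Qed.

Lemma measurable_facetJ (J : {set 'I_n}) : measurable [set w | facetJ (p w) J].
Proof.
have [->|[i0 i0J]] := set_0Vmem J.
  rewrite (_ : [set w | _] = set0)//; apply/seteqP; split => // w /=.
  by move=> [_ [k [_ /has_dim_nonempty [i]]]]; rewrite inE.
have -> : [set w | facetJ (p w) J] = [set w | exists u b, exposes (p w) u b J] `&`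
   \bigcup_k ([set w | has_dim (convJ (p w) [set: 'I_n]%SET) k.+1] `&` [set w | has_dim (convJ (p w) J) k]).
  apply/seteqP; split => w /=.
    by move=> [h [k [h1 h2]]]; split => //; exists k.
  by move=> [h [k _ [h1 h2]]]; split => //; exists k.
apply: measurableI; first exact: measurable_exposes i0J.
by apply: bigcupT_measurable => k; apply: measurableI; exact: measurable_has_dim.
Qed.

Lemma measurable_eqpt i j : measurable [set w | p w i = p w j].
Proof.
have -> : [set w | p w i = p w j] = \bigcap_(k in [set: 'I_d]) ~` [set w | (p w i - p w j) 0 k != 0].
  apply/seteqP; split => w /=.
    by move=> h k _ /=; rewrite h subrr mxE eqxx.
  move=> H; apply/rowP => k; have := H k I => /= /negP; rewrite negbK !mxE subr_eq0.
  by move/eqP.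
apply: fin_bigcap_measurable => [|k _]; first exact: finite_finset.
  apply: measurableC; apply: measurable_neq0.
exact: measurable_diff.
Qed.

Lemma measurable_is_vert i : measurable [set w | is_vert (p w) i].
Proof.
have -> : [set w | is_vert (p w) i] = \bigcup_(J in [set J : {set 'I_n} | i \in J])
   ([set w | exists u b, exposes (p w) u b J] `&` \bigcap_(j in [set j | j \in J]) [set w | p w j = p w i]).
  apply/seteqP; split => w.
    by move=> [u [b [J [e iJ h]]]]; exists J => //; split; [exists u, b|].
  by move=> [J iJ [[u [b e]] h]]; exists u, b, J.
apply: fin_bigcup_measurable => [|J iJ]; first exact: finite_finset.
  apply: measurableI.
  exact: measurable_exposes iJ.
by apply: fin_bigcap_measurable => [|j _]; [exact: finite_finset|exact: measurable_eqpt].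
Qed.

Lemma measurable_affdist (J : {set 'I_n}) i (r : R) :
  measurable [set w | exists2 x, affJ (p w) J x & enorm (x - p w i) < r].
Proof.
have [->|[i0 i0J]] := set_0Vmem J.
  rewrite (_ : [set w | _] = set0)//; apply/seteqP; split => // w /=.
  move=> [x [a [a0 a1 _]] _].
  have : \sum_i a i = 0 by apply: big1 => k _; apply: a0; rewrite inE.
  by rewrite a1 => /eqP; rewrite oner_eq0.
have -> : [set w | exists2 x, affJ (p w) J x & enorm (x - p w i) < r] =
  \bigcup_(q in [set: 'rV[rat]_n]) [set w | enorm (p w i0 + map_mx ratr q *m diffmx (p w) J i0 - p w i) < r].
  apply/seteqP; split => w /=.
    by move=> /(affJ_rat (p w) i r i0J) [q lt]; exists q.
  by move=> [q _ lt]; apply/(affJ_rat (p w) i r i0J); exists q.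
apply: countable_bigcupT_measurable => // q; apply: measurable_lt.
have mc j : measurable_fun setT (fun w => (p w i0 + map_mx ratr q *m diffmx (p w) J i0 - p w i) 0 j).
  under eq_fun do rewrite !mxE.
  apply: measurable_funB => //; apply: measurable_funD => //; apply: measurable_sum => k.
  under eq_fun do rewrite /diffmx !mxE.
  apply: measurable_funM => //; case: (k \in J); first exact: measurable_diff.
  by under eq_fun do rewrite mxE; exact: measurable_cst.
apply: (@measurableT_comp _ _ _ _ _ _ (@Num.sqrt R)).
  by apply: continuous_measurable_fun; exact: sqrt_continuous.
exact: measurable_fun_dot.
Qed.

Lemma measurable_vf_lt (r : R) : 0 < r ->
  measurable [set w | vf (conv_hull (range (p w))) < r].
Proof.
move=> r0.
have -> : [set w | vf (conv_hull (range (p w))) < r] =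
  (\bigcap_(J in [set: {set 'I_n}]) ~` [set w | facetJ (p w) J]) `|`
  \bigcup_(J in [set: {set 'I_n}]) ([set w | facetJ (p w) J] `&`
    ((\bigcap_(i in [set i | i \notin J]) ~` [set w | is_vert (p w) i]) `|`
     \bigcup_(i in [set i | i \notin J]) ([set w | is_vert (p w) i] `&`
        [set w | exists2 x, affJ (p w) J x & enorm (x - p w i) < r]))).
  apply/seteqP; split => w /=.
    move/(vf_lt (p w) r0) => [h|[J fJ h]]; first by left => J _; exact: h.
    right; exists J => //; split => //; case: h => [h|[i [iJ vi h]]].
      by left => i iJ; exact: h.
    by right; exists i.
  move=> H; apply/(vf_lt (p w) r0); case: H => [h|[J _ [fJ h]]].
    by left => J; exact: h.
  right; exists J => //; case: h => [h|[i iJ [vi h]]]; first by left => i; exact: h.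
  by right; exists i.
apply: measurableU.
  apply: fin_bigcap_measurable => [|J _]; first exact: finite_finset.
  apply: measurableC; exact: measurable_facetJ.
apply: fin_bigcup_measurable => [|J _]; first exact: finite_finset.
  apply: measurableI; first exact: measurable_facetJ.
apply: measurableU.
  apply: fin_bigcap_measurable => [|i _]; first exact: finite_finset.
  apply: measurableC; exact: measurable_is_vert.
apply: fin_bigcup_measurable => [|i _]; first exact: finite_finset.
  apply: measurableI; first exact: measurable_is_vert.
exact: measurable_affdist.
Qed.

(** A countable intersection of strict bounds, the only form in which [vf_lt] describes the
    event. *)
Lemma measurable_vf_le (r : R) : 0 < r ->
  measurable [set w | vf (conv_hull (range (p w))) <= r].
Proof.
move=> r0.
have -> : [set w | vf (conv_hull (range (p w))) <= r] =
  \bigcap_l [set w | vf (conv_hull (range (p w))) < r + l.+1%:R^-1].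
  apply/seteqP; split => w /=.
    by move=> h l _ /=; apply: le_lt_trans h _; rewrite ltrDl invr_gt0 ltr0n.
  move=> H; apply/ler_addgt0Pr => e e0.
  have le : (Num.bound e^-1).+1%:R^-1 <= e.
    rewrite invf_ple ?posrE// ltW//.
    apply: lt_le_trans (archi_boundP _) _; first by rewrite invr_ge0 ltW.
    by rewrite ler_nat.
  have := H (Num.bound e^-1) I => /= /ltW h; apply: le_trans h _; by rewrite lerD2l.
apply: bigcapT_measurable => l; apply: measurable_vf_lt.
by rewrite addr_gt0// invr_gt0 ltr0n.
Qed.

End meas.

(** * Vertices close to a facet *)

Lemma mulmx_tr_dot {R : realType} {d n : nat} (w : 'rV[R]_d) (A : 'M[R]_(n, d)) i :
  (w *m A^T) 0 i = dot w (row i A).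
Proof. by rewrite mxE; apply: eq_bigr => j _; rewrite !mxE. Qed.

Lemma dot_sub_scale {R : realType} {d : nat} (u y : 'rV[R]_d) (t : R) :
  dot (u - t *: y) (u - t *: y) = dot u u - 2 * t * dot u y + t ^+ 2 * dot y y.
Proof. by rewrite dotBl !dotBr !dotZl !dotZr (dotC y u); ring. Qed.

(** * Pivoting to a vertex of the polar polytope *)

Section pivot.
Context {R : realType} {d m : nat}.
Variable q : 'I_m -> 'rV[R]_d.
Hypothesis q_int : forall u, u != 0 -> exists i, 0 < dot u (q i).

(** The constraints that are tight at a point [u] of the polar polytope, given by [dot u (q i) <= 1]
    for all [i]. Full column rank means that [u] is a vertex of the polar, that is, the normal of a
    facet of the hull of [q]. *)
Definition tightmx (u : 'rV[R]_d) : 'M[R]_(m, d) :=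
  \matrix_i (if dot u (q i) == 1 then q i else 0).

(** A step of the simplex method: move along a direction [w] that keeps the tight constraints tight
    and does not decrease the objective, until a new constraint becomes tight. [q_int] ensures that
    one does. *)
Lemma pivot_step (u v : 'rV[R]_d) : (forall i, dot u (q i) <= 1) ->
  ~~ row_full (tightmx u) ->
  exists u', [/\ forall i, dot u' (q i) <= 1, dot u v <= dot u' v &
    (\rank (tightmx u) < \rank (tightmx u'))%N].
Proof.
move=> fu nfull.
have [w0 w0ker w0n0] : exists2 w : 'rV[R]_d, (w <= kermx (tightmx u)^T)%MS & w != 0.
  have : kermx (tightmx u)^T != 0.
    rewrite -mxrank_eq0 mxrank_ker mxrank_tr subn_eq0 -ltnNge ltn_neqAle rank_leq_col andbT.
    exact: nfull.
  by move=> /rowV0Pn [w h1 h2]; exists w.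
have [w [wn0 wv wt]] : exists w, [/\ w != 0, 0 <= dot w v & forall i, dot u (q i) = 1 -> dot w (q i) = 0].
  have t0 i : dot u (q i) = 1 -> dot w0 (q i) = 0.
    move=> ui; have /sub_kermxP/matrixP/(_ 0 i) := w0ker.
    by rewrite mulmx_tr_dot rowK ui eqxx mxE.
  have [h|h] := leP 0 (dot w0 v); first by exists w0.
  exists (- w0); rewrite oppr_eq0 w0n0 dotNl oppr_ge0 ltW//; split => // i /t0.
  by rewrite dotNl => ->; rewrite oppr0.
have [i1 wi1] := q_int wn0.
(* The ratio test: [sl i] is the step length at which constraint [i] becomes tight, and the smallest
   one is taken. *)
pose sl i := (1 - dot u (q i)) / dot w (q i).
case: (@arg_minP _ R 'I_m i1 (fun i => 0 < dot w (q i)) sl) => // i2 wi2 min2.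
have s0 : 0 <= sl i2 by rewrite divr_ge0 ?subr_ge0 ?fu ?ltW.
pose u' := u + sl i2 *: w.
have u'E i : dot u' (q i) = dot u (q i) + sl i2 * dot w (q i) by rewrite dotDl dotZl.
have u't i : dot u (q i) = 1 -> dot u' (q i) = 1.
  by move=> ui; rewrite u'E wt// mulr0 addr0.
have u'2 : dot u' (q i2) = 1.
  by rewrite u'E /sl divfK ?gt_eqF// subrKC.
exists u'; split.
- move=> i; rewrite u'E; have [wi|wi] := ltP 0 (dot w (q i)); last first.
    have := fu i; have : sl i2 * dot w (q i) <= 0 by rewrite mulr_ge0_le0. lra.
  have := min2 _ wi; rewrite {2}/sl ler_pdivlMr//; lra.
- by rewrite dotDl dotZl lerDl mulr_ge0.
apply: rank_ltmx; rewrite ltmxE; apply/andP; split.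
  apply/row_subP => i; rewrite rowK; case: eqP => [ui|_]; last exact: sub0mx.
  have -> : q i = row i (tightmx u') by rewrite rowK u't ?eqxx.
  exact: row_sub.
(* The new tight row is not a combination of the old ones, since [w] is orthogonal to those but not
   to [q i2]. *)
apply/negP => sub.
have : (row i2 (tightmx u') <= tightmx u)%MS by apply: submx_trans sub; exact: row_sub.
rewrite rowK u'2 eqxx => /submxP [D qE].
have : dot w (q i2) = 0; last by move=> e; rewrite e ltxx in wi2.
rewrite qE mulmx_sum_row dot_sumr; apply: big1 => i _; rewrite dotZr rowK.
by case: eqP => [/wt ->|_]; rewrite ?dot0r mulr0.
Qed.

Lemma pivot (u v : 'rV[R]_d) : (forall i, dot u (q i) <= 1) ->
  exists u', [/\ forall i, dot u' (q i) <= 1, dot u v <= dot u' v & row_full (tightmx u')].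
Proof.
move: {2}(d - _)%N (leqnn (d - \rank (tightmx u))) => k.
elim: k u => [|k IH] u ku fu.
  exists u; split => //; rewrite /row_full eqn_leq rank_leq_col/=.
  by rewrite -subn_eq0 -leqn0.
have [full|nfull] := boolP (row_full (tightmx u)); first by exists u.
have [u1 [f1 v1 r1]] := pivot_step v fu nfull.
have [|u2 [f2 v2 r2]] := IH u1 _ f1.
  rewrite -ltnS; apply: leq_trans ku; rewrite ltn_sub2l//.
  by rewrite (leq_trans r1)// rank_leq_col.
by exists u2; split => //; exact: le_trans v2.
Qed.

End pivot.

Section separation.
Context {R : realType} {d m : nat}.
Variable p : 'I_m -> 'rV[R]_d.

Lemma compact_min (T : topologicalType) (K : set T) (f : T -> R) :
  compact K -> K !=set0 -> {within K, continuous f} ->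
  exists2 x, K x & forall y, K y -> f x <= f y.
Proof.
move=> cK [x0 Kx0] cf.
have cI : compact (f @` K) by exact: continuous_compact.
have clI := compact_closed (@Rhausdorff R) cI.
have [b [_ bB]] := compact_bounded cI.
have lb : has_lbound (f @` K).
  exists (- (b + 1)) => y fy; have := bB (b + 1); rewrite ltrDl ltr01 => /(_ isT _ fy).
  by rewrite /= ler_norml => /andP[].
have hi : has_inf (f @` K) by split => //; exists (f x0), x0.
have [x Kx xE] : (f @` K) (inf (f @` K)).
  apply: clI => A /nbhs_ballP [e /= e0 eA].
  have [y fy ylt] := inf_adherent e0 hi.
  exists y; split => //; apply: eA; rewrite /ball/= distrC ger0_norm ?subr_ge0.
    by rewrite ltrBlDl.
  exact: ge_inf.
exists x => // y Ky; rewrite xE; apply: ge_inf => //; by exists y.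
Qed.

(** The functional is the vector from the nearest point of the hull to [x]. The minimum is taken
    over the compact simplex [K] of coefficients, of which the hull is a linear image. *)
Lemma separation (x : 'rV[R]_d) : (0 < m)%N -> ~ conv_hull (range p) x ->
  exists u, forall i, dot u (p i) < dot u x.
Proof.
move=> m0; rewrite conv_hull_range => nx.
pose K := [set l : 'rV[R]_m | (forall j, `[0, 1]%classic (l 0 j)) /\ dot l (const_mx 1) = 1].
pose P := \matrix_i p i.
pose f (l : 'rV[R]_m) := dot (x - l *m P) (x - l *m P).
have cK : compact K.
  have -> : K = [set l : 'rV[R]_m | forall j, `[(0:R), 1]%classic (l 0 j)] `&` [set l : 'rV[R]_m | dot l (const_mx 1) = 1].
    by [].
  apply: compact_closedI.
    by apply: (@rV_compact _ _ (fun=> `[(0:R), 1]%classic)) => _; exact: segment_compact.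
  have -> : [set l : 'rV[R]_m | dot l (const_mx 1) = 1] = (fun l => dot l (const_mx 1)) @^-1` [set 1] by [].
  by apply: closed_comp; [move=> y _; exact: continuous_dot|exact: closed_eq].
have K0 : K !=set0.
  exists (delta_mx 0 (Ordinal m0)); split.
    by move=> j; rewrite /= in_itv/= mxE eqxx/=; case: eqP => _; rewrite ?lexx ?ler01.
  by rewrite dotC dot_delta mxE.
have cf : continuous f.
  have cc j : continuous (fun l : 'rV[R]_m => (x - l *m P) 0 j).
    have -> : (fun l : 'rV[R]_m => (x - l *m P) 0 j) = (fun l : 'rV[R]_m => dot l (\row_k (- P k j)) + x 0 j).
      apply/funext => l; rewrite !mxE addrC; congr (_ + _).
      by rewrite -sumrN; apply: eq_bigr => k _; rewrite !mxE mulrN.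
    exact: continuous_dotD.
  by apply: continuous_sumr => j _ y; apply: continuousM; exact: cc.
have [l Kl lmin] := compact_min cK K0 (continuous_subspaceT cf).
exists (x - l *m P) => i; set u := x - l *m P.
have u0 : 0 < dot u u.
  rewrite lt_neqAle dot_ge0 andbT eq_sym dot_eq0 subr_eq0; apply/eqP => xE.
  apply: nx; exists (fun i => l 0 i); split.
  - by move=> j; have := Kl.1 j; rewrite /= in_itv/= => /andP[].
  - by move=> j; rewrite inE.
  - by rewrite -Kl.2; apply: eq_bigr => j _; rewrite mxE mulr1.
  - by rewrite xE mulmx_sum_row; apply: eq_bigr => j _; rewrite rowK.
have xE : x = u + l *m P by rewrite subrK.
pose y := p i - l *m P.
have h (t : R) : 0 <= t <= 1 -> dot u u <= dot (u - t *: y) (u - t *: y).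
  move=> /andP[t0 t1]; pose l' := (1 - t) *: l + t *: delta_mx 0 i.
  have Kl' : K l'.
    split => [j|].
      have := Kl.1 j; rewrite /= !in_itv/= !mxE eqxx/= => /andP[a0 a1].
      have [b0 b1] : 0 <= (j == i)%:R :> R /\ (j == i)%:R <= 1 :> R by case: eqP.
      apply/andP; split; nra.
    by rewrite dotDl !dotZl Kl.2 (dotC (delta_mx 0 i)) dot_delta mxE; ring.
  have := lmin _ Kl'; rewrite /f -/u.
  suff -> : x - l' *m P = u - t *: y by [].
  rewrite /l' mulmxDl -!scalemxAl -rowE rowK /y /u.
  rewrite scalerBl scale1r scalerBr !opprB !opprD !addrA; congr (_ + _).
  by rewrite addrAC opprK addrAC.
have uy : dot u y <= 0.
  rewrite leNgt; apply/negP => uy.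
  have yy := dot_ge0 y.
  have E t : dot (u - t *: y) (u - t *: y) = dot u u - 2 * t * dot u y + t ^+ 2 * dot y y.
    exact: dot_sub_scale.
  (* A step towards [p i] short enough for the linear gain 2 t dot(u,y) to exceed the quadratic loss
     t^2 dot(y,y), against minimality. *)
  pose t := Num.min 1 (dot u y / (dot y y + 1)).
  have yy1 : 0 < dot y y + 1 by lra.
  have t0 : 0 < t by rewrite lt_min ltr01 divr_gt0.
  have t1 : t <= 1 by rewrite ge_min lexx.
  have t2 : t * (dot y y + 1) <= dot u y by rewrite -ler_pdivlMr// ge_min lexx orbT.
  have := h t; rewrite E (ltW t0) t1 => /(_ isT).
  have : t * dot y y <= dot u y by nra.
  move=> h3; have : t * (t * dot y y) <= t * dot u y by rewrite ler_pM2l.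
  have : 0 < t * dot u y by rewrite mulr_gt0.
  rewrite expr2; lra.
move: uy; rewrite /y dotBr subr_le0 => uy; apply: le_lt_trans uy _.
by rewrite xE [in ltRHS]dotDr ltrDr.
Qed.

End separation.

Section slab.
Context {R : realType} {d n : nat}.
Variable p : 'I_n -> 'rV[R]_d.

Lemma is_vert_self i : (forall j, j != i -> dot (p i) (p j) < dot (p i) (p i)) -> is_vert p i.
Proof.
move=> h; exists (p i), (dot (p i) (p i)), [set i]%SET; split.
- split => j; rewrite inE; first by move/eqP ->.
  exact: h.
- by rewrite inE.
- by move=> j; rewrite inE => /eqP ->.
Qed.

(** The rank condition makes the affine hull of the facet the whole hyperplane, so it contains the
    foot of the perpendicular from [p ia]. The point [p ia] off the hyperplane raises the rank of
    all differences to d, which is the dimension part of being a facet. *)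
Lemma vf_lt_slab (u : 'rV[R]_d) (b : R) (J : {set 'I_n}) i0 ia (s : R) :
  dot u u = 1 -> exposes p u b J -> i0 \in J -> ia \notin J -> is_vert p ia ->
  (d <= (\rank (diffmx p J i0)).+1)%N -> `|b - dot u (p ia)| < s ->
  vf (conv_hull (range p)) < s.
Proof.
move=> uu e i0J iaJ va rk lts.
have s0 : 0 < s by apply: le_lt_trans lts.
have u0 : u != 0 by apply/eqP => u0; move: uu; rewrite u0 dot0l => /eqP; rewrite eq_sym oner_eq0.
set D := diffmx p J i0.
have Dker : (D <= kermx u^T)%MS.
  apply/row_subP => i; apply/sub_kermxP; apply/matrixP => a c; rewrite (ord1 a) (ord1 c).
  rewrite rowK -dot_mulmx mxE; case: ifP => iJ; last by rewrite dot0l.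
  by rewrite dotBl !(dotC _ u) (e.1 i)// (e.1 i0)// subrr.
have rku : \rank u = 1%N by rewrite rank_rV u0.
have rker : \rank (kermx u^T) = (d - 1)%N by rewrite mxrank_ker mxrank_tr rku.
have d0 : (0 < d)%N by rewrite lt0n; apply/eqP => d0; have := rank_leq_col u; rewrite rku d0.
have rD : \rank D = (d - 1)%N.
  apply/eqP; rewrite eqn_leq -{1}rker mxrankS//=.
  by rewrite leq_subLR add1n.
have DE : (D == kermx u^T)%MS by rewrite -(mxrank_leqif_eq Dker) rD rker.
have xJ x : dot u x = b -> affJ p J x.
  move=> xb; rewrite (affJ_diffmx _ i0J).
  have : (x - p i0 <= kermx u^T)%MS.
    apply/sub_kermxP; apply/matrixP => a c; rewrite (ord1 a) (ord1 c).
    by rewrite -dot_mulmx mxE dotBl !(dotC _ u) xb (e.1 i0)// subrr.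
  rewrite -(eqmxP DE) => /submxP [w wE]; exists w => //.
  by rewrite -wE addrC subrK.
apply/(vf_lt p s0); right; exists J.
  split; first by exists u, b.
  exists (\rank D); split; last by apply/(has_dim_convJ _ _ i0J).
  have i0T : i0 \in [set: 'I_n]%SET by rewrite inE.
  apply/(has_dim_convJ _ _ i0T).
  apply/eqP; rewrite eqn_leq rD subn1 prednK// rank_leq_col/=.
  have : (\rank D < \rank (diffmx p [set: 'I_n]%SET i0))%N.
    apply: rank_ltmx; rewrite ltmxE; apply/andP; split.
      apply/row_subP => i; rewrite rowK; case: ifP => iJ; last exact: sub0mx.
      have -> : p i - p i0 = row i (diffmx p [set: 'I_n]%SET i0) by rewrite rowK inE.
      exact: row_sub.
    apply/negP => sub.
    have : (row ia (diffmx p [set: 'I_n]%SET i0) <= kermx u^T)%MS.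
      by apply: submx_trans Dker; apply: submx_trans sub; exact: row_sub.
    rewrite rowK inE => /sub_kermxP /matrixP /(_ 0 0).
    rewrite -dot_mulmx mxE dotBl !(dotC _ u) (e.1 i0)// => /eqP; rewrite subr_eq0 => /eqP E.
    by have := e.2 _ iaJ; rewrite E ltxx.
  by rewrite rD subn1 prednK.
right; exists ia; split => //.
(* The foot of the perpendicular from [p ia]. *)
exists (p ia + (b - dot u (p ia)) *: u).
  by apply: xJ; rewrite dotDr dotZr uu mulr1 subrKC.
rewrite addrAC subrr add0r /enorm dotZl dotZr uu mulr1 -expr2 sqrtr_sqr.
exact: lts.
Qed.

End slab.

(** * Exponentially many separated facets *)

Section rounding.
Context {R : realType}.

(** Derandomised rounding: rounding each entry up with probability equal to its fractional part f
    would give an unbiased error of variance f (1 - f) <= 1/4 per entry. Choosing entry after entry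
    the better of the two roundings does at least as well. *)
Lemma rounding (D k : nat) (x : 'I_D -> R) (y : 'I_D -> 'rV[R]_k) :
  exists z : 'I_D -> int, (forall j, `|(z j)%:~R - x j| <= 1) /\
    dot (\sum_j (x j - (z j)%:~R) *: y j) (\sum_j (x j - (z j)%:~R) *: y j)
     <= \sum_j dot (y j) (y j) / 4.
Proof.
suff H (r : seq 'I_D) : uniq r -> exists z : 'I_D -> int, (forall j, `|(z j)%:~R - x j| <= 1) /\
    dot (\sum_(j <- r) (x j - (z j)%:~R) *: y j) (\sum_(j <- r) (x j - (z j)%:~R) *: y j)
     <= \sum_(j <- r) dot (y j) (y j) / 4.
  exact: (H _ (index_enum_uniq _)).
elim: r => [_|i r IH /= /andP[ir ur]].
  exists (fun j => Num.floor (x j)); split; last by rewrite !big_nil dot0l.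
  move=> j; have := Num.Theory.floor_le (x j); have := floorD1_gt (x j).
  by rewrite intrD1 => h1 h2; rewrite ler_norml; apply/andP; split; lra.
have [z [z1 z2]] := IH ur.
set S := \sum_(j <- r) (x j - (z j)%:~R) *: y j in z2.
pose f := x i - (Num.floor (x i))%:~R.
have f01 : 0 <= f <= 1.
  have := Num.Theory.floor_le (x i); have := floorD1_gt (x i).
  by rewrite intrD1 /f => h1 h2; apply/andP; split; lra.
have [e [e01 eE]] : exists e : int, (e = 0 \/ e = 1) /\
    dot ((f - e%:~R) *: y i + S) ((f - e%:~R) *: y i + S) <= dot S S + dot (y i) (y i) / 4.
  have E (a : R) : dot (a *: y i + S) (a *: y i + S) = dot S S + 2 * a * dot (y i) S + a ^+ 2 * dot (y i) (y i).
    by rewrite dotDl !dotDr !dotZl !dotZr (dotC S (y i)); ring.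
  have yy := dot_ge0 (y i).
  have [h|h] := leP (dot ((f - 0%:~R) *: y i + S) ((f - 0%:~R) *: y i + S)) (dot S S + dot (y i) (y i) / 4).
    by exists 0; split; [left|].
  exists 1; split; [by right|].
  move: h; rewrite !E mulr0z mulr1z; move: f01 => /andP[f0 f1].
  move: (dot (y i) S) (dot (y i) (y i)) (dot S S) yy => a b c b0 h.
  have f_gt0 : 0 < f.
    rewrite lt_neqAle f0 andbT; apply/eqP => fz; move: h; rewrite -fz expr2; lra.
  (* Weighted by 1 - f and f, the excesses of the two roundings over b/4 sum to -b (f - 1/2)^2, so
     they cannot both be positive. *)
  rewrite leNgt; apply/negP => h'.
  have h1 : 0 <= (1 - f) * (2 * (f - 0) * a + (f - 0) ^+ 2 * b - b / 4) by apply: mulr_ge0; lra.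
  have h2 : 0 < f * (2 * (f - 1) * a + (f - 1) ^+ 2 * b - b / 4) by apply: mulr_gt0; lra.
  have h3 : 0 <= b * (f - 1 / 2) ^+ 2 by rewrite mulr_ge0// sqr_ge0.
  lra.
exists (fun j => if j == i then Num.floor (x i) + e else z j); split.
  move=> j; case: eqP => [->|_]; last exact: z1.
  move: f01; rewrite /f => /andP[f0 f1].
  by case: e01 => ->; rewrite ?addr0 ?intrD1 ler_norml; apply/andP; split; lra.
rewrite !big_cons eqxx.
have -> : \sum_(j <- r) (x j - (if j == i then Num.floor (x i) + e else z j)%:~R) *: y j = S.
  apply: eq_big_seq => j jr; case: eqP => // ji; by rewrite -ji jr in ir.
have -> : x i - (Num.floor (x i) + e)%:~R = f - e%:~R by rewrite /f intrD opprD addrA.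
by apply: le_trans eE _; rewrite addrC lerD2l.
Qed.

End rounding.

(** * Counting grid points *)

Section counting.
Context {R : realType}.

Lemma one_sub_expR (t : R) : 0 < t -> (1 - expR (- t))^-1 <= (1 + t) / t.
Proof.
move=> t0; have h : expR (- t) <= (1 + t)^-1.
  by rewrite expRN lef_pV2 ?posrE ?expR_gt0 ?expR_ge1Dx//; lra.
have t1 : 0 < 1 + t by lra.
have h2 : t / (1 + t) <= 1 - expR (- t).
  have -> : t / (1 + t) = 1 - (1 + t)^-1 by field; rewrite gt_eqF.
  lra.
rewrite -[(1 + t) / t]invf_div lef_pV2// posrE.
  by apply: lt_le_trans h2; rewrite divr_gt0.
by rewrite divr_gt0.
Qed.

Lemma expRN_le1 (t z : R) : 0 < t -> 0 <= z -> expR (- t * z) <= 1.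
Proof.
move=> t0 z0; have h : 0 <= t * z by rewrite mulr_ge0// ltW.
by rewrite -(@expR0 R) ler_expR mulNr; lra.
Qed.

Lemma geo_sum_le (t y : R) (K : nat) : 0 < t ->
  \sum_(k < K) (if k%:R <= y then expR (- t * (y - k%:R)) else 0) <= (1 - expR (- t))^-1.
Proof.
move=> t0; have e1 : expR (- t) < 1 by rewrite -expR0 ltr_expR; lra.
have G0 : 0 <= (1 - expR (- t))^-1 by rewrite invr_ge0; lra.
elim: K y => [|K IH] y; first by rewrite big_ord0.
rewrite big_ord_recr/=; case: ifPn => [Ky|_]; last by rewrite addr0.
have -> : \sum_(i < K) (if i%:R <= y then expR (- t * (y - i%:R)) else 0) =
  expR (- t) * \sum_(i < K) (if i%:R <= y - 1 then expR (- t * (y - 1 - i%:R)) else 0).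
  rewrite mulr_sumr; apply: eq_bigr => i _.
  have iK : i%:R <= K%:R - 1 :> R by rewrite lerBrDr natr1 ler_nat.
  have -> : i%:R <= y by lra.
  have -> : i%:R <= y - 1 by lra.
  by rewrite -expRD; congr expR; rewrite -?natr1; ring.
have := IH (y - 1).
set S := \sum_(i < K) _ => hS.
have h : expR (- t * (y - K%:R)) <= 1 by apply: expRN_le1; lra.
have : expR (- t) * S <= expR (- t) * (1 - expR (- t))^-1 by rewrite ler_wpM2l// expR_ge0.
have : (1 - expR (- t)) * (1 - expR (- t))^-1 = 1 by rewrite mulfV// gt_eqF//; lra.
lra.
Qed.

Lemma geo_sum_ge (t y : R) (K : nat) : 0 < t ->
  \sum_(k < K) (if y <= k%:R then expR (- t * (k%:R - y)) else 0) <= (1 - expR (- t))^-1.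
Proof.
move=> t0; have e1 : expR (- t) < 1 by rewrite -expR0 ltr_expR; lra.
have G0 : 0 <= (1 - expR (- t))^-1 by rewrite invr_ge0; lra.
elim: K y => [|K IH] y; first by rewrite big_ord0.
rewrite big_ord_recl/=.
have lifte (i : 'I_K) : (bump 0 i)%:R = i%:R + 1 :> R by rewrite /bump/= add1n -natr1.
case: ifPn => [y0|_].
  have -> : \sum_(i < K) (if y <= (bump 0 i)%:R then expR (- t * ((bump 0 i)%:R - y)) else 0) =
    expR (- t) * \sum_(i < K) (if y <= i%:R then expR (- t * (i%:R - y)) else 0).
    rewrite mulr_sumr; apply: eq_bigr => i _; rewrite lifte.
    have i0 : 0 <= i%:R :> R by rewrite ler0n.
    have -> : y <= i%:R by lra.
    have -> : y <= i%:R + 1 by lra.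
    by rewrite -expRD; congr expR; rewrite -?natr1; ring.
  have := IH y.
  set S := \sum_(i < K) _ => hS.
  have h : expR (- t * (0 - y)) <= 1 by apply: expRN_le1; lra.
  have : expR (- t) * S <= expR (- t) * (1 - expR (- t))^-1 by rewrite ler_wpM2l// expR_ge0.
  have : (1 - expR (- t)) * (1 - expR (- t))^-1 = 1 by rewrite mulfV// gt_eqF//; lra.
  lra.
rewrite add0r; apply: le_trans (IH (y - 1)).
apply: ler_sum => i _; rewrite lifte lerBlDr.
by case: ifP => _ //; rewrite ler_expR; lra.
Qed.

(** Two geometric series, split at [y]. The bound depends neither on the centre [y], which need not
    be an integer, nor on the range [K]. *)
Lemma geo_sum_abs (t y : R) (K : nat) : 0 < t ->
  \sum_(k < K) expR (- t * `|k%:R - y|) <= 2 * ((1 + t) / t).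
Proof.
move=> t0; have h := one_sub_expR t0.
have h1 := geo_sum_le y K t0; have h2 := geo_sum_ge y K t0.
have : \sum_(k < K) expR (- t * `|k%:R - y|) <=
  \sum_(k < K) (if k%:R <= y then expR (- t * (y - k%:R)) else 0) +
  \sum_(k < K) (if y <= k%:R then expR (- t * (k%:R - y)) else 0).
  rewrite -big_split/=; apply: ler_sum => k _.
  have [ky|yk] := leP k%:R y.
    rewrite ler0_norm ?subr_le0// opprB lerDl; case: ifP => _ //; exact: expR_ge0.
  by rewrite (ltW yk) ger0_norm ?subr_ge0 ?add0r// ltW.
lra.
Qed.

(** Exponential Markov for the counting measure: the weight exp(-t |f - y|_1) factorises over the
    coordinates, and t = 1/L costs only the factor exp(D). *)
Lemma count_l1 (D B : nat) (y : 'I_D -> R) (L : R) : 0 < L ->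
  #|[set f : {ffun 'I_D -> 'I_B} | \sum_j `|(f j)%:R - y j| <= L * D%:R]%SET|%:R
  <= (2 * expR 1 * (1 + L)) ^+ D :> R.
Proof.
move=> L0; pose t := L^-1; have t0 : 0 < t by rewrite invr_gt0.
have -> : #|[set f : {ffun 'I_D -> 'I_B} | \sum_j `|(f j)%:R - y j| <= L * D%:R]%SET|%:R =
  \sum_(f : {ffun 'I_D -> 'I_B} | \sum_j `|(f j)%:R - y j| <= L * D%:R) (1 : R).
  by rewrite -sum1_card natr_sum; apply: eq_bigl => f; rewrite inE.
apply: (@le_trans _ _ (expR D%:R * \sum_(f : {ffun 'I_D -> 'I_B}) \prod_j expR (- t * `|(f j)%:R - y j|))).
  rewrite mulr_sumr [leRHS](bigID (fun f : {ffun 'I_D -> 'I_B} => \sum_j `|(f j)%:R - y j| <= L * D%:R))/=.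
  rewrite ler_wpDr//; first by apply: sumr_ge0 => f _; rewrite mulr_ge0 ?expR_ge0// prodr_ge0// => j _; exact: expR_ge0.
  apply: ler_sum => f hf; rewrite -expR_sum -expRD -[leLHS]expR0 ler_expR -mulr_sumr.
  have : t * \sum_j `|(f j)%:R - y j| <= t * (L * D%:R) by rewrite ler_pM2l.
  rewrite mulrA mulVf ?mul1r; last by rewrite gt_eqF.
  lra.
rewrite -(bigA_distr_bigA (fun j (k : 'I_B) => expR (- t * `|k%:R - y j|))).
have -> : 2 * expR 1 * (1 + L) = expR 1 * (2 * (1 + L)) :> R by ring.
rewrite exprMn; have -> : expR D%:R = expR 1 ^+ D :> R by rewrite -expRM_natl mulr1.
rewrite ler_wpM2l ?exprn_ge0 ?expR_ge0//.
rewrite -[in leRHS](card_ord D) -prodr_const; apply: ler_prod => j _.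
rewrite sumr_ge0 ?andTb; last by move=> k _; exact: expR_ge0.
apply: le_trans (geo_sum_abs (y j) B t0) _.
by rewrite /t invrK (_ : (1 + L^-1) * L = 1 + L)//; field; rewrite gt_eqF.
Qed.

(** A weak form of cosh y <= exp(y^2/2), sufficient here and elementary. *)
Lemma cosh_le (y : R) : expR y + expR (- y) <= 2 * expR (2 * y ^+ 2).
Proof.
wlog y0 : y / 0 <= y.
  move=> H; have [/H //|/ltW y0] := leP 0 y.
  by have := H (- y); rewrite oppr_ge0 y0 opprK sqrrN => /(_ isT); rewrite addrC.
have [y1|y1] := leP y (1/2).
  have h := expR_ge1Dx (2 * y ^+ 2).
  have a1 : expR y <= 1 + y + 2 * y ^+ 2.
    have : 1 - y <= expR (- y) by apply: expR_ge1Dx.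
    rewrite expRN => hy.
    have e0 := expR_gt0 y.
    have h1 : (1 - y) * expR y <= 1.
      by rewrite -[leRHS](@mulVf _ (expR y)) ?gt_eqF// ler_wpM2r// ltW.
    have h2 : 0 <= y ^+ 2 * (1 - 2 * y) by rewrite mulr_ge0 ?sqr_ge0//; lra.
    have y2 : 0 < 1 - y by lra.
    rewrite -(ler_pM2l y2); apply: le_trans h1 _; rewrite expr2 in h2 *; lra.
  have a2 : expR (- y) <= 1 - y + y ^+ 2.
    rewrite expRN; have hy := expR_ge1Dx y.
    apply: (@le_trans _ _ (1 + y)^-1); first by rewrite lef_pV2 ?posrE ?expR_gt0//; lra.
    rewrite -div1r ler_pdivrMr; last lra.
    have : 0 <= y ^+ 3 by rewrite exprn_ge0.
    by rewrite !exprS expr0; lra.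
  have := sqr_ge0 y; lra.
have h1 : expR y <= expR (2 * y ^+ 2) by rewrite ler_expR expr2; nra.
have h2 : expR (- y) <= expR (2 * y ^+ 2) by rewrite ler_expR expr2; nra.
lra.
Qed.

(** A Chernoff bound for a uniformly distributed grid vector: its independent symmetric coordinates
    have subgaussian exponential moments. *)
Lemma cap_count (d L : nat) (u : 'rV[R]_d) (z : R) : dot u u = 1 -> 0 < z -> (0 < L)%N ->
  #|[set f : {ffun 'I_d -> 'I_L.*2.+1} |
     z * L%:R * Num.sqrt d%:R <= \sum_j u 0 j * ((f j)%:R - L%:R)]%SET|%:R
  <= expR (- (z ^+ 2 * d%:R / 8)) * (L.*2.+1%:R) ^+ d :> R.
Proof.
move=> uu z0 L0; have Lp : 0 < L%:R :> R by rewrite ltr0n.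
(* The minimiser of -s z L sqrt d + 2 s^2 L^2; the minimum is -z^2 d / 8. *)
pose s := z * Num.sqrt d%:R / (4 * L%:R).
have s0 : 0 <= s by rewrite divr_ge0 ?mulr_ge0 ?sqrtr_ge0 ?ltW//.
have -> : #|[set f : {ffun 'I_d -> 'I_L.*2.+1} |
     z * L%:R * Num.sqrt d%:R <= \sum_j u 0 j * ((f j)%:R - L%:R)]%SET|%:R =
  \sum_(f : {ffun 'I_d -> 'I_L.*2.+1} | z * L%:R * Num.sqrt d%:R <= \sum_j u 0 j * ((f j)%:R - L%:R)) (1 : R).
  by rewrite -sum1_card natr_sum; apply: eq_bigl => f; rewrite inE.
apply: (@le_trans _ _ (expR (- s * (z * L%:R * Num.sqrt d%:R)) *
   \sum_(f : {ffun 'I_d -> 'I_L.*2.+1}) \prod_j expR (s * (u 0 j * ((f j)%:R - L%:R))))).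
  rewrite mulr_sumr [leRHS](bigID (fun f : {ffun 'I_d -> 'I_L.*2.+1} => z * L%:R * Num.sqrt d%:R <= \sum_j u 0 j * ((f j)%:R - L%:R)))/=.
  rewrite ler_wpDr//; first by apply: sumr_ge0 => f _; rewrite mulr_ge0 ?expR_ge0// prodr_ge0// => j _; exact: expR_ge0.
  apply: ler_sum => f hf; rewrite -expR_sum -expRD -[leLHS]expR0 ler_expR -mulr_sumr.
  by rewrite mulNr addrC subr_ge0 ler_wpM2l.
rewrite -(bigA_distr_bigA (fun j (k : 'I_L.*2.+1) => expR (s * (u 0 j * (k%:R - L%:R))))).
have sq : Num.sqrt d%:R ^+ 2 = d%:R :> R by rewrite sqr_sqrtr.
have b j : \sum_(k < L.*2.+1) expR (s * (u 0 j * (k%:R - L%:R))) <=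
    L.*2.+1%:R * expR (2 * (s * u 0 j * L%:R) ^+ 2).
  pose a := s * u 0 j.
  (* Reversing the range -L, ..., L changes the sign of the exponent; averaging both forms produces
     a cosh. *)
  have E : \sum_(k < L.*2.+1) expR (s * (u 0 j * (k%:R - L%:R))) = \sum_(k < L.*2.+1) expR (- (a * (k%:R - L%:R))).
    rewrite [LHS](reindex_inj rev_ord_inj)/=; apply: eq_bigr => k _; congr expR.
    have -> : (L.*2.+1 - k.+1)%:R = L%:R + L%:R - k%:R :> R.
      have kL : (k <= L.*2)%N by rewrite -ltnS.
      have dE : L.*2%:R = L%:R + L%:R :> R by rewrite -addnn natrD.
      by rewrite subSS natrB// dE.
    by rewrite /a; ring.
  have : 2 * \sum_(k < L.*2.+1) expR (s * (u 0 j * (k%:R - L%:R))) <=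
     2 * (L.*2.+1%:R * expR (2 * (s * u 0 j * L%:R) ^+ 2)).
    rewrite {1}mulr2n mulrDl mul1r {2}E -big_split/=.
    apply: (@le_trans _ _ (\sum_(k < L.*2.+1) 2 * expR (2 * (a * L%:R) ^+ 2))).
      apply: ler_sum => k _; rewrite mulrA -/a.
      apply: le_trans (cosh_le _) _; rewrite ler_pM2l// ler_expR ler_pM2l//.
      rewrite (exprMn 2 a (k%:R - L%:R)) (exprMn 2 a L%:R).
      apply: ler_wpM2l; first exact: sqr_ge0.
      have kL : k%:R <= L%:R + L%:R :> R by rewrite -natrD ler_nat addnn -ltnS.
      have k0 : 0 <= k%:R :> R by rewrite ler0n.
      have : 0 <= k%:R * (L%:R + L%:R - k%:R) :> R by rewrite mulr_ge0 ?subr_ge0.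
      rewrite !expr2; lra.
    by rewrite sumr_const card_ord -mulr_natr /a; lra.
  lra.
apply: (@le_trans _ _ (expR (- s * (z * L%:R * Num.sqrt d%:R)) *
   \prod_(j < d) (L.*2.+1%:R * expR (2 * (s * u 0 j * L%:R) ^+ 2)))).
  rewrite ler_wpM2l ?expR_ge0//; apply: ler_prod => j _; rewrite b andbT.
  by apply: sumr_ge0 => k _; exact: expR_ge0.
rewrite big_split/= prodr_const card_ord mulrA mulrAC -expR_sum -expRD ler_wpM2r ?exprn_ge0//.
rewrite ler_expR -mulr_sumr.
have -> : \sum_(j < d) (s * u 0 j * L%:R) ^+ 2 = s ^+ 2 * L%:R ^+ 2.
  under eq_bigr do rewrite mulrAC exprMn expr2 [u 0 _ ^+ 2]expr2.
  by rewrite -mulr_sumr -/(dot u u) uu mulr1 -expr2 exprMn.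
rewrite /s; move: sq; set sd := Num.sqrt d%:R => sq; rewrite -sq.
rewrite le_eqVlt; apply/orP; left; apply/eqP; field.
by rewrite gt_eqF.
Qed.

End counting.

Lemma card_bigcup_le (I T : finType) (A : {set I}) (B : I -> {set T}) :
  (#|(\bigcup_(i in A) B i)%SET| <= \sum_(i in A) #|B i|)%N.
Proof.
elim/big_rec2: _ => [|i n C _ h]; first by rewrite cards0.
by apply: leq_trans (leq_card_setU _ _) _; rewrite leq_add2l.
Qed.

(** * Integer nets and the covering of a polytope *)

Section net.
Context {R : realType}.

(** A finite type of integer vectors with entries in [-K, K]: the ordinal is shifted by [K]. *)
Definition zdec (D K : nat) (f : {ffun 'I_D -> 'I_K.*2.+1}) (j : 'I_D) : R :=
  (f j)%:R - K%:R.

Definition znet (D K : nat) (L : R) : {set {ffun 'I_D -> 'I_K.*2.+1}} :=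
  [set f : {ffun 'I_D -> 'I_K.*2.+1} | \sum_j `|zdec f j| <= L * D%:R]%SET.

Lemma card_znet (D K : nat) (L : R) : 0 < L ->
  #|znet D K L|%:R <= (2 * expR 1 * (1 + L)) ^+ D :> R.
Proof. by move=> L0; have := @count_l1 R D K.*2.+1 (fun=> K%:R) L L0. Qed.

(** The net depends on [D], [K] and [L] only, whereas the rounding is adapted to the vectors [y].
    Each entry moves by at most 1, so the l^1 radius grows from L to L + 1, and [K] is large enough
    for all entries to fit. *)
Lemma round_net (D k K : nat) (x : 'I_D -> R) (y : 'I_D -> 'rV[R]_k) (L : R) :
  \sum_j `|x j| <= L * D%:R -> (L + 1) * D%:R <= K%:R ->
  exists2 f, f \in znet D K (L + 1) &
    (forall j, `|zdec f j - x j| <= 1) /\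
    dot (\sum_j (x j - zdec f j) *: y j) (\sum_j (x j - zdec f j) *: y j)
     <= \sum_j dot (y j) (y j) / 4.
Proof.
move=> hx hK; have [z [z1 z2]] := rounding x y.
have zs : \sum_j `|(z j)%:~R : R| <= (L + 1) * D%:R.
  apply: (@le_trans _ _ (\sum_j (`|x j| + 1))).
    apply: ler_sum => j _; rewrite -[X in `|X| <= _](subrK (x j)) addrC.
    by apply: le_trans (ler_normD _ _) _; rewrite lerD2l.
  by rewrite big_split/= sumr_const card_ord mulrDl mul1r lerD2r.
have zK j : `|(z j)%:~R : R| <= K%:R.
  apply: le_trans hK; apply: le_trans zs; rewrite (bigD1 j)//= lerDl; exact: sumr_ge0.
pose f := [ffun j => inord (absz (z j + K%:Z)) : 'I_K.*2.+1].
have zf j : zdec f j = (z j)%:~R.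
  have := zK j; rewrite ler_norml => /andP[zK1 zK2].
  have z0 : 0 <= z j + K%:Z.
    by rewrite -(ler_int R) intrD; rewrite (_ : (K%:Z)%:~R = K%:R)//; lra.
  rewrite /zdec ffunE inordK.
    have -> : (absz (z j + K%:Z))%:R = (z j + K%:Z)%:~R :> R.
      by rewrite -{2}(gez0_abs z0).
    by rewrite intrD addrK.
  rewrite ltnS -(ler_nat R).
  have -> : (absz (z j + K%:Z))%:R = (z j + K%:Z)%:~R :> R.
    by rewrite -{2}(gez0_abs z0).
  by rewrite intrD -addnn natrD; rewrite (_ : (K%:Z)%:~R = K%:R)//; lra.
exists f.
  by rewrite inE; under eq_bigr do rewrite zf.
split; first by move=> j; rewrite zf.
by have -> : \sum_j (x j - zdec f j) *: y j = \sum_j (x j - (z j)%:~R) *: y j by apply: eq_bigr => j _; rewrite zf.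
Qed.

Definition gridv (d L : nat) (v : {ffun 'I_d -> 'I_L.*2.+1}) : 'rV[R]_d := \row_j zdec v j.

Lemma dot_cauchy (d : nat) (u v : 'rV[R]_d) : (dot u v) ^+ 2 <= dot u u * dot v v.
Proof.
have [->|v0] := eqVneq v 0; first by rewrite !dot0r expr0n/= mulr0.
have vv : 0 < dot v v by rewrite lt_neqAle dot_ge0 eq_sym dot_eq0 v0.
have := dot_ge0 (dot v v *: u - dot u v *: v).
rewrite dotBl !dotBr !dotZl !dotZr (dotC v u).
move: (dot u v) (dot u u) (dot v v) vv => a b c c0 h.
have : 0 <= c * (b * c - a ^+ 2) by rewrite expr2; lra.
by rewrite pmulr_rge0// subr_ge0.
Qed.

Lemma cauchy_sum (d : nat) (x : 'I_d -> R) :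
  (\sum_j `|x j|) ^+ 2 <= d%:R * \sum_j x j ^+ 2.
Proof.
have := dot_cauchy (\row_j `|x j|) (const_mx 1).
have -> : dot (\row_j `|x j|) (const_mx 1) = \sum_j `|x j|.
  by apply: eq_bigr => j _; rewrite !mxE mulr1.
have -> : dot (\row_j `|x j|) (\row_j `|x j|) = \sum_j x j ^+ 2.
  by apply: eq_bigr => j _; rewrite !mxE -expr2 real_normK ?num_real.
have -> : dot (const_mx 1 : 'rV[R]_d) (const_mx 1) = d%:R.
  rewrite /dot; under eq_bigr do rewrite !mxE mulr1.
  by rewrite sumr_const card_ord.
by rewrite mulrC.
Qed.

Lemma dot_gridv (d L : nat) (v : {ffun 'I_d -> 'I_L.*2.+1}) :
  dot (gridv v) (gridv v) <= d%:R * L%:R ^+ 2.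
Proof.
have -> : d%:R * L%:R ^+ 2 = \sum_(j < d) L%:R ^+ 2 :> R by rewrite sumr_const card_ord mulr_natl.
apply: ler_sum => j _; rewrite !mxE /zdec.
have kL : (v j)%:R <= L%:R + L%:R :> R by rewrite -natrD ler_nat addnn -ltnS.
have k0 : 0 <= (v j)%:R :> R by rewrite ler0n.
have : 0 <= (v j)%:R * (L%:R + L%:R - (v j)%:R) :> R by rewrite mulr_ge0 ?subr_ge0.
rewrite expr2; lra.
Qed.

Definition badgrid (d L m : nat) (A : 'I_m -> 'rV[R]_d) (g : 'rV[R]_d) (sg : R) :
   {set {ffun 'I_d -> 'I_L.*2.+1}} :=
  [set v : {ffun 'I_d -> 'I_L.*2.+1} | `[< conv_hull (range A) (g + sg *: gridv v) >]]%SET.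

(** A version of Maurey's empirical method. Rounding d times the coefficients of a convex
    combination yields one of at most (6e)^m integer vectors, and moves the point by at most sqrt
    Lam. So the hull is covered by (6e)^m balls of constant radius; each becomes, after scaling by
    1/[sg], part of an l^1 ball of radius S d, where [count_l1] applies. *)
Lemma card_badgrid (d L m Lam : nat) (A : 'I_m -> 'rV[R]_d) (g : 'rV[R]_d) (C : R) :
  (0 < d)%N -> (d <= m)%N -> (m <= Lam * d)%N -> (0 < L)%N -> 0 < C ->
  (forall i, dot (A i) (A i) <= 4 * d%:R) ->
  #|badgrid L A g (C / (L%:R * Num.sqrt d%:R))|%:R <=
   (6 * expR 1) ^+ m * (2 * expR 1 * (1 + Num.sqrt Lam%:R * L%:R / C)) ^+ d :> R.
Proof.
move=> d0 dm mLam L0 C0 hA.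
have dp : 0 < d%:R :> R by rewrite ltr0n.
have Lp : 0 < L%:R :> R by rewrite ltr0n.
have sdp : 0 < Num.sqrt d%:R :> R by rewrite sqrtr_gt0.
have sd2 : Num.sqrt d%:R ^+ 2 = d%:R :> R by rewrite sqr_sqrtr.
have Lam0 : (0 < Lam)%N.
  by rewrite lt0n; apply/eqP => E; move: mLam; rewrite E mul0n leqn0 => /eqP m0; move: dm; rewrite m0 leqn0 -(negbK (d == 0)%N) -lt0n d0.
have sLp : 0 < Num.sqrt Lam%:R :> R by rewrite sqrtr_gt0 ltr0n.
set sg := C / (L%:R * Num.sqrt d%:R).
have sg0 : 0 < sg by rewrite divr_gt0// mulr_gt0.
set S := Num.sqrt Lam%:R * L%:R / C.
have S0 : 0 < S by rewrite divr_gt0// mulr_gt0.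
pose K := (m.*2)%N.
pose c (f : {ffun 'I_m -> 'I_K.*2.+1}) := d%:R^-1 *: (\sum_i zdec f i *: A i) - g.
pose B f := [set v : {ffun 'I_d -> 'I_L.*2.+1} |
   \sum_j `|(v j)%:R - (L%:R + sg^-1 * c f 0 j)| <= S * d%:R]%SET.
have sub : badgrid L A g sg \subset (\bigcup_(f in znet m K (1 + 1)) B f)%SET.
  apply/fintype.subsetP => v; rewrite inE => /asboolP; rewrite conv_hull_range => -[l [l0 _ l1 E]].
  (* The coefficients sum to 1, so scaled by d they have l^1 norm d, which is at most m. *)
  have x1 : \sum_i `|d%:R * l i| <= 1 * m%:R.
    under eq_bigr do rewrite ger0_norm ?mulr_ge0//.
    by rewrite -mulr_sumr l1 mulr1 mul1r ler_nat.
  have hK : (1 + 1) * m%:R <= K%:R :> R by rewrite /K -addnn natrD; lra.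
  have [f fnet [_ f2]] := round_net (fun i => d%:R^-1 *: A i) x1 hK.
  apply/finset.bigcupP; exists f => //; rewrite inE.
  have E2 : \sum_i (d%:R * l i - zdec f i) *: (d%:R^-1 *: A i) = sg *: gridv v - c f.
    have -> : sg *: gridv v - c f = (g + sg *: gridv v) - d%:R^-1 *: (\sum_i zdec f i *: A i).
      by rewrite /c opprB addrA (addrC g).
    rewrite E scaler_sumr -sumrB; apply: eq_bigr => i _.
    by rewrite !scalerA -scalerBl; congr (_ *: _); field; rewrite gt_eqF.
  rewrite E2 in f2.
  have f3 : dot (sg *: gridv v - c f) (sg *: gridv v - c f) <= Lam%:R.
    apply: le_trans f2 _.
    apply: (@le_trans _ _ (\sum_(i < m) d%:R^-1)).
      apply: ler_sum => i _; rewrite dotZl dotZr mulrA.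
      have : d%:R^-1 * d%:R^-1 * dot (A i) (A i) <= d%:R^-1 * d%:R^-1 * (4 * d%:R).
        by rewrite ler_pM2l ?mulr_gt0 ?invr_gt0.
      have -> : d%:R^-1 * d%:R^-1 * (4 * d%:R) = 4 * d%:R^-1 :> R.
        by field; rewrite gt_eqF.
      move=> h; lra.
    rewrite sumr_const card_ord -[leLHS]mulr_natr ler_pdivrMl//.
    by rewrite -natrM ler_nat mulnC.
  set x := fun j => (v j)%:R - (L%:R + sg^-1 * c f 0 j).
  have xE : \sum_j x j ^+ 2 <= sg^-1 ^+ 2 * Lam%:R.
    have -> : \sum_j x j ^+ 2 = sg^-1 ^+ 2 * dot (sg *: gridv v - c f) (sg *: gridv v - c f).
      rewrite /dot mulr_sumr /x; move: (c f) => cf.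
      apply: eq_bigr => j _; rewrite !mxE /zdec.
      by field; rewrite gt_eqF.
    by rewrite ler_wpM2l// sqr_ge0.
  have h := cauchy_sum x.
  have h2 : (\sum_j `|x j|) ^+ 2 <= (S * d%:R) ^+ 2.
    apply: le_trans h _; apply: (@le_trans _ _ (d%:R * (sg^-1 ^+ 2 * Lam%:R))).
      by rewrite ler_wpM2l// ltW.
    rewrite /S /sg le_eqVlt; apply/orP; left; apply/eqP.
    have sLE : Lam%:R = Num.sqrt Lam%:R ^+ 2 :> R by rewrite sqr_sqrtr.
    rewrite [X in _ * (_ * X)]sLE; move: sd2; set sd := Num.sqrt d%:R => sd2; rewrite -sd2.
    by field; rewrite !gt_eqF.
  rewrite -(@ler_pXn2r _ 2)// nnegrE; first exact: sumr_ge0.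
  by rewrite mulr_ge0// ltW.
apply: (@le_trans _ _ (\sum_(f in znet m K (1 + 1)) #|B f|%:R)).
  rewrite -natr_sum ler_nat; apply: leq_trans (subset_leq_card sub) _.
  by rewrite (leq_trans (card_bigcup_le _ _))//.
apply: (@le_trans _ _ (\sum_(f in znet m K (1 + 1)) (2 * expR 1 * (1 + S)) ^+ d)).
  by apply: ler_sum => f _; exact: count_l1.
have q : 0 <= (2 * expR 1 * (1 + S)) ^+ d.
  have e0 := expR_gt0 (1 : R).
  by apply: exprn_ge0; apply: mulr_ge0; [apply: mulr_ge0; lra|lra].
rewrite sumr_const -[leLHS]mulr_natl ler_wpM2r//.
apply: le_trans (card_znet m K _) _ => //.
by rewrite (_ : 2 * expR 1 * (1 + (1 + 1)) = 6 * expR 1) //; ring.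
Qed.

(** With C = 2 W sqrt Lam the bound of [card_badgrid] is at most (W + L/2)^d, hence at most L^d once
    L >= 2 W, while the grid has (2L+1)^d points. [L] and [C] depend on [Lam] only. *)
Lemma badgrid_half (Lam : nat) : (0 < Lam)%N ->
  exists (L : nat) (C : R), [/\ (0 < L)%N, 0 < C &
   forall (d m : nat) (A : 'I_m -> 'rV[R]_d) (g : 'rV[R]_d),
   (0 < d)%N -> (d <= m)%N -> (m <= Lam * d)%N ->
   (forall i, dot (A i) (A i) <= 4 * d%:R) ->
   (2 * #|badgrid L A g (C / (L%:R * Num.sqrt d%:R))| <= L.*2.+1 ^ d)%N].
Proof.
move=> Lam0; pose W : R := (6 * expR 1) ^+ Lam * (2 * expR 1).
have e1 : 1 <= expR 1 :> R by rewrite -[leLHS]expR0 ler_expR.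
have W0 : 0 < W by rewrite mulr_gt0 ?exprn_gt0 ?mulr_gt0 ?expR_gt0.
have sLp : 0 < Num.sqrt Lam%:R :> R by rewrite sqrtr_gt0 ltr0n.
have [L [L0 LW]] : exists L : nat, (0 < L)%N /\ 2 * W <= L%:R.
  exists (Num.bound (2 * W)).+1; split => //.
  by apply: le_trans (ltW (archi_boundP _)) _; rewrite ?ler_nat// mulr_ge0// ltW.
have Lp : 0 < L%:R :> R by rewrite ltr0n.
exists L, (2 * W * Num.sqrt Lam%:R); split => //; first by rewrite !mulr_gt0.
move=> d m A g d0 dm mLam hA.
rewrite -(ler_nat R) natrM natrX.
have := card_badgrid g d0 dm mLam L0 (_ : 0 < 2 * W * Num.sqrt Lam%:R) hA.
rewrite !mulr_gt0// => /(_ isT) h.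
have h2 : (6 * expR 1) ^+ m * (2 * expR 1 * (1 + Num.sqrt Lam%:R * L%:R / (2 * W * Num.sqrt Lam%:R))) ^+ d
   <= L%:R ^+ d :> R.
  apply: (@le_trans _ _ ((6 * expR 1) ^+ (Lam * d) * (2 * expR 1 * (1 + Num.sqrt Lam%:R * L%:R / (2 * W * Num.sqrt Lam%:R))) ^+ d)).
    rewrite ler_wpM2r//; last by rewrite ler_weXn2l//; lra.
    by rewrite exprn_ge0// mulr_ge0 ?mulr_ge0 ?expR_ge0// addr_ge0// divr_ge0 ?mulr_ge0// ltW// mulr_gt0.
  rewrite exprM -exprMn mulrA -/W.
  apply: lerXn2r; rewrite ?nnegrE.
  - by rewrite ltW// mulr_gt0// addr_gt0// divr_gt0 ?mulr_gt0.
  - exact: ltW.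
  have -> : W * (1 + Num.sqrt Lam%:R * L%:R / (2 * W * Num.sqrt Lam%:R)) = W + L%:R / 2.
    by field; rewrite !gt_eqF.
  lra.
apply: (@le_trans _ _ (2 * L%:R ^+ d)).
  by rewrite ler_pM2l//; apply: le_trans h h2.
apply: (@le_trans _ _ (2 ^+ d * L%:R ^+ d)).
  rewrite ler_wpM2r ?exprn_ge0//; case: d d0 {h h2 dm mLam hA A g} => // d _.
  by rewrite exprS ler_peMr// exprn_ege1// ler1n.
rewrite -exprMn lerXn2r ?nnegrE ?mulr_ge0//.
by rewrite -natrM ler_nat mul2n.
Qed.

End net.

(** In a separated set of maximal cardinality, every element of [G] is near some member; otherwise
    it could be added. *)
Lemma greedy_separated (R : realType) (V : finType) (G : {set V}) (near : rel V) (c : R) :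
  (forall v, v \in G -> near v v) -> (forall v w, near v w = near w v) ->
  (forall w, w \in G -> #|[set v in G | near w v]%SET|%:R <= c) ->
  exists S : {set V}, [/\ S \subset G,
    (forall v w, v \in S -> w \in S -> v != w -> ~~ near v w) & #|G|%:R <= #|S|%:R * c].
Proof.
move=> nrefl nsym hc.
pose P (S : {set V}) := (S \subset G) && [forall v in S, forall w in S, (v != w) ==> ~~ near v w].
have P0 : P finset.set0.
  by rewrite /P finset.sub0set; apply/forall_inP => v; rewrite inE.
case: (@arg_maxnP _ finset.set0 P (fun S => #|S|)) => // S /andP[SG /forall_inP sep] Smax.
have sep' v w : v \in S -> w \in S -> v != w -> ~~ near v w.
  by move=> vS wS vw; have /forall_inP/(_ w wS)/implyP := sep v vS; exact.
exists S; split => //.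
have cov : G \subset (\bigcup_(w in S) [set v in G | near w v]%SET)%SET.
  apply/fintype.subsetP => v vG; apply/finset.bigcupP.
  have [vS|vS] := boolP (v \in S); first by exists v => //; rewrite inE vG nrefl.
  have : ~~ P (v |: S)%SET.
    apply/negP => /Smax; rewrite cardsU1 vS /= add1n ltnn//.
  rewrite /P finset.subUset finset.sub1set vG SG/= negb_forall => /existsP[x].
  rewrite negb_imply => /andP[xS]; rewrite negb_forall => /existsP[y].
  rewrite negb_imply => /andP[yS]; rewrite negb_imply => /andP[xy /negPn nxy].
  move: xS yS; rewrite !in_setU1 => /orP[/eqP xv|xS] /orP[/eqP yv|yS].
  - by rewrite xv yv eqxx in xy.
  - by exists y => //; rewrite inE vG nsym -xv.
  - by exists x => //; rewrite inE vG -yv.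
  - by have := sep' _ _ xS yS xy; rewrite nxy.
apply: (@le_trans _ _ (\sum_(w in S) c)); last by rewrite sumr_const mulr_natl.
apply: (@le_trans _ _ (\sum_(w in S) #|[set v in G | near w v]%SET|%:R)).
  rewrite -natr_sum ler_nat; apply: leq_trans (subset_leq_card cov) _.
  exact: card_bigcup_le.
by apply: ler_sum => w wS; apply: hc; exact: (fintype.subsetP SG).
Qed.

(** * Facets seen from grid vectors *)

Section family.
Context {R : realType}.

(** The last clause says that the points on the hyperplane affinely span it: their differences have
    rank at least d - 1. *)
Definition facet_data (d m : nat) (A : 'I_m -> 'rV[R]_d) (u : 'rV[R]_d) (h : R) : Prop :=
  [/\ dot u u = 1, forall i, dot u (A i) <= h &
   exists2 i0, dot u (A i0) = h &
     (d <= (\rank (diffmx A [set i | dot u (A i) == h]%SET i0)).+1)%N].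

(** A polar vertex [u] about the origin [g] becomes a unit normal, and 1/|u| is the distance from
    [g] to the facet. Passing from the d independent vectors [A i - g] to the differences of points
    loses at most one from the rank. *)
Lemma pivot_facet_data (d m : nat) (A : 'I_m -> 'rV[R]_d) (g u : 'rV[R]_d) :
  (0 < d)%N -> (forall i, dot u (A i - g) <= 1) -> row_full (tightmx (fun i => A i - g) u) ->
  facet_data A ((Num.sqrt (dot u u))^-1 *: u) ((Num.sqrt (dot u u))^-1 * (1 + dot u g)).
Proof.
move=> d0 fu full; set T := tightmx _ u in full.
have [i0 i0t] : exists i, dot u (A i - g) = 1.
  apply/not_existsP => h.
  have T0 : T = 0.
    by apply/row_matrixP => i; rewrite rowK row0; case: eqP => // /h.
  by move: full; rewrite /row_full T0 mxrank0 => /eqP d0'; rewrite -d0' in d0.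
have un0 : u != 0.
  by apply/eqP => u0; move: i0t; rewrite u0 dot0l => /eqP; rewrite eq_sym oner_eq0.
have uu : 0 < dot u u by rewrite lt_neqAle dot_ge0 eq_sym dot_eq0 un0.
set r := (Num.sqrt (dot u u))^-1.
have r0 : 0 < r by rewrite invr_gt0 sqrtr_gt0.
have r2 : r * r * dot u u = 1.
  rewrite -invfM -expr2 sqr_sqrtr ?dot_ge0// mulVf// gt_eqF//.
have tE i : (dot (r *: u) (A i) == r * (1 + dot u g)) = (dot u (A i - g) == 1).
  have rn0 : r != 0 by rewrite gt_eqF.
  by rewrite dotZl (inj_eq (mulfI rn0)) dotBr subr_eq.
split.
- by rewrite dotZl dotZr mulrA.
- by move=> i; rewrite dotZl ler_pM2l//; have := fu i; rewrite dotBr; lra.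
exists i0; first by apply/eqP; rewrite tE i0t eqxx.
set D := diffmx _ _ _.
have TD : (T <= D + (A i0 - g))%MS.
  apply/row_subP => i; rewrite rowK; case: ifP => [ti|_]; last exact: sub0mx.
  have -> : A i - g = row i D + (A i0 - g).
    by rewrite rowK inE tE ti addrA subrK.
  apply: addmx_sub; first by apply: submx_trans (addsmxSl _ _); exact: row_sub.
  exact: addsmxSr.
move: full; rewrite /row_full => /eqP rT.
rewrite -{1}rT; apply: leq_trans (mxrankS TD) _.
apply: leq_trans (mxrank_adds_leqif _ _).1 _.
have := rank_leq_row (A i0 - g); set a := \rank _; set b := \rank _; lia.
Qed.

Lemma ler_of_sqr (x y : R) : 0 <= y -> x ^+ 2 <= y ^+ 2 -> x <= y.
Proof. by move=> y0 h; rewrite leNgt; apply/negP => yx; nra. Qed.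

(** For a grid vector v outside, pivoting yields a facet whose distance r from [g] lies in [h0, C]
    and whose unit normal has inner product at least r/sg with v. So the normal determines a cap
    that contains v, caps of nearby normals overlap, and by [cap_count] one cap accounts for few of
    the grid vectors. *)
Lemma facet_family (Lam : nat) (h0 : R) : (0 < Lam)%N -> 0 < h0 ->
  exists (z C : R), [/\ 0 < z, 0 < C &
   forall (d m : nat) (A : 'I_m -> 'rV[R]_d) (g : 'rV[R]_d),
   (0 < d)%N -> (d <= m)%N -> (m <= Lam * d)%N ->
   (forall i, dot (A i) (A i) <= 4 * d%:R) ->
   (forall u, dot u u = 1 -> exists i, h0 <= dot u (A i - g)) ->
   exists (F : finType) (u : F -> 'rV[R]_d) (h : F -> R),
   [/\ forall f, facet_data A (u f) (h f),
       forall f, `|h f - dot (u f) g| <= C,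
       forall f f', f != f' -> `|dot (u f) (u f')| <= 1 - z ^+ 2 / 2 &
       expR (z ^+ 2 * d%:R / 8) / 4 <= #|F|%:R]].
Proof.
move=> Lam0 h00; have [L [C [L0 C0 hbad]]] := @badgrid_half R _ Lam0.
have Lp : 0 < L%:R :> R by rewrite ltr0n.
(* Chosen so that h0/sg = 2 z L sqrt d: every normal has inner product at least 2 z L sqrt d with
   its grid vector, twice the threshold of [cap_count]. *)
pose z := h0 / (2 * C).
have z0 : 0 < z by rewrite divr_gt0// mulr_gt0.
exists z, C; split => // d m A g d0 dm mLam hA hint.
have dp : 0 < d%:R :> R by rewrite ltr0n.
have sdp : 0 < Num.sqrt d%:R :> R by rewrite sqrtr_gt0.
have sd2 : Num.sqrt d%:R ^+ 2 = d%:R :> R by rewrite sqr_sqrtr.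
have m0 : (0 < m)%N by apply: leq_trans dm.
set sg := C / (L%:R * Num.sqrt d%:R) in hbad.
have sg0 : 0 < sg by rewrite divr_gt0// mulr_gt0.
pose V := {ffun 'I_d -> 'I_L.*2.+1}.
have q_int u : u != 0 -> exists i, 0 < dot u (A i - g).
  move=> un0; have uu : 0 < dot u u by rewrite lt_neqAle dot_ge0 eq_sym dot_eq0 un0.
  set r := (Num.sqrt (dot u u))^-1.
  have r0 : 0 < r by rewrite invr_gt0 sqrtr_gt0.
  have [|i hi] := hint (r *: u).
    rewrite dotZl dotZr mulrA -invfM -expr2 sqr_sqrtr ?dot_ge0// mulVf// gt_eqF//.
  exists i; rewrite -(pmulr_rgt0 _ r0) -dotZl; exact: lt_le_trans hi.
pose G := (~: badgrid L A g sg)%SET.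
have facet v : v \in G -> exists uh : 'rV[R]_d * R,
    [/\ facet_data A uh.1 uh.2, `|uh.2 - dot uh.1 g| <= C &
        2 * z * (L%:R * Num.sqrt d%:R) <= dot uh.1 (gridv v)].
  rewrite !inE => /asboolPn /(separation m0) [u0 u0lt].
  have u0sg i : dot u0 (A i - g) < dot u0 (sg *: gridv v).
    by have := u0lt i; rewrite dotDr dotBr; lra.
  have u0n0 : u0 != 0.
    apply/eqP => u00; have := u0lt (Ordinal m0); rewrite u00 !dot0l ltxx//.
  have [i1 i1p] := q_int _ u0n0.
  pose t := dot u0 (sg *: gridv v).
  have t0 : 0 < t by apply: lt_trans i1p (u0sg i1).
  pose u1 := t^-1 *: u0.
  have fu1 i : dot u1 (A i - g) <= 1.
    by rewrite dotZl ler_pdivrMl// mulr1 ltW.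
  have u1v : dot u1 (gridv v) = sg^-1.
    rewrite dotZl; have : t = sg * dot u0 (gridv v) by rewrite /t dotZr.
    move=> tE; have u0v : dot u0 (gridv v) = sg^-1 * t by rewrite tE mulrA mulVf ?mul1r ?gt_eqF.
    by rewrite u0v mulrCA mulVf ?mulr1// gt_eqF.
  have [u [fu uv full]] := pivot q_int (gridv v) fu1.
  rewrite u1v in uv.
  exists ((Num.sqrt (dot u u))^-1 *: u, (Num.sqrt (dot u u))^-1 * (1 + dot u g)).
  have fd := pivot_facet_data d0 fu full.
  have uv0 : 0 < dot u (gridv v) by apply: lt_le_trans uv; rewrite invr_gt0.
  have un0 : u != 0 by apply/eqP => u00; rewrite u00 dot0l ltxx in uv0.
  have uu : 0 < dot u u by rewrite lt_neqAle dot_ge0 eq_sym dot_eq0 un0.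
  set r := (Num.sqrt (dot u u))^-1 in fd *.
  have r0 : 0 < r by rewrite invr_gt0 sqrtr_gt0.
  have r2 : r ^+ 2 * dot u u = 1.
    by rewrite /r exprVn sqr_sqrtr ?dot_ge0// mulVf// gt_eqF.
  (* No point is higher than r above [g] in the direction of the normal, while some point is at
     height at least h0. *)
  have rh : h0 <= r.
    have [|i hi] := hint (r *: u); first by rewrite dotZl dotZr mulrA -expr2.
    apply: le_trans hi _; rewrite dotZl -[leRHS]mulr1 ler_pM2l//.
  (* The scaled grid vector reaches at least to the hyperplane of the facet, and its length is at
     most C. *)
  have rC : r <= C.
    have cs := dot_cauchy u (gridv v).
    have gv := dot_gridv (R:=R) v.
    have sgE : sg^-1 = L%:R * Num.sqrt d%:R / C by rewrite /sg invf_div.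
    have Cge : (L%:R * Num.sqrt d%:R / C) ^+ 2 <= dot u u * (d%:R * L%:R ^+ 2).
      apply: (@le_trans _ _ (dot u (gridv v) ^+ 2)).
        rewrite -sgE; apply: lerXn2r => //; rewrite nnegrE ltW// invr_gt0//.
      by apply: le_trans cs _; rewrite ler_pM2l.
    have LL : 0 < L%:R ^+ 2 * d%:R :> R by rewrite mulr_gt0// exprn_gt0.
    have E1 : (L%:R * Num.sqrt d%:R / C) ^+ 2 = L%:R ^+ 2 * d%:R / C ^+ 2.
      by rewrite exprMn exprVn exprMn sd2.
    have E2 : r ^+ 2 <= C ^+ 2.
      rewrite E1 ler_pdivrMr ?exprn_gt0// in Cge.
      have : r ^+ 2 * (L%:R ^+ 2 * d%:R) <= r ^+ 2 * (dot u u * (d%:R * L%:R ^+ 2) * C ^+ 2).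
        by rewrite ler_pM2l// exprn_gt0.
      have -> : r ^+ 2 * (dot u u * (d%:R * L%:R ^+ 2) * C ^+ 2) =
         (r ^+ 2 * dot u u) * (C ^+ 2 * (L%:R ^+ 2 * d%:R)) by ring.
      by rewrite r2 mul1r ler_pM2r.
    by apply: ler_of_sqr E2; exact: ltW.
  split => //=.
    have -> : r * (1 + dot u g) - dot (r *: u) g = r by rewrite dotZl; ring.
    by rewrite ger0_norm// ltW.
  rewrite dotZl; apply: (@le_trans _ _ (r * sg^-1)); last by rewrite ler_pM2l.
  have -> : 2 * z * (L%:R * Num.sqrt d%:R) = h0 * sg^-1.
    by rewrite /z /sg; field; rewrite !gt_eqF.
  by rewrite ler_pM2r// invr_gt0.
have /choice [uh uhE] : forall v : V, exists x : 'rV[R]_d * R, v \in G ->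
    [/\ facet_data A x.1 x.2, `|x.2 - dot x.1 g| <= C &
        2 * z * (L%:R * Num.sqrt d%:R) <= dot x.1 (gridv v)].
  move=> v; have [/facet [x hx]|vG] := boolP (v \in G); [by exists x|by exists (0, 0)].
(* Nearly opposite normals count as near too, because the covariance of two cosines involves u + u'
   as well as u - u'. *)
pose near : rel V := [rel v w | 1 - z ^+ 2 / 2 < `|dot (uh v).1 (uh w).1|].
pose c : R := 2 * (expR (- (z ^+ 2 * d%:R / 8)) * (L.*2.+1%:R) ^+ d).
have z2 : 0 < z ^+ 2 by rewrite exprn_gt0.
have [|||S [SG sep card]] := @greedy_separated R V G near c.
- move=> v /uhE [[uu _ _] _ _]; rewrite /near/= uu ger0_norm//; lra.
- by move=> v w; rewrite /near/= dotC.
- move=> w /uhE [[ww _ _] _ _].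
  pose B (s : R) := [set f : V | z * L%:R * Num.sqrt d%:R <= \sum_j (s *: (uh w).1) 0 j * ((f j)%:R - L%:R)]%SET.
  have sub : [set v in G | near w v]%SET \subset (B 1 :|: B (-1))%SET.
    apply/fintype.subsetP => v; rewrite inE => /andP[/uhE [[vv _ _] _ vg]].
    rewrite /near/= => nr.
    (* Replacing the normal of v by a unit vector within distance z changes the inner product with v
       by at most z L sqrt d, which leaves half of 2 z L sqrt d. *)
    have key (s : R) : s ^+ 2 = 1 -> 1 - z ^+ 2 / 2 < s * dot (uh w).1 (uh v).1 -> v \in B s.
      move=> s2 sn; rewrite inE.
      have -> : \sum_j (s *: (uh w).1) 0 j * ((v j)%:R - L%:R) = dot (s *: (uh w).1) (gridv v).
        by apply: eq_bigr => j _; rewrite !mxE.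
      set w1 := s *: (uh w).1.
      have dd : dot ((uh v).1 - w1) ((uh v).1 - w1) <= z ^+ 2.
        rewrite dotBl !dotBr vv /w1 !dotZl !dotZr ww (dotC (uh v).1) mulrA -expr2 s2; lra.
      have cs := dot_cauchy ((uh v).1 - w1) (gridv v).
      have gv := dot_gridv (R:=R) v.
      have cs2 : (dot ((uh v).1 - w1) (gridv v)) ^+ 2 <= (z * L%:R * Num.sqrt d%:R) ^+ 2.
        apply: le_trans cs _.
        have -> : (z * L%:R * Num.sqrt d%:R) ^+ 2 = z ^+ 2 * (d%:R * L%:R ^+ 2) by rewrite !exprMn sd2; ring.
        by apply: ler_pM => //; exact: dot_ge0.
      have cs3 : dot ((uh v).1 - w1) (gridv v) <= z * L%:R * Num.sqrt d%:R.
        have zL : 0 <= z * L%:R * Num.sqrt d%:R.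
          by apply: mulr_ge0; [apply: mulr_ge0|]; exact: ltW.
        exact: ler_of_sqr cs2.
      move: cs3 vg; rewrite dotBl; move: (dot w1 _) (dot (uh v).1 _) => a b h1 h2.
      have h3 : 2 * z * (L%:R * Num.sqrt d%:R) = 2 * (z * L%:R * Num.sqrt d%:R) by ring.
      by rewrite h3 in h2; lra.
    rewrite inE; move: nr; rewrite ltr_normr => /orP[h|h]; apply/orP; [left|right]; apply: key.
    - by rewrite expr1n.
    - by rewrite mul1r.
    - by rewrite sqrrN expr1n.
    - by rewrite mulN1r.
  have cB s : s ^+ 2 = 1 -> #|B s|%:R <= expR (- (z ^+ 2 * d%:R / 8)) * (L.*2.+1%:R) ^+ d.
    by move=> s2; apply: cap_count => //; rewrite dotZl dotZr ww mulr1 -expr2.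
  apply: (@le_trans _ _ (#|B 1|%:R + #|B (-1)|%:R)).
    rewrite -natrD ler_nat; apply: leq_trans (subset_leq_card sub) _.
    exact: (leq_card_setU _ _).1.
  rewrite /c mulrDl mul1r; apply: lerD; apply: cB; first by rewrite expr1n.
  by rewrite sqrrN expr1n.
exists {v | v \in S}, (fun v => (uh (val v)).1), (fun v => (uh (val v)).2).
have inG (v : {v | v \in S}) : val v \in G by apply: (fintype.subsetP SG); exact: (valP v).
split.
- by move=> v; have [] := uhE _ (inG v).
- by move=> v; have [] := uhE _ (inG v).
- move=> v w vw; rewrite leNgt; apply: (sep (val v) (val w)); try exact: valP.
  by rewrite (inj_eq val_inj).
rewrite card_sig.
have -> : #|[pred x | x \in S]| = #|S| by apply: eq_card.
have cV : #|V| = (L.*2.+1 ^ d)%N by rewrite card_ffun !card_ord.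
have GV : (L.*2.+1%:R) ^+ d <= 2 * #|G|%:R :> R.
  rewrite -natrX -natrM ler_nat /G.
  have := cardsC (badgrid L A g sg); rewrite cV => E.
  have := hbad d m A g d0 dm mLam hA.
  rewrite -/sg -E; clear; lia.
have Vp : 0 < (L.*2.+1%:R) ^+ d :> R by rewrite exprn_gt0// ltr0n.
have h1 : (L.*2.+1%:R) ^+ d <= 2 * (#|S|%:R * c) by apply: le_trans GV _; rewrite ler_pM2l.
rewrite /c in h1.
have : 1 <= 4 * (#|S|%:R * expR (- (z ^+ 2 * d%:R / 8))).
  rewrite -(ler_pM2r Vp) mul1r; lra.
rewrite expRN => h2.
have e0 := expR_gt0 (z ^+ 2 * d%:R / 8).
rewrite ler_pdivrMr// -[leLHS]mul1r.
move: h2; rewrite mulrA ler_pdivlMr// => h2; lra.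
Qed.

End family.

(** * Fejer kernels and the slab covering argument *)

Section fejer.
Context {R : realType}.
Implicit Types x y : R.

Lemma sin_le_id x : 0 <= x -> sin x <= x.
Proof.
rewrite le_eqVlt => /predU1P[<-|x0]; first by rewrite sin0.
have [|t t0 e] := @MVT R (@sin R) (@cos R) 0 x x0 (fun t _ => is_derive_sin t).
  by apply: continuous_subspaceT; exact: continuous_sin.
move: e; rewrite sin0 !subr0 => ->.
by rewrite ger_pMl// cos_le1.
Qed.

Lemma one_sub_cosE x : 1 - cos x = 2 * sin (x / 2) ^+ 2.
Proof.
have -> : cos x = cos ((x / 2) *+ 2) by congr cos; rewrite mulr2n; lra.
rewrite cos_mulr2n cos2sin2; ring.
Qed.

Lemma cos_ge_quad x : 1 - x ^+ 2 / 2 <= cos x.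
Proof.
wlog x0 : x / 0 <= x.
  move=> H; have [/H //|/ltW x0] := leP 0 x.
  by have := H (- x); rewrite cosN sqrrN oppr_ge0; exact.
have h2 : 0 <= x / 2 by lra.
have h := sin_le_id h2.
have e := one_sub_cosE x.
suff : sin (x / 2) ^+ 2 <= (x / 2) ^+ 2 by lra.
have [x1|x1] := leP x 2; last first.
  apply: (@le_trans _ _ 1); last by nra.
  by rewrite sin2cos2; have := sqr_ge0 (cos (x / 2)); lra.
have : 0 <= sin (x / 2).
  apply: sin_ge0_pi; rewrite h2/=.
  have := pihalf_ge1 R; lra.
nra.
Qed.

Lemma sin_ge_lin x : 0 <= x <= 1 -> x / 2 <= sin x.
Proof.
move=> /andP[]; rewrite le_eqVlt => /predU1P[<-|x0 x1]; first by rewrite sin0 mul0r.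
have [|t /andP[t0 tx] e] := @MVT R (@sin R) (@cos R) 0 x x0 (fun t _ => is_derive_sin t).
  by apply: continuous_subspaceT; exact: continuous_sin.
move: e; rewrite sin0 !subr0 => ->.
have := cos_ge_quad t; rewrite ?bnd_simp in t0 tx; nra.
Qed.

Lemma one_sub_cos_ge x : `|x| <= 1 -> x ^+ 2 / 8 <= 1 - cos x.
Proof.
wlog x0 : x / 0 <= x.
  move=> H; have [/H //|/ltW x0 x1] := leP 0 x.
  by have := H (- x); rewrite cosN sqrrN oppr_ge0 normrN; exact.
rewrite ger0_norm// one_sub_cosE => x1.
have : (x / 2) / 2 <= sin (x / 2) by apply: sin_ge_lin; lra.
nra.
Qed.

(** The square of |sum of exp(i k x) over k < q| divided by q, expanded into cosines so that its
    Gaussian expectations are explicit. *)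
Definition fejer (q : nat) x : R :=
  q%:R^-1 * \sum_(i : 'I_q * 'I_q) cos ((i.1%:R - i.2%:R) * x).

Lemma fejerE q x : fejer q x =
  q%:R^-1 * ((\sum_(i < q) cos (i%:R * x)) ^+ 2 + (\sum_(i < q) sin (i%:R * x)) ^+ 2).
Proof.
rewrite /fejer; congr (_ * _).
rewrite -(pair_bigA _ (fun i j : 'I_q => cos ((i%:R - j%:R) * x)))/=.
rewrite !expr2 !mulr_suml -big_split/=; apply: eq_bigr => i _.
rewrite !mulr_sumr -big_split/=; apply: eq_bigr => j _.
by rewrite mulrBl cosB.
Qed.

Lemma fejer_ge0 q x : 0 <= fejer q x.
Proof. by rewrite fejerE mulr_ge0// addr_ge0// sqr_ge0. Qed.

Lemma fejer_ge q x : `|q%:R * x| <= 1 -> q%:R / 4 <= fejer q x.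
Proof.
move=> qx; rewrite fejerE; case: q qx => [|q] qx; first by rewrite mul0r invr0 mul0r.
have q0 : 0 < q.+1%:R :> R by rewrite ltr0n.
have h : q.+1%:R / 2 <= \sum_(i < q.+1) cos (i%:R * x).
  have -> : q.+1%:R / 2 = \sum_(i < q.+1) (2^-1 : R).
    by rewrite sumr_const card_ord mulr_natl.
  apply: ler_sum => i _; apply: le_trans (cos_ge_quad _).
  have : (i%:R * x) ^+ 2 <= 1.
    have : `|i%:R * x| <= 1.
      apply: le_trans qx.
      by rewrite !normrM ler_wpM2r// !normr_nat ler_nat ltnW.
    by rewrite ler_norml => /andP[]; move: (_ * x) => t; nra.
  by lra.
rewrite [leRHS]mulrC ler_pdivlMr//.
have := sqr_ge0 (\sum_(i < q.+1) sin (i%:R * x)).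
have h' : (q.+1%:R / 2) ^+ 2 <= (\sum_(i < q.+1) cos (i%:R * x)) ^+ 2.
  by rewrite lerXn2r ?nnegrE// ?divr_ge0// (le_trans _ h)// divr_ge0.
by move: h'; rewrite expr_div_n; lra.
Qed.

(** The closed form (1 - cos(q x)) / (q (1 - cos x)), with numerator at most 2 and 1 - cos x >=
    x^2/8 on [-1, 1]. *)
Lemma fejer_off q x : x != 0 -> `|x| <= 1 -> fejer q x <= 16 / (q%:R * x ^+ 2).
Proof.
move=> x0 x1.
case: q => [|q]; first by rewrite /fejer invr0 !mul0r invr0 mulr0.
have q0 : 0 < q.+1%:R :> R by rewrite ltr0n.
have x2 : 0 < x ^+ 2 by rewrite exprn_even_gt0.
suff : fejer q.+1 x * (1 - cos x) <= 2 / q.+1%:R.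
  have := one_sub_cos_ge x1; have := fejer_ge0 q.+1 x => f0 h1 h2.
  have q2 : 0 < q.+1%:R * x ^+ 2 by exact: mulr_gt0.
  rewrite ler_pdivlMr//.
  have : fejer q.+1 x * (x ^+ 2 / 8) <= 2 / q.+1%:R.
    by apply: le_trans h2; rewrite ler_wpM2l.
  by rewrite ler_pdivlMr//; lra.
(* Real and imaginary parts of the geometric sum (1 - exp(i x)) times the sum of exp(i k x) over k <
   n, which is 1 - exp(i n x). *)
have H n : (1 - cos x) * (\sum_(i < n) cos (i%:R * x)) + sin x * (\sum_(i < n) sin (i%:R * x))
     = 1 - cos (n%:R * x) /\
   (1 - cos x) * (\sum_(i < n) sin (i%:R * x)) - sin x * (\sum_(i < n) cos (i%:R * x))
     = - sin (n%:R * x).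
  elim: n => [|n [IH1 IH2]]; first by rewrite !big_ord0 mul0r cos0 sin0; split; ring.
  rewrite !big_ord_recr/=.
  have -> : n.+1%:R * x = n%:R * x + x by rewrite -natr1 mulrDl mul1r.
  rewrite cosD sinD; split.
    transitivity ((1 - cos x) * (\sum_(i < n) cos (i%:R * x)) + sin x * (\sum_(i < n) sin (i%:R * x)) + ((1 - cos x) * cos (n%:R * x) + sin x * sin (n%:R * x))); first by ring.
    by rewrite IH1; ring.
  transitivity ((1 - cos x) * (\sum_(i < n) sin (i%:R * x)) - sin x * (\sum_(i < n) cos (i%:R * x)) + ((1 - cos x) * sin (n%:R * x) - sin x * cos (n%:R * x))); first by ring.
  by rewrite IH2; ring.
have [H1 H2] := H q.+1.
rewrite fejerE.
move: H1 H2; set S := \sum_(i < _) cos _; set S' := \sum_(i < _) sin _ => H1 H2.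
have c1 := cos2Dsin2 x; have c2 := cos2Dsin2 (q.+1%:R * x).
move: c1 c2 H1 H2 (cos_geN1 (q.+1%:R * x)).
set c := cos x; set s := sin x; set C := cos _; set C' := sin _ => c1 c2 H1 H2 C1.
have E : (S ^+ 2 + S' ^+ 2) * (1 - c) = 1 - C.
  suff : 2 * ((S ^+ 2 + S' ^+ 2) * (1 - c)) = 2 * (1 - C) by lra.
  transitivity ((S ^+ 2 + S' ^+ 2) * (1 - 2 * c + (c ^+ 2 + s ^+ 2))); first by rewrite c1; ring.
  transitivity (((1 - c) * S + s * S') ^+ 2 + ((1 - c) * S' - s * S) ^+ 2); first by ring.
  rewrite H1 H2; transitivity (1 - 2 * C + (C ^+ 2 + C' ^+ 2)); first by ring.
  by rewrite c2; ring.
rewrite -mulrA E mulrC ler_pM2r ?invr_gt0//; lra.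
Qed.

Lemma sum_shift_le (f : R -> R) (q j : nat) : (forall x, 0 <= f x) ->
  \sum_(i < q) f (i%:R - j%:R) <= \sum_(k < q) f k%:R + \sum_(k < j) f (- k.+1%:R).
Proof.
move=> f0; elim: j q => [|j IH] q.
  by rewrite big_ord0 addr0; apply: ler_sum => i _; rewrite subr0.
case: q => [|q]; first by rewrite !big_ord0 add0r sumr_ge0.
rewrite big_ord_recl/= sub0r big_ord_recr/= [\sum_(i < j.+1) _]big_ord_recr/=.
have := IH q; have := f0 q%:R.
under [\sum_(i < q) f (_ - j.+1%:R)]eq_bigr do rewrite /bump/= add1n -addn1 -(addn1 j) !natrD opprD addrACA subrr addr0.
lra.
Qed.

(** In place of a comparison with an integral: exp(y) >= (1 + y)^2 / 4 bounds each term by a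
    difference of consecutive values of 1/(1 + a k^2), and these telescope. *)
Lemma sum_gauss_le (a : R) (n : nat) : 0 < a ->
  \sum_(k < n) k%:R * expR (- (a * k%:R ^+ 2)) <= 4 / a.
Proof.
move=> a0.
have step (k : nat) : k.+1%:R * expR (- (a * k.+1%:R ^+ 2)) <=
   4 / a * ((1 + a * k%:R ^+ 2)^-1 - (1 + a * k.+1%:R ^+ 2)^-1).
  have kp : 0 < k.+1%:R :> R by rewrite ltr0n.
  have k0 : 0 <= k%:R :> R by [].
  have kE : k.+1%:R = k%:R + 1 :> R by rewrite natr1.
  rewrite kE in kp *; set x := k%:R in k0 kp *.
  set y := a * (x + 1) ^+ 2.
  have y0 : 0 < y by rewrite mulr_gt0// exprn_gt0.
  have x20 : 0 <= a * x ^+ 2 by rewrite mulr_ge0 ?sqr_ge0// ltW.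
  have p1 : 0 < 1 + a * x ^+ 2 by lra.
  have py : 0 < 1 + y by lra.
  have e1 : (1 + y) ^+ 2 / 4 <= expR y.
    have -> : y = y / 2 + y / 2 by lra.
    rewrite expRD; have := expR_ge1Dx (y / 2); nra.
  have e2 : expR (- y) <= 4 / (1 + y) ^+ 2.
    rewrite expRN -[leRHS]invrK lef_pV2 ?posrE ?expR_gt0//; last first.
      by rewrite invr_gt0 divr_gt0// exprn_gt0.
    by rewrite invf_div.
  have -> : (1 + a * x ^+ 2)^-1 - (1 + y)^-1 = a * (2 * x + 1) / ((1 + a * x ^+ 2) * (1 + y)).
    by rewrite /y in py *; field; rewrite !gt_eqF.
  apply: (@le_trans _ _ ((x + 1) * (4 / (1 + y) ^+ 2))); first by rewrite ler_pM2l.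
  have -> : 4 / a * (a * (2 * x + 1) / ((1 + a * x ^+ 2) * (1 + y))) =
     (2 * x + 1) * (4 / ((1 + a * x ^+ 2) * (1 + y))).
    by field; rewrite !gt_eqF.
  apply: ler_pM; [lra|by rewrite divr_ge0// ltW// exprn_gt0|lra|].
  rewrite ler_pM2l// lef_pV2 ?posrE ?exprn_gt0// ?mulr_gt0// expr2 ler_pM2r//.
  rewrite /y; nra.
have H (m : nat) : \sum_(k < m.+1) k%:R * expR (- (a * k%:R ^+ 2)) <= 4 / a * (1 - (1 + a * m%:R ^+ 2)^-1).
  elim: m => [|m IH]; first by rewrite big_ord1 mul0r expr0n/= mulr0 addr0 invr1 subrr mulr0.
  rewrite big_ord_recr/=; have := step m; move: IH; set u := 4 / a; nra.
case: n => [|n]; first by rewrite big_ord0 divr_ge0// ltW.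
apply: le_trans (H n) _; rewrite ger_pMr ?divr_gt0//.
have : 0 < (1 + a * n%:R ^+ 2)^-1 by rewrite invr_gt0 ltr_pwDl// mulr_ge0 ?sqr_ge0// ltW.
lra.
Qed.

(** The total weight of the frequencies in the covariance bounds below. Independence of [q] is
    essential, as [q] will grow exponentially in d. *)
Lemma fejer_weight_sum (q : nat) (b kap : R) : 0 < b -> 0 < kap ->
  q%:R^-1 * \sum_(i : 'I_q * 'I_q) `|(i.1%:R - i.2%:R) * kap| *
     expR (- (b * ((i.1%:R - i.2%:R) * kap) ^+ 2 / 2)) <= 16 / (b * kap).
Proof.
move=> b0 k0; case: q => [|q].
  by rewrite invr0 mul0r divr_ge0// mulr_ge0 ?ltW//.
have q0 : 0 < q.+1%:R :> R by rewrite ltr0n.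
pose f (x : R) := `|x * kap| * expR (- (b * (x * kap) ^+ 2 / 2)).
rewrite -(pair_bigA _ (fun i j : 'I_q.+1 => f (i%:R - j%:R)))/= exchange_big/=.
have f0 x : 0 <= f x by rewrite mulr_ge0// expR_ge0.
pose a := b * kap ^+ 2 / 2.
have a0 : 0 < a by rewrite divr_gt0// mulr_gt0// exprn_gt0.
have fE n : f n%:R = kap * (n%:R * expR (- (a * n%:R ^+ 2))).
  rewrite /f ger0_norm; last by rewrite mulr_ge0// ltW.
  by rewrite mulrA [kap * _]mulrC; congr (_ * expR _); rewrite /a exprMn; ring.
have fN n : f (- n%:R) = f n%:R by rewrite /f mulNr normrN sqrrN.
have S n : \sum_(k < n) f k%:R <= kap * (4 / a).
  under eq_bigr do rewrite fE.
  by rewrite -mulr_sumr ler_pM2l// sum_gauss_le.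
rewrite mulrC ler_pdivrMr//.
have -> : 16 / (b * kap) * q.+1%:R = \sum_(j < q.+1) (16 / (b * kap)).
  by rewrite sumr_const card_ord mulr_natr.
apply: ler_sum => j _; apply: le_trans (sum_shift_le _ _ f0) _.
have h2 : \sum_(k < j) f (- k.+1%:R) <= kap * (4 / a).
  apply: le_trans (S j.+1); rewrite big_ord_recl/=.
  under eq_bigr do rewrite fN.
  by rewrite lerDr.
have -> : 16 / (b * kap) = kap * (4 / a) + kap * (4 / a).
  by rewrite /a; field; rewrite !gt_eqF.
by apply: lerD => //; exact: S.
Qed.

End fejer.

Section bounded_measurable.
Context {R : realType} {disp} {T : measurableType disp} (P : probability T R).
Implicit Types f g : T -> R.

(** All integrands of the second moment computation are trigonometric polynomials in linear forms;
    this class is closed under sums and products, which settles integrability once and for all. *)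
Definition bmeas f := measurable_fun setT f /\ exists M, forall x, `|f x| <= M.

Lemma bmeas_int f : bmeas f -> P.-integrable setT (EFin \o f).
Proof. by move=> [mf [M hM]]; exact: bounded_integrable hM. Qed.

Lemma bmeas_cst c : bmeas (fun=> c).
Proof. by split => //; exists `|c|. Qed.

Lemma bmeasD f g : bmeas f -> bmeas g -> bmeas (fun x => f x + g x).
Proof.
move=> [mf [M hM]] [mg [N hN]]; split; first exact: measurable_funD.
by exists (M + N) => x; apply: le_trans (ler_normD _ _) _; exact: lerD.
Qed.

Lemma bmeasM f g : bmeas f -> bmeas g -> bmeas (fun x => f x * g x).
Proof.
move=> [mf [M hM]] [mg [N hN]]; split; first exact: measurable_funM.
by exists (M * N) => x; rewrite normrM; exact: ler_pM.
Qed.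

Lemma bmeasZ c f : bmeas f -> bmeas (fun x => c * f x).
Proof. by move=> bf; apply: bmeasM => //; exact: bmeas_cst. Qed.

Lemma bmeas_sum (I : finType) (r : seq I) (f : I -> T -> R) :
  (forall i, bmeas (f i)) -> bmeas (fun x => \sum_(i <- r) f i x).
Proof.
move=> bf; elim: r => [|i r IH].
  by under eq_fun do rewrite big_nil; exact: bmeas_cst.
by under eq_fun do rewrite big_cons; exact: bmeasD.
Qed.

Lemma RintD f g : bmeas f -> bmeas g ->
  \int[P]_x (f x + g x) = \int[P]_x f x + \int[P]_x g x.
Proof. by move=> bf bg; rewrite RintegralD//; exact: bmeas_int. Qed.

Lemma RintZ c f : bmeas f -> \int[P]_x (c * f x) = c * \int[P]_x f x.
Proof. by move=> bf; rewrite RintegralZl//; exact: bmeas_int. Qed.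

Lemma Rint_sum (I : finType) (r : seq I) (f : I -> T -> R) : (forall i, bmeas (f i)) ->
  \int[P]_x (\sum_(i <- r) f i x) = \sum_(i <- r) \int[P]_x f i x.
Proof.
move=> bf; elim: r => [|i r IH].
  by under eq_Rintegral do rewrite big_nil; rewrite big_nil; exact: Rint_cst.
under eq_Rintegral do rewrite big_cons.
by rewrite big_cons RintD// ?IH//; exact: bmeas_sum.
Qed.

Lemma chebyshev_bmeas f (t : R) : bmeas f -> 0 < t ->
  (P [set x | (t <= `|f x|)%R] <= (t ^- 2 * \int[P]_x (f x ^+ 2))%:E)%E.
Proof.
move=> bf t0.
have bf2 : bmeas (fun x => f x ^+ 2) by exact: bmeasM.
have mA : measurable [set x | t <= `|f x|].
  rewrite -[X in measurable X]setTI.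
  have -> : [set x | t <= `|f x|] = (fun x => `|f x|) @^-1` `[t, +oo[%classic.
    by apply/seteqP; split => x /=; rewrite in_itv/= andbT.
  apply: measurableT_comp => //; exact: bf.1.
rewrite EFinM lee_pdivlMl ?exprn_gt0//.
have -> : (\int[P]_x (f x ^+ 2))%:E = (\int[P]_x (f x ^+ 2)%:E)%E.
  rewrite /Rintegral fineK//; exact: integrable_fin_num (bmeas_int bf2).
rewrite -[P _]/(P _) -(setIT [set x | t <= `|f x|]) -integral_indic//.
rewrite -ge0_integralZl//; last 2 first.
- by apply/measurable_EFinP; exact: measurable_indic.
- by rewrite lee_fin exprn_ge0// ltW.
apply: ge0_le_integral => //.
- by move=> x _; rewrite mule_ge0// lee_fin exprn_ge0// ltW.
- apply: measurable_funeM; by apply/measurable_EFinP; exact: measurable_indic.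
- by apply/measurable_EFinP; exact: bf2.1.
move=> x _; rewrite -EFinM lee_fin indicE.
have [|_] := boolP (x \in _); rewrite ?mulr0 ?sqr_ge0// mulr1 inE/= => h.
rewrite -[leRHS]real_normK ?num_real//; apply: lerXn2r => //; rewrite nnegrE//; exact: ltW.
Qed.

End bounded_measurable.

(** * Covariances of cosines of linear forms *)

Section gaussian_linear.
Context {R : realType} {disp} {T : measurableType disp} (P : probability T R) {d : nat}
  (X : 'I_d -> T -> R) (sX : std_family P X).
Implicit Types u v : 'rV[R]_d.

Definition lin v w := \sum_j v 0 j * X j w.

Lemma measurable_lin v : measurable_fun setT (lin v).
Proof.
rewrite /lin; elim: (index_enum _) => [|i r IH].
  by under eq_fun do rewrite big_nil; exact: measurable_cst.
under eq_fun do rewrite big_cons; apply: measurable_funD => //.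
by apply: measurable_funM => //; exact: sX.1.
Qed.

Lemma lin_cos v b : \int[P]_w cos (lin v w + b) = expR (- (dot v v / 2)) * cos b.
Proof.
rewrite /lin (@std_cos R _ _ T P X (fun j => v 0 j) b (index_enum _) (index_enum_uniq _) sX).
by congr (expR (- (_ / 2)) * _); apply: eq_bigr => j _; rewrite expr2.
Qed.

Lemma linD u v w : lin (u + v) w = lin u w + lin v w.
Proof. by rewrite /lin -big_split; apply: eq_bigr => j _; rewrite mxE mulrDl. Qed.

Lemma linZ c v w : lin (c *: v) w = c * lin v w.
Proof. by rewrite /lin mulr_sumr; apply: eq_bigr => j _; rewrite mxE mulrA. Qed.

Lemma linN v w : lin (- v) w = - lin v w.
Proof. by rewrite -scaleN1r linZ mulN1r. Qed.

Lemma bmeas_lin_cos v b : bmeas (fun w => cos (lin v w + b)).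
Proof.
split; last by exists 1 => w; exact: cos_max.
apply: (measurableT_comp (f := @cos R)).
  by apply: continuous_measurable_fun; exact: continuous_cos.
by apply: measurable_funD => //; exact: measurable_lin.
Qed.

Lemma lin_coscos u v a b : \int[P]_w (cos (lin u w + a) * cos (lin v w + b)) =
  2^-1 * (expR (- (dot (u + v) (u + v) / 2)) * cos (a + b) +
          expR (- (dot (u - v) (u - v) / 2)) * cos (a - b)).
Proof.
rewrite -!lin_cos -RintD ?(RintZ _ _ (bmeasD _ _))//; try exact: bmeas_lin_cos.
rewrite -RintZ; last by apply: bmeasD; exact: bmeas_lin_cos.
apply: eq_Rintegral => w _; rewrite !linD linN.
have -> : lin u w + lin v w + (a + b) = (lin u w + a) + (lin v w + b) by ring.
have -> : lin u w - lin v w + (a - b) = (lin u w + a) - (lin v w + b) by ring.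
move: (lin u w + a) (lin v w + b) => y z.
rewrite cosD cosB; lra.
Qed.

Lemma expRN_diff (x y m : R) : m <= x -> m <= y ->
  `|expR (- x) - expR (- y)| <= `|x - y| * expR (- m).
Proof.
wlog xy : x y / x <= y.
  move=> H mx my; have [xy|/ltW yx] := leP x y; first exact: H.
  by rewrite distrC (distrC x); exact: H.
move=> mx my; rewrite ger0_norm; last by rewrite subr_ge0 ler_expR lerN2.
rewrite ler0_norm ?subr_le0// opprB.
have -> : expR (- y) = expR (- x) * expR (- (y - x)) by rewrite -expRD; congr expR; ring.
have h := expR_ge1Dx (- (y - x)).
have h2 : expR (- x) <= expR (- m) by rewrite ler_expR lerN2.
have h3 := expR_gt0 (- x).
apply: (@le_trans _ _ ((y - x) * expR (- x))); first nra.
by rewrite ler_wpM2l// subr_ge0.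
Qed.

(** For u = p + w with w orthogonal to the projected space and W = |w|^2, the subtracted term is the
    conditional expectation of the cosine given the projection of the Gaussian vector. So this is
    the deviation at frequency [k]. *)
Definition fluct (u p : 'rV[R]_d) (W h k : R) w :=
  cos (k * (lin u w - h)) - expR (- (k ^+ 2 * W / 2)) * cos (k * (lin p w - h)).

Lemma bmeas_kcos k v h : bmeas (fun w => cos (k * (lin v w - h))).
Proof.
have -> : (fun w => cos (k * (lin v w - h))) = (fun w => cos (lin (k *: v) w + (- (k * h)))).
  by apply/funext => w; rewrite linZ mulrBr.
exact: bmeas_lin_cos.
Qed.

Lemma bmeas_fluct u p W h k : bmeas (fluct u p W h k).
Proof.
apply: bmeasD; first exact: bmeas_kcos.
have -> : (fun x => - (expR (- (k ^+ 2 * W / 2)) * cos (k * (lin p x - h)))) =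
  (fun x => (- expR (- (k ^+ 2 * W / 2))) * cos (k * (lin p x - h))).
  by apply/funext => x; rewrite mulNr.
by apply: bmeasZ; exact: bmeas_kcos.
Qed.

(** Of the four products, the three that contain a conditional expectation have the same mean up to
    sign. What remains is a difference of two exponentials whose exponents differ by k k' dot(w,
    w'), and both exponents are large thanks to the angle between u and u'. *)
Lemma fluct_cov (u p w u' p' w' : 'rV[R]_d) (tau h h' k k' : R) :
  u = p + w -> u' = p' + w' -> dot p w = 0 -> dot p w' = 0 -> dot p' w = 0 -> dot p' w' = 0 ->
  dot u u = 1 -> dot u' u' = 1 -> `|dot u u'| <= 1 - tau -> 0 < tau ->
  `|\int[P]_x (fluct u p (dot w w) h k x * fluct u' p' (dot w' w') h' k' x)| <=
  `|dot w w'| * ((`|k| * expR (- (tau / 2 * k ^+ 2 / 2))) * (`|k'| * expR (- (tau / 2 * k' ^+ 2 / 2)))).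
Proof.
move=> uE u'E pw pw' p'w p'w' uu u'u' hr t0.
set W := dot w w; set W' := dot w' w'; set g := dot w w'.
set e := expR (- (k ^+ 2 * W / 2)); set e' := expR (- (k' ^+ 2 * W' / 2)).
pose Q := dot p p; pose Q' := dot p' p'; pose a := dot p p'.
have QW : Q + W = 1.
  by move: uu; rewrite uE !dotDl !dotDr pw (dotC w p) pw -/Q -/W => <-; ring.
have QW' : Q' + W' = 1.
  by move: u'u'; rewrite u'E !dotDl !dotDr p'w' (dotC w' p') p'w' -/Q' -/W' => <-; ring.
have uu' : dot u u' = a + g.
  by rewrite uE u'E !dotDl !dotDr pw' (dotC w p') p'w -/a -/g; ring.
have up' : dot u p' = a by rewrite uE dotDl (dotC w p') p'w addr0.
have pu' : dot p u' = a by rewrite u'E dotDr pw' addr0.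
have bound (x y : 'rV[R]_d) : `|dot x y| <= (dot x x + dot y y) / 2.
  have h1 := dot_ge0 (x + y); have h2 := dot_ge0 (x - y).
  move: h1 h2; rewrite !(dotDl, dotDr, dotNl, dotNr) (dotC y x) => h1 h2.
  rewrite ler_norml; apply/andP; split; lra.
(* If |w|^2 + |w'|^2 >= tau, the projections are short and their inner product is small; otherwise
   the inner product of the residuals is at most tau/2, and that of the projections differs from
   dot(u, u') by no more. *)
have ag : `|a| <= 1 - tau / 2.
  have ha := bound p p'; have hg := bound w w'.
  rewrite -/a -/g -/Q -/Q' -/W -/W' in ha hg.
  rewrite uu' in hr.
  have := ler_normB (a + g) g; rewrite addrK => hag.
  have [h1|h1] := leP tau (W + W'); lra.
pose b := - (k * h); pose b' := - (k' * h').
pose N s := (k ^+ 2 + k' ^+ 2 + s * (2 * k * k' * (a + g))) / 2.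
pose N' s := (k ^+ 2 + k' ^+ 2 + s * (2 * k * k' * a)) / 2.
have key : \int[P]_x (fluct u p W h k x * fluct u' p' W' h' k' x) =
   2^-1 * (cos (b + b') * (expR (- N 1) - expR (- N' 1)) +
           cos (b - b') * (expR (- N (-1)) - expR (- N' (-1)))).
  pose cc (x : 'rV[R]_d) (k0 b0 : R) y := cos (lin (k0 *: x) y + b0).
  have bc x k0 b0 : bmeas (cc x k0 b0) by exact: bmeas_lin_cos.
  transitivity (\int[P]_x ((cc u k b x * cc u' k' b' x + (- e') * (cc u k b x * cc p' k' b' x))
     + ((- e) * (cc p k b x * cc u' k' b' x) + (e * e') * (cc p k b x * cc p' k' b' x)))).
    apply: eq_Rintegral => x _; rewrite /fluct /cc -/e -/e' !linZ /b /b' !mulrBr; ring.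
  have bcc x k0 b0 x1 k1 b1 : bmeas (fun y => cc x k0 b0 y * cc x1 k1 b1 y) by apply: bmeasM.
  rewrite (@RintD _ _ _ P (fun x => cc u k b x * cc u' k' b' x + (- e') * (cc u k b x * cc p' k' b' x)));
    [|by apply: bmeasD => //; apply: bmeasZ|by apply: bmeasD; apply: bmeasZ].
  rewrite !(RintD P)//; try by apply: bmeasZ.
  rewrite !(RintZ P)//.
  rewrite !lin_coscos.
  have dd (x y : 'rV[R]_d) s : dot (k *: x + (s * k') *: y) (k *: x + (s * k') *: y) =
     k ^+ 2 * dot x x + s ^+ 2 * k' ^+ 2 * dot y y + s * (2 * k * k' * dot x y).
    rewrite !(dotDl, dotDr) !(dotZl, dotZr) (dotC y x); ring.
  have d1 (x y : 'rV[R]_d) : dot (k *: x + k' *: y) (k *: x + k' *: y) =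
     k ^+ 2 * dot x x + k' ^+ 2 * dot y y + (2 * k * k' * dot x y).
    by have := dd x y 1; rewrite mul1r => ->; ring.
  have d2 (x y : 'rV[R]_d) : dot (k *: x - k' *: y) (k *: x - k' *: y) =
     k ^+ 2 * dot x x + k' ^+ 2 * dot y y - (2 * k * k' * dot x y).
    by have := dd x y (-1); rewrite mulN1r scaleNr => ->; ring.
  rewrite !d1 !d2 uu u'u' uu' up' pu' -/Q -/Q' -/a.
  have e1 x : e * expR (- (x / 2)) = expR (- ((k ^+ 2 * W + x) / 2)).
    by rewrite /e -expRD; congr expR; lra.
  have e1' x : e' * expR (- (x / 2)) = expR (- ((k' ^+ 2 * W' + x) / 2)).
    by rewrite /e' -expRD; congr expR; lra.
  have QE : Q = 1 - W by lra.
  have QE' : Q' = 1 - W' by lra.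
  have s1 s : e' * expR (- ((k ^+ 2 * 1 + k' ^+ 2 * Q' + s * (2 * k * k' * a)) / 2)) = expR (- N' s).
    by rewrite e1' /N' QE'; congr expR; lra.
  have s2 s : e * expR (- ((k ^+ 2 * Q + k' ^+ 2 * 1 + s * (2 * k * k' * a)) / 2)) = expR (- N' s).
    by rewrite e1 /N' QE; congr expR; lra.
  have s3 s : e * e' * expR (- ((k ^+ 2 * Q + k' ^+ 2 * Q' + s * (2 * k * k' * a)) / 2)) = expR (- N' s).
    by rewrite -mulrA e1' e1 /N' QE QE'; congr expR; lra.
  have p1 := s1 1; have m1 := s1 (-1); have p2 := s2 1; have m2 := s2 (-1).
  have p3 := s3 1; have m3 := s3 (-1).
  rewrite !mul1r !mulN1r in p1 m1 p2 m2 p3 m3.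
  have NE1 : expR (- ((k ^+ 2 * 1 + k' ^+ 2 * 1 + 2 * k * k' * (a + g)) / 2)) = expR (- N 1).
    by congr expR; rewrite /N; lra.
  have NE2 : expR (- ((k ^+ 2 * 1 + k' ^+ 2 * 1 - 2 * k * k' * (a + g)) / 2)) = expR (- N (-1)).
    by congr expR; rewrite /N; lra.
  rewrite NE1 NE2; move: p1 m1 p2 m2 p3 m3.
  move: (expR (- N 1)) (expR (- N (-1))) (expR (- N' 1)) (expR (- N' (-1))) (cos (b + b')) (cos (b - b')).
  move=> n1 n2 n1' n2' c1 c2.
  set x1 := expR _; set x2 := expR _; set x3 := expR _; set x4 := expR _; set x5 := expR _; set x6 := expR _.
  move=> p1 m1 p2 m2 p3 m3.
  transitivity (2^-1 * (n1 * c1 + n2 * c2) - 2^-1 * ((e' * x1) * c1 + (e' * x2) * c2)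
     - 2^-1 * ((e * x3) * c1 + (e * x4) * c2) + 2^-1 * ((e * e' * x5) * c1 + (e * e' * x6) * c2)); first by ring.
  by rewrite p1 m1 p2 m2 p3 m3; ring.
rewrite key.
set m := tau / 2 * (k ^+ 2 + k' ^+ 2) / 2.
have low (s y : R) : s ^+ 2 = 1 -> `|y| <= 1 - tau / 2 ->
   m <= (k ^+ 2 + k' ^+ 2 + s * (2 * k * k' * y)) / 2.
  move=> s2 hy; rewrite /m.
  have : `|s * (2 * k * k' * y)| <= (k ^+ 2 + k' ^+ 2) * (1 - tau / 2).
    have s1 : `|s| = 1 by apply/eqP; rewrite -sqrp_eq1// -normrX s2 normr1.
    rewrite normrM s1 mul1r normrM; apply: ler_pM => //.
    rewrite ler_norml; apply/andP; split.
      by have := sqr_ge0 (k + k'); lra.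
    by have := sqr_ge0 (k - k'); lra.
  rewrite ler_norml => /andP[]; lra.
have NN s : s ^+ 2 = 1 -> `|expR (- N s) - expR (- N' s)| <= `|k * k' * g| * expR (- m).
  move=> s2; have -> : `|k * k' * g| = `|N s - N' s|.
    have -> : N s - N' s = s * (k * k' * g) by rewrite /N /N'; lra.
    have s1 : `|s| = 1 by apply/eqP; rewrite -sqrp_eq1// -normrX s2 normr1.
    by rewrite [RHS]normrM s1 mul1r.
  apply: expRN_diff; first by apply: low => //; rewrite -uu'; lra.
  exact: low.
have N1 := NN 1 (expr1n _ _).
have N2 := NN (-1); rewrite sqrrN expr1n in N2; have {}N2 := N2 erefl.
have -> : `|g| * ((`|k| * expR (- (tau / 2 * k ^+ 2 / 2))) * (`|k'| * expR (- (tau / 2 * k' ^+ 2 / 2))))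
  = `|k * k' * g| * expR (- m).
  rewrite !normrM /m.
  have -> : - (tau / 2 * (k ^+ 2 + k' ^+ 2) / 2) =
    - (tau / 2 * k ^+ 2 / 2) + - (tau / 2 * k' ^+ 2 / 2) by lra.
  by rewrite expRD; ring.
have c1 := cos_max (b + b'); have c2 := cos_max (b - b').
rewrite normrM ger0_norm; last by rewrite invr_ge0.
rewrite ler_pdivrMl//; apply: le_trans (ler_normD _ _) _.
rewrite mulr_natl mulr2n; apply: lerD; rewrite normrM -[leRHS]mul1r; exact: ler_pM.
Qed.

End gaussian_linear.

(** * Projecting away the common directions *)

Section projection.
Context {R : realType} {d : nat}.
Implicit Types u v w : 'rV[R]_d.

Definition orthonormal_family K (e : 'I_K -> 'rV[R]_d) := forall i j, dot (e i) (e j) = (i == j)%:R.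

Definition proj K (e : 'I_K -> 'rV[R]_d) v := \sum_i dot (e i) v *: e i.

Lemma dot_proj K (e : 'I_K -> 'rV[R]_d) u v : dot u (proj e v) = \sum_i dot (e i) u * dot (e i) v.
Proof.
rewrite /proj dot_sumr; apply: eq_bigr => i _; by rewrite dotZr (dotC u) mulrC.
Qed.

Lemma dot_basis_proj K (e : 'I_K -> 'rV[R]_d) i v : orthonormal_family e ->
  dot (e i) (v - proj e v) = 0.
Proof.
move=> oe; rewrite dotBr dot_proj (bigD1 i)//= oe eqxx mul1r big1 ?addr0 ?subrr//.
by move=> j /negbTE ji; rewrite oe ji mul0r.
Qed.

Lemma dot_proj_res K (e : 'I_K -> 'rV[R]_d) u v : orthonormal_family e ->
  dot (proj e u) (v - proj e v) = 0.
Proof.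
move=> oe; rewrite {1}/proj dot_suml big1// => i _.
by rewrite dotZl dot_basis_proj// mulr0.
Qed.

Lemma dot_res K (e : 'I_K -> 'rV[R]_d) u v : orthonormal_family e ->
  dot (u - proj e u) (v - proj e v) = dot (u - proj e u) v.
Proof. by move=> oe; rewrite [LHS]dotBr (dotC _ (proj e v)) dot_proj_res// subr0. Qed.

Lemma pythagoras K (e : 'I_K -> 'rV[R]_d) v : orthonormal_family e ->
  dot v v = \sum_i dot (e i) v ^+ 2 + dot (v - proj e v) (v - proj e v).
Proof.
move=> oe; rewrite dot_res// dotBl (dotC (proj e v)) dot_proj.
have -> : \sum_i dot (e i) v * dot (e i) v = \sum_i dot (e i) v ^+ 2.
  by apply: eq_bigr => i _; rewrite expr2.
by rewrite addrC subrK.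
Qed.

Lemma projB K (e : 'I_K -> 'rV[R]_d) u v : proj e (u - v) = proj e u - proj e v.
Proof. by rewrite /proj -sumrB; apply: eq_bigr => i _; rewrite dotBr scalerBl. Qed.

(** A vector is added as long as its squared inner products with the [u f] sum to more than eta M.
    By Bessel's inequality all these sums together are at most M, so at most 1/eta vectors are
    added. When no vector can be added, the normalised residuals themselves satisfy the opposite
    inequality. *)
Lemma greedy_orthonormal (F : finType) (u : F -> 'rV[R]_d) (eta : R) :
  (0 < #|F|)%N -> (forall f, dot (u f) (u f) = 1) -> 0 < eta ->
  exists K (e : 'I_K -> 'rV[R]_d), [/\ orthonormal_family e, K%:R * eta <= 1 &
    \sum_f \sum_f' dot (u f - proj e (u f)) (u f' - proj e (u f')) ^+ 2 <= eta * #|F|%:R ^+ 2].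
Proof.
move=> F0 uu eta0; set M := #|F|; have Mp : 0 < M%:R :> R by rewrite ltr0n.
pose good K (e : 'I_K -> 'rV[R]_d) := orthonormal_family e /\
  forall i, eta * M%:R < \sum_f dot (e i) (u f) ^+ 2.
have goodK K (e : 'I_K -> 'rV[R]_d) : good K e -> K%:R * eta <= 1.
  move=> [oe ge].
  have h : \sum_(i < K) (eta * M%:R) <= \sum_(f : F) (1 : R).
    apply: (@le_trans _ _ (\sum_(i < K) \sum_f dot (e i) (u f) ^+ 2)).
      by apply: ler_sum => i _; exact: ltW.
    rewrite exchange_big; apply: ler_sum => f _.
    have := pythagoras (u f) oe; rewrite uu => ->.
    by rewrite lerDl dot_ge0.
  move: h; rewrite !sumr_const card_ord -/M -[_ *+ K]mulr_natl mulrA -[leRHS]mul1r.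
  by rewrite ler_pM2r.
pose B := Num.truncn eta^-1.
have bound K : `[< exists e, good K e >] -> (K <= B)%N.
  move=> /asboolP[e /goodK h]; rewrite /B -ltnS.
  have : K%:R < B.+1%:R :> R.
    have : eta^-1 < B.+1%:R by rewrite /B truncnS_gt.
    apply: le_lt_trans; by rewrite -[leRHS]mul1r ler_pdivlMr.
  by rewrite ltr_nat.
have ex0 : exists K, `[< exists e, good K e >].
  exists 0%N; apply/asboolP; exists (fun=> 0); split; by case.
case: (ex_maxnP ex0 bound) => K /asboolP[e ge] Kmax.
have [oe he] := ge.
exists K, e; split => //; first exact: goodK ge.
have fresh v : dot v v = 1 -> (forall i, dot (e i) v = 0) ->
    \sum_f dot v (u f) ^+ 2 <= eta * M%:R.
  move=> vv ve; rewrite leNgt; apply/negP => hv.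
  suff : (K.+1 <= K)%N by rewrite ltnn.
  apply: Kmax; apply/asboolP.
  exists (fun i => if unlift ord_max i is Some j then e j else v); split.
    move=> i j; case: unliftP => [i' ->|->]; case: unliftP => [j' ->|->].
    - by rewrite oe (inj_eq lift_inj).
    - by rewrite ve (eq_sym _ ord_max) (negbTE (neq_lift _ _)).
    - by rewrite dotC ve (negbTE (neq_lift _ _)).
    - by rewrite vv eqxx.
  by move=> i; case: unliftP => [i' _|_].
have -> : eta * M%:R ^+ 2 = \sum_(f : F) (eta * M%:R).
  by rewrite sumr_const -/M -[RHS]mulr_natr expr2 mulrA.
apply: ler_sum => f _; set w := u f - proj e (u f).
under eq_bigr do rewrite dot_res//.
rewrite -/w; have [w0|wn0] := eqVneq w 0.
  rewrite w0 big1 ?mulr_ge0 ?ltW// => f' _; by rewrite dot0l expr0n.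
have ww : 0 < dot w w by rewrite lt_neqAle dot_ge0 eq_sym dot_eq0 wn0.
have ww1 : dot w w <= 1.
  have := pythagoras (u f) oe; rewrite uu -/w => ->.
  by rewrite lerDr sumr_ge0// => i _; rewrite sqr_ge0.
pose r := (Num.sqrt (dot w w))^-1.
have r2 : r ^+ 2 = (dot w w)^-1 by rewrite /r exprVn sqr_sqrtr// ltW.
have h : \sum_f0 dot (r *: w) (u f0) ^+ 2 <= eta * M%:R.
  apply: fresh; first by rewrite dotZl dotZr mulrA -expr2 r2 mulVf// gt_eqF.
  by move=> i; rewrite dotZr /w dot_basis_proj// mulr0.
have E : \sum_f0 dot (r *: w) (u f0) ^+ 2 = (dot w w)^-1 * \sum_f0 dot w (u f0) ^+ 2.
  by rewrite mulr_sumr; apply: eq_bigr => f0 _; rewrite dotZl exprMn r2.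
rewrite E ler_pdivrMl// in h; apply: le_trans h _.
by rewrite ger_pMl// mulr_gt0.
Qed.

(** Ensures that most kernels have a substantial conditional expectation. The K coordinates are
    sorted into bins of width 1/L. For two normals in the same bins and with residuals of square at
    most tau/4, the squared distance is less than K/L^2 + tau < 2 tau or so at most, whereas
    separation makes it at least 2 tau. *)
Lemma card_small_residual (F : finType) (u : F -> 'rV[R]_d) (tau : R) (K L : nat)
    (e : 'I_K -> 'rV[R]_d) : orthonormal_family e ->
  (forall f, dot (u f) (u f) = 1) ->
  (forall f f', f != f' -> dot (u f) (u f') <= 1 - tau) ->
  K%:R < tau * L%:R ^+ 2 ->
  (#|[set f | (dot (u f - proj e (u f)) (u f - proj e (u f)) <= tau / 4)%R]%SET| <= L.*2.+1 ^ K)%N.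
Proof.
move=> oe uu sep KL; set S := [set f | _]%SET.
have L0 : (0 < L)%N.
  rewrite lt0n; apply/eqP => L0; move: KL; rewrite L0 expr0n mulr0 ltNge ler0n//.
have Lp : 0 < L%:R :> R by rewrite ltr0n.
pose c f i := dot (e i) (u f).
have c1 f i : `|c f i| <= 1.
  have : c f i ^+ 2 <= 1.
    have := pythagoras (u f) oe; rewrite uu (bigD1 i)//= => ->.
    rewrite -addrA lerDl addr_ge0 ?dot_ge0// sumr_ge0// => j _; exact: sqr_ge0.
  by move=> h; rewrite ler_norml; apply/andP; split; nra.
pose bin f : {ffun 'I_K -> 'I_L.*2.+1} := [ffun i => inord (Num.truncn ((c f i + 1) * L%:R))].
have tr f i : let t := Num.truncn ((c f i + 1) * L%:R) in
    (t < L.*2.+1)%N /\ t%:R <= (c f i + 1) * L%:R < t.+1%:R.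
  move=> t; have := c1 f i; rewrite ler_norml => /andP[h1 h2].
  have h0 : 0 <= (c f i + 1) * L%:R by rewrite mulr_ge0//; lra.
  have := truncn_itv h0; rewrite -/t => /andP[h3 h4]; split; last by rewrite h3.
  rewrite ltnS -(ler_nat R); apply: le_trans h3 _.
  by rewrite -muln2 natrM mulrC ler_pM2l//; lra.
have inj : {in S &, injective bin}.
  move=> f f'; rewrite !inE => Sf Sf' bb; apply/eqP/negP => /negP ff'.
  have cl i : (c f i - c f' i) ^+ 2 <= L%:R ^- 2.
    have := congr1 (fun g : {ffun _ -> _} => g i) bb; rewrite !ffunE => /(congr1 val).
    have [t1 /andP[a1 a2]] := tr f i; have [t2 /andP[b1 b2]] := tr f' i.
    rewrite /= !inordK// => tt; rewrite tt -natr1 in a1 a2; rewrite -natr1 in b2.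
    have L2 : 0 < L%:R ^+ 2 :> R by exact: exprn_gt0.
    rewrite -[leRHS]mul1r ler_pdivlMr; last exact: L2.
    have h1 : -1 <= (c f i - c f' i) * L%:R by lra.
    have h2 : (c f i - c f' i) * L%:R <= 1 by lra.
    by rewrite -exprMn; move: h1 h2; move: (_ * L%:R) => y; nra.
  have oB := pythagoras (u f - u f') oe.
  have s1 : \sum_i dot (e i) (u f - u f') ^+ 2 <= K%:R * L%:R ^- 2.
    have -> : K%:R * L%:R ^- 2 = \sum_(i < K) (L%:R ^- 2 : R) by rewrite sumr_const card_ord mulr_natl.
    by apply: ler_sum => i _; rewrite dotBr; exact: cl.
  have s2 : K%:R * L%:R ^- 2 < tau by rewrite ltr_pdivrMr// exprn_gt0.
  rewrite projB in oB.
  have E : u f - u f' - (proj e (u f) - proj e (u f')) = (u f - proj e (u f)) - (u f' - proj e (u f')).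
    by rewrite !opprB addrACA [RHS]addrACA; congr (_ + _); exact: addrC.
  rewrite E in oB; move: Sf Sf' oB.
  move: (u f - proj e (u f)) (u f' - proj e (u f')) => w w' Sf Sf' oB.
  have uu' := sep _ _ ff'.
  have := dot_ge0 (w + w').
  move: s1 oB; move: (\sum_i _) => Sg s1; rewrite !(dotBl, dotBr, dotDl, dotDr) !uu (dotC (u f')) (dotC w' w) => oB ww.
  lra.
rewrite -(card_in_imset inj); apply: leq_trans (max_card _) _.
by rewrite card_ffun !card_ord.
Qed.

End projection.

Section markov_inequalities.
Context {R : realType} {disp} {T : measurableType disp} (P : probability T R).

Lemma markov_ge0 (A : set T) (F : T -> R) (c : R) : measurable A -> measurable_fun setT F ->
  (forall x, 0 <= F x) -> 0 <= c -> (forall x, A x -> c <= F x) ->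
  (c%:E * P A <= \int[P]_x (F x)%:E)%E.
Proof.
move=> mA mF F0 c0 hA.
rewrite -(setIT A) -integral_indic// -ge0_integralZl//; last first.
  by apply/measurable_EFinP; exact: measurable_indic.
apply: ge0_le_integral => //.
- by move=> x _; rewrite mule_ge0// lee_fin.
- by apply: measurable_funeM; apply/measurable_EFinP; exact: measurable_indic.
- exact/measurable_EFinP.
move=> x _; rewrite -EFinM lee_fin indicE.
by have [|_] := boolP (x \in _); rewrite ?mulr0// mulr1 inE => /hA.
Qed.

Lemma bmeas_EFin (f : T -> R) : bmeas f -> (\int[P]_x f x)%:E = (\int[P]_x (f x)%:E)%E.
Proof. by move=> bf; rewrite /Rintegral fineK//; exact: integrable_fin_num (bmeas_int _ bf). Qed.

End markov_inequalities.

(** * The average of the Fejer kernels *)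

Section cover_estimates.
Context {R : realType} {disp} {T : measurableType disp} (P : probability T R) {d : nat}
  (X : 'I_d -> T -> R) (sX : std_family P X).

Lemma lin_expR (v : 'rV[R]_d) : (\int[P]_w (expR (lin X v w))%:E = (expR (dot v v / 2))%:E)%E.
Proof.
have H := @std_prod_integral R _ _ T P X (fun j x => expR (v 0 j * x)) (index_enum 'I_d)
  (index_enum_uniq _) sX.
rewrite (eq_integral (fun w => (\prod_j expR (v 0 j * X j w))%:E)); last first.
  by move=> w _; rewrite /lin expR_sum.
rewrite H; last 2 first.
- by move=> j; apply: measurableT_comp => //; exact: measurable_funM.
- by move=> j x; exact: expR_ge0.
rewrite /dot mulr_suml expR_sum -prodEFin; apply: eq_bigr => j _.
have := @normal_quad_integral R 0 (v 0 j); rewrite addr0 sqrtr1 invr1 mul1r mulr1 expr2 => <-; last lra.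
by apply: eq_integral => x _; rewrite !mul0r oppr0 add0r.
Qed.

Variables (F : finType) (u : F -> 'rV[R]_d) (h : F -> R) (K : nat) (e : 'I_K -> 'rV[R]_d).
Hypotheses (oe : orthonormal_family e) (uu : forall f, dot (u f) (u f) = 1).
Local Notation p f := (proj e (u f)).
Local Notation w f := (u f - proj e (u f)).
Local Notation M := (#|F|%:R : R).

Definition freq q (kap : R) (i : 'I_q * 'I_q) : R := (i.1%:R - i.2%:R) * kap.

(** The Fejer kernel of one slab minus its conditional expectation [smoothed] given the projection,
    as [deviE] shows. *)
Definition devi q kap f x : R := q%:R^-1 * \sum_(i : 'I_q * 'I_q)
  fluct X (u f) (p f) (dot (w f) (w f)) (h f) (freq kap i) x.

(** The conditional expectation of the Fejer kernel: averaging over the residual part damps each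
    frequency by a Gaussian factor. *)
Definition smoothed q kap f x : R := q%:R^-1 * \sum_(i : 'I_q * 'I_q)
  expR (- (freq kap i ^+ 2 * dot (w f) (w f) / 2)) * cos (freq kap i * (lin X (p f) x - h f)).

Lemma deviE q kap f x :
  devi q kap f x = fejer q (kap * (lin X (u f) x - h f)) - smoothed q kap f x.
Proof.
rewrite /devi /fejer /smoothed -mulrBr -sumrB; congr (_ * _).
by apply: eq_bigr => i _; rewrite /fluct /freq mulrA.
Qed.

Lemma devi_le q kap f x : `|devi q kap f x| <= 2 * q%:R.
Proof.
case: q => [|q]; first by rewrite /devi invr0 mul0r normr0 mulr0.
have q0 : 0 < q.+1%:R :> R by rewrite ltr0n.
rewrite normrM ger0_norm ?invr_ge0// ler_pdivrMl//.
apply: le_trans (ler_norm_sum _ _ _) _.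
apply: (@le_trans _ _ (\sum_(i : 'I_q.+1 * 'I_q.+1) (2 : R))).
  apply: ler_sum => i _; rewrite /fluct; apply: le_trans (ler_normB _ _) _.
  rewrite -[leRHS]/(1 + 1); apply: lerD; first exact: cos_max.
  rewrite normrM -[leRHS]mulr1; apply: ler_pM => //; last exact: cos_max.
  rewrite ger0_norm ?expR_ge0// -[leRHS]expR0 ler_expR oppr_le0.
  by apply: divr_ge0 => //; apply: mulr_ge0; [exact: sqr_ge0|exact: dot_ge0].
by rewrite sumr_const card_prod !card_ord -[leLHS]mulr_natl natrM mulrAC -mulrA.
Qed.

Lemma bmeas_devi q kap f : bmeas (devi q kap f).
Proof. by apply: bmeasZ; apply: bmeas_sum => i; exact: (bmeas_fluct sX). Qed.

Lemma devi_cov q kap tau f f' : 0 < kap -> 0 < tau -> `|dot (u f) (u f')| <= 1 - tau ->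
  `|\int[P]_x (devi q kap f x * devi q kap f' x)| <=
   `|dot (w f) (w f')| * (32 / (tau * kap)) ^+ 2.
Proof.
move=> k0 t0 hr; case: q => [|q].
  under eq_Rintegral do rewrite /devi invr0 !mul0r.
  by rewrite (Rint_cst P 0) normr0 mulr_ge0// sqr_ge0.
have q0 : 0 < q.+1%:R :> R by rewrite ltr0n.
pose fl g i := fluct X (u g) (p g) (dot (w g) (w g)) (h g) (@freq q.+1 kap i).
have bfl g i : bmeas (fl g i) by exact: (bmeas_fluct sX).
pose wt (i : 'I_q.+1 * 'I_q.+1) := `|freq kap i| * expR (- (tau / 2 * freq kap i ^+ 2 / 2)).
have E : \int[P]_x (devi q.+1 kap f x * devi q.+1 kap f' x) =
    q.+1%:R^-1 * (q.+1%:R^-1 * \sum_i \sum_i' \int[P]_x (fl f i x * fl f' i' x)).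
  transitivity (\int[P]_x (q.+1%:R^-1 * (q.+1%:R^-1 * (\sum_i \sum_i' (fl f i x * fl f' i' x))))).
    apply: eq_Rintegral => x _; rewrite /devi mulrACA -mulrA; congr (_ * (_ * _)).
    by rewrite mulr_suml; apply: eq_bigr => i _; rewrite mulr_sumr.
  have b1 i : bmeas (fun x => \sum_i' (fl f i x * fl f' i' x)).
    by apply: bmeas_sum => i'; exact: bmeasM.
  have b2 : bmeas (fun x => \sum_i \sum_i' (fl f i x * fl f' i' x)) by exact: bmeas_sum.
  rewrite (RintZ P)//; last exact: bmeasZ.
  rewrite (RintZ P)// (Rint_sum P)//; congr (_ * (_ * _)); apply: eq_bigr => i _.
  by rewrite (Rint_sum P)// => i'; exact: bmeasM.
have S : q.+1%:R^-1 * \sum_i wt i <= 32 / (tau * kap).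
  have t2 : 0 < tau / 2 by lra.
  have := fejer_weight_sum q.+1 t2 k0.
  have -> : 16 / (tau / 2 * kap) = 32 / (tau * kap) by field; rewrite !gt_eqF.
  exact.
have qn : `|q.+1%:R^-1| = q.+1%:R^-1 :> R by rewrite ger0_norm ?invr_ge0.
rewrite E !normrM !qn.
apply: (@le_trans _ _ (q.+1%:R^-1 * (q.+1%:R^-1 * (\sum_i \sum_i' `|dot (w f) (w f')| * (wt i * wt i'))))).
  do 2 (rewrite ler_pM2l ?invr_gt0//).
  apply: le_trans (ler_norm_sum _ _ _) _; apply: ler_sum => i _.
  apply: le_trans (ler_norm_sum _ _ _) _; apply: ler_sum => i' _.
  apply: fluct_cov hr t0 => //; try by rewrite addrC subrK.
  - exact: dot_proj_res.
  - exact: dot_proj_res.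
  - exact: dot_proj_res.
  - exact: dot_proj_res.
have -> : \sum_i \sum_i' `|dot (w f) (w f')| * (wt i * wt i') =
   `|dot (w f) (w f')| * ((\sum_i wt i) * (\sum_i wt i)).
  rewrite mulr_suml mulr_sumr; apply: eq_bigr => i _.
  by rewrite mulr_sumr mulr_sumr.
have S0 : 0 <= q.+1%:R^-1 * \sum_i wt i.
  by rewrite mulr_ge0 ?invr_ge0// sumr_ge0// => i _; rewrite mulr_ge0// expR_ge0.
have -> : q.+1%:R^-1 * (q.+1%:R^-1 * (`|dot (w f) (w f')| * ((\sum_i wt i) * (\sum_i wt i)))) =
   `|dot (w f) (w f')| * (q.+1%:R^-1 * \sum_i wt i) ^+ 2 by ring.
by apply: ler_wpM2l => //; apply: lerXn2r => //; rewrite nnegrE//; exact: le_trans S.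
Qed.

(** The diagonal terms have only the crude bound 4 q^2, harmless after division by M because M is
    chosen much larger than q^2. The other terms are governed by the average of |dot(w, w')|. *)
Lemma second_moment q kap tau r : (0 < #|F|)%N -> 0 < kap -> 0 < tau -> 0 < r ->
  (forall f f', f != f' -> `|dot (u f) (u f')| <= 1 - tau) ->
  \sum_f \sum_f' dot (w f) (w f') ^+ 2 <= r ^+ 2 * M ^+ 2 ->
  \int[P]_x ((M^-1 * \sum_f devi q kap f x) ^+ 2) <=
    4 * q%:R ^+ 2 / M + r * (32 / (tau * kap)) ^+ 2.
Proof.
move=> F0 k0 t0 r0 sep hw; have Mp : 0 < M by rewrite ltr0n.
set B := (32 / (tau * kap)) ^+ 2; have B0 : 0 <= B by exact: sqr_ge0.
have bD f f' : bmeas (fun x => devi q kap f x * devi q kap f' x).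
  by apply: bmeasM; exact: bmeas_devi.
have -> : \int[P]_x ((M^-1 * \sum_f devi q kap f x) ^+ 2) =
   M^-1 * (M^-1 * \sum_f \sum_f' \int[P]_x (devi q kap f x * devi q kap f' x)).
  transitivity (\int[P]_x (M^-1 * (M^-1 * \sum_f \sum_f' (devi q kap f x * devi q kap f' x)))).
    apply: eq_Rintegral => x _; rewrite expr2 mulrACA -mulrA; congr (_ * (_ * _)).
    by rewrite mulr_suml; apply: eq_bigr => f _; rewrite mulr_sumr.
  have b1 f : bmeas (fun x => \sum_f' (devi q kap f x * devi q kap f' x)) by exact: bmeas_sum.
  have b2 : bmeas (fun x => \sum_f \sum_f' (devi q kap f x * devi q kap f' x)) by exact: bmeas_sum.
  rewrite (RintZ P)//; last exact: bmeasZ.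
  rewrite (RintZ P)// (Rint_sum P)//; congr (_ * (_ * _)); apply: eq_bigr => i _.
  by rewrite (Rint_sum P).
have hS : \sum_f \sum_f' \int[P]_x (devi q kap f x * devi q kap f' x) <=
    M * (4 * q%:R ^+ 2) + (\sum_f \sum_f' `|dot (w f) (w f')|) * B.
  have -> : M * (4 * q%:R ^+ 2) = \sum_(f : F) (4 * q%:R ^+ 2 : R) by rewrite sumr_const mulr_natl.
  rewrite mulr_suml -big_split/=; apply: ler_sum => f _.
  rewrite (bigD1 f)//=; apply: lerD.
    apply: le_trans (ler_norm _) _.
    apply: (bounded_Rintegral_norm P); first exact: (bD f f).1.
    move=> x; rewrite normrM; have := devi_le q kap f x; move: (`|_|) (normr_ge0 (devi q kap f x)) => y y0 hy.
    nra.
  rewrite mulr_suml [leRHS](bigD1 f)//=.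
  apply: ler_wpDl; first by rewrite mulr_ge0.
  apply: ler_sum => f' ff'; apply: le_trans (ler_norm _) _.
  by apply: devi_cov => //; apply: sep; rewrite eq_sym.
(* The arithmetic-geometric inequality |y| <= y^2/(2r) + r/2 turns the bound r^2 on the mean square
   into the bound r on the mean. *)
have hg : \sum_f \sum_f' `|dot (w f) (w f')| <= r * M ^+ 2.
  apply: (@le_trans _ _ (\sum_f \sum_f' (dot (w f) (w f') ^+ 2 * (2 * r)^-1 + r / 2))).
    apply: ler_sum => f _; apply: ler_sum => f' _.
    move: (dot _ _) => y.
    have -> : y ^+ 2 * (2 * r)^-1 + r / 2 = (y ^+ 2 + r ^+ 2) / (2 * r) by field; rewrite gt_eqF.
    rewrite ler_pdivlMr; last by rewrite mulr_gt0.
    have := sqr_ge0 (`|y| - r); rewrite -[y ^+ 2]real_normK ?num_real//; nra.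
  have -> : \sum_f \sum_f' (dot (w f) (w f') ^+ 2 * (2 * r)^-1 + r / 2) =
     (\sum_f \sum_f' dot (w f) (w f') ^+ 2) * (2 * r)^-1 + M ^+ 2 * (r / 2).
    have -> : M ^+ 2 * (r / 2) = \sum_(f : F) \sum_(f' : F) (r / 2).
      by rewrite !sumr_const -mulrnA -[RHS]mulr_natl natrM expr2.
    rewrite mulr_suml -big_split; apply: eq_bigr => f _.
    by rewrite mulr_suml -big_split.
  have : (\sum_f \sum_f' dot (w f) (w f') ^+ 2) * (2 * r)^-1 <= r ^+ 2 * M ^+ 2 * (2 * r)^-1.
    by rewrite ler_pM2r// invr_gt0 mulr_gt0.
  have -> : r ^+ 2 * M ^+ 2 * (2 * r)^-1 = M ^+ 2 * (r / 2) by field; rewrite gt_eqF.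
  lra.
rewrite mulrA -invfM ler_pdivrMl ?mulr_gt0//; apply: le_trans hS _.
have -> : M * M * (4 * q%:R ^+ 2 / M + r * B) = M * (4 * q%:R ^+ 2) + r * M ^+ 2 * B.
  by field; rewrite gt_eqF.
by rewrite lerD2l ler_wpM2r.
Qed.

(** The damped cosine sum shows no sign; written as a Gaussian average of Fejer kernels it is
    nonnegative and can be bounded below on a short interval. *)
Lemma smoothed_normal q kap f x : smoothed q kap f x =
  \int[normal_prob 0 1]_g fejer q (kap * (lin X (p f) x - h f + Num.sqrt (dot (w f) (w f)) * g)).
Proof.
set W := dot (w f) (w f); set y := _ - h f.
have bc t b : bmeas (fun g : R => cos (t * g + b)).
  split; last by exists 1 => g; exact: cos_max.
  apply: (measurableT_comp (f := @cos R)).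
    by apply: continuous_measurable_fun; exact: continuous_cos.
  by apply: measurable_funD => //; exact: measurable_funM.
transitivity (\int[normal_prob 0 1]_g (q%:R^-1 * \sum_(i : 'I_q * 'I_q)
   cos (freq kap i * Num.sqrt W * g + freq kap i * y))); last first.
  apply: eq_Rintegral => g _; congr (_ * _); apply: eq_bigr => i _.
  by congr cos; rewrite /freq; ring.
rewrite (RintZ (normal_prob 0 1)); last by apply: bmeas_sum => i; exact: bc.
rewrite (Rint_sum (normal_prob 0 1)); last by move=> i; exact: bc.
congr (_ * _); apply: eq_bigr => i _.
by rewrite normal_cos [(_ * Num.sqrt W) ^+ 2]exprMn (sqr_sqrtr (dot_ge0 _)).
Qed.

Lemma smoothed_ge0 q kap f x : 0 <= smoothed q kap f x.
Proof. by rewrite smoothed_normal; apply: Rintegral_ge0 => g _; exact: fejer_ge0. Qed.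

Lemma smoothed_lower q kap f x (th Y : R) : 0 < th -> th ^+ 2 <= dot (w f) (w f) ->
  0 < kap -> 1 <= q%:R * kap -> `|lin X (p f) x - h f| <= Y ->
  normal_peak 1 * expR (- (((1 + Y) / th) ^+ 2 / 2)) / 2 / kap <= smoothed q kap f x.
Proof.
move=> th0 hW k0 qk hY; set W := dot (w f) (w f) in hW *.
have Y0 : 0 <= Y by apply: le_trans hY.
set y := _ - h f in hY; pose t := Num.sqrt W.
have W1 : W <= 1.
  have := pythagoras (u f) oe; rewrite uu -/W => ->.
  by rewrite lerDr sumr_ge0// => i _; exact: sqr_ge0.
have t2 : t ^+ 2 = W by rewrite sqr_sqrtr// dot_ge0.
have t0 : 0 <= t by exact: sqrtr_ge0.
have tth : th <= t by apply: ler_of_sqr => //; rewrite t2.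
have t1 : t <= 1 by apply: ler_of_sqr => //; rewrite t2 expr1n.
have tp : 0 < t by exact: lt_le_trans tth.
have q0 : 0 < q%:R :> R by rewrite -(pmulr_lgt0 _ k0); exact: lt_le_trans qk.
(* The half-width of the region where the kernel is at least q/4. The corresponding [g] form an
   interval of length 2 rho/t, so q cancels and 1/kap remains. *)
set rho := (q%:R * kap)^-1.
have qkp : 0 < q%:R * kap by exact: lt_le_trans qk.
have rho0 : 0 < rho by rewrite invr_gt0.
have rho1 : rho <= 1 by rewrite invf_le1.
set G := (1 + Y) / th; set kk := normal_peak 1 * expR (- (G ^+ 2 / 2)).
have kk0 : 0 <= kk by rewrite mulr_ge0 ?expR_ge0// normal_peak_ge0.
pose a := (- rho - y) / t; pose b := (rho - y) / t.
have ab : a <= b by rewrite ler_pM2r ?invr_gt0//; lra.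
have inA g : a <= g <= b -> - rho <= y + t * g <= rho.
  rewrite /a /b ler_pdivrMr// ler_pdivlMr// => /andP[h1 h2]; lra.
have pdf g : a <= g <= b -> kk <= normal_pdf 0 1 g.
  move=> /inA /andP[g1 g2]; rewrite normal_pdf01E; apply: ler_wpM2l; first exact: normal_peak_ge0.
  rewrite ler_expR lerN2 ler_pM2r//.
  have G0 : 0 <= G by rewrite divr_ge0 ?(ltW th0)//; lra.
  have : `|t * g| <= 1 + Y.
    have := ler_normB (y + t * g) y; rewrite addrAC subrr add0r => h1.
    have : `|y + t * g| <= rho by rewrite ler_norml g1 g2.
    lra.
  rewrite normrM (ger0_norm t0) => h1.
  have h2 : `|g| <= G.
    rewrite /G ler_pdivlMr// mulrC; apply: le_trans h1; exact: ler_wpM2r.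
  rewrite -[g ^+ 2]real_normK ?num_real//; apply: lerXn2r => //; rewrite nnegrE//.
have NA := normal_prob_itv_ge ab pdf kk0.
have bf : bmeas (fun g : R => fejer q (kap * (y + t * g))).
  apply: bmeasZ; apply: bmeas_sum => i; split; last by exists 1 => g; exact: cos_max.
  apply: (measurableT_comp (f := @cos R)).
    by apply: continuous_measurable_fun; exact: continuous_cos.
  by do 2 (apply: measurable_funM => //); apply: measurable_funD => //; apply: measurable_funM.
have := @markov_ge0 R _ _ (normal_prob 0 1) `[a, b]%classic (fun g : R => fejer q (kap * (y + t * g))) (q%:R / 4).
move=> /(_ (measurable_itv _) bf.1).
rewrite -(bmeas_EFin (normal_prob 0 1) bf) => mk.
have -> : smoothed q kap f x = \int[normal_prob 0 1]_g fejer q (kap * (y + t * g)) by rewrite smoothed_normal.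
rewrite -lee_fin; apply: le_trans (mk _ _ _).
- apply: (@le_trans _ _ ((q%:R / 4)%:E * (kk * (b - a))%:E)%E); last first.
    by apply: lee_wpmul2l => //; rewrite lee_fin divr_ge0// ltW.
  rewrite -EFinM lee_fin.
  have -> : q%:R / 4 * (kk * (b - a)) = (kk / 2 / kap) / t.
    rewrite /a /b /rho; field; rewrite !gt_eqF//.
  rewrite ler_pdivlMr//; apply: ler_piMr => //.
  by apply: divr_ge0; [exact: divr_ge0|exact: ltW].
- by move=> g; exact: fejer_ge0.
- by rewrite divr_ge0// ltW.
move=> g; rewrite /= in_itv/= => /inA /andP[g1 g2]; apply: fejer_ge.
have -> : q%:R * (kap * (y + t * g)) = (q%:R * kap) * (y + t * g) by ring.
rewrite normrM gtr0_norm// -ler_pdivlMl// mulr1 -/rho ler_norml g1 g2//.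
Qed.

End cover_estimates.

(** * Hitting one of many thin slabs *)

Section cover.
Context {R : realType}.

Lemma expR_ge_lin (A eps : R) : 0 < A -> 0 < eps ->
  exists D : nat, forall d, (D <= d)%N -> A * d%:R <= expR (eps * d%:R).
Proof.
move=> A0 e0; exists (Num.truncn (4 * A / eps ^+ 2)).+1 => d hd.
have h : 4 * A / eps ^+ 2 <= d%:R.
  by apply: le_trans (ltW (truncnS_gt _)) _; rewrite ler_nat.
have e2 : 0 < eps ^+ 2 by rewrite exprn_gt0.
rewrite ler_pdivrMr// in h.
have -> : eps * d%:R = eps * d%:R / 2 + eps * d%:R / 2 by lra.
rewrite expRD; have h1 := expR_ge1Dx (eps * d%:R / 2).
have d0 : 0 <= d%:R :> R by [].
have h2 : 0 <= eps * d%:R / 2 by rewrite divr_ge0// mulr_ge0// ltW.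
apply: (@le_trans _ _ ((eps * d%:R / 2) * (eps * d%:R / 2))); first nra.
by apply: ler_pM => //; lra.
Qed.

Lemma measurable_le_fun {disp} {T : measurableType disp} (f g : T -> R) :
  measurable_fun setT f -> measurable_fun setT g -> measurable [set w | f w <= g w].
Proof.
move=> mf mg; have -> : [set w | f w <= g w] = ~` [set w | g w - f w < 0].
  by apply/seteqP; split => w /=; rewrite subr_lt0 leNgt => /negP.
by apply: measurableC; apply: measurable_lt; exact: measurable_funB.
Qed.

Lemma measurable_sum_fin {disp} {T : measurableType disp} (I : finType) (f : I -> T -> R) :
  (forall i, measurable_fun setT (f i)) -> measurable_fun setT (fun w => \sum_i f i w).
Proof.
move=> mf; elim: (index_enum I) => [|i r IH].
  by under eq_fun do rewrite big_nil; exact: measurable_cst.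
by under eq_fun do rewrite big_cons; exact: measurable_funD.
Qed.

Lemma measurable_miss {disp} {T : measurableType disp} {d} (X : 'I_d -> T -> R) (F : finType)
   (u : F -> 'rV[R]_d) (h : F -> R) (s c : R) : (forall j, measurable_fun setT (X j)) ->
  measurable [set w | (\sum_j X j w ^+ 2 <= c)%R /\ forall f, ~ (0 < h f - lin X (u f) w < s)].
Proof.
move=> mX.
have mlin v : measurable_fun setT (lin X v).
  by apply: measurable_sum_fin => j; exact: measurable_funM.
have -> : [set w | (\sum_j X j w ^+ 2 <= c)%R /\ forall f, ~ (0 < h f - lin X (u f) w < s)] =
  [set w | (\sum_j X j w ^+ 2 <= c)%R] `&`
  \bigcap_(f in [set: F]) ~` ([set w | 0 < h f - lin X (u f) w] `&` [set w | h f - lin X (u f) w < s]).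
  apply/seteqP; split => w /=.
    by move=> [h1 h2]; split => // f _ /= [h3 h4]; apply: (h2 f); rewrite h3.
  by move=> [h1 h2]; split => // f /andP[h3 h4]; apply: (h2 f).
apply: measurableI.
  by apply: measurable_le_fun => //; apply: measurable_sum_fin => j; exact: measurable_funM.
apply: fin_bigcap_measurable => [|f _]; first exact: finite_finset.
have ml : measurable_fun setT (fun w => h f - lin X (u f) w) by exact: measurable_funB.
apply: measurableC; apply: measurableI; last exact: measurable_lt.
have -> : [set w | 0 < h f - lin X (u f) w] = ~` [set w | h f - lin X (u f) w <= 0].
  by apply/seteqP; split => w /=; rewrite ltNge => /negP.
by apply: measurableC; apply: measurable_le_fun => //; exact: measurable_cst.
Qed.

(** The deterministic part. At least a quarter of the facets have a large residual and a bounded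
    projected form, so the conditional expectations average at least c1/(4 kap), and the kernels at
    least half of that. If every slab were missed, each kernel would be at most 64/(q kap^2 s^2),
    which is too small. [h'] is the centre of the slab. *)
Lemma no_miss {disp} {T : measurableType disp} d (X : 'I_d -> T -> R) (x : T) (F : finType)
    (u : F -> 'rV[R]_d) (h : F -> R) K (e : 'I_K -> 'rV[R]_d) (q : nat)
    (kap th2 th c1 C' H s : R) :
  let h' f := h f - s / 2 in let M := #|F|%:R in
  orthonormal_family e -> (forall f, dot (u f) (u f) = 1) ->
  (forall f, `|h f| <= H) -> 0 < M -> 0 < kap -> 0 < th -> th ^+ 2 = th2 -> 0 < C' ->
  0 < s <= 1 -> 0 < q%:R :> R -> 1 <= q%:R * kap -> 0 < c1 ->
  c1 = normal_peak 1 * expR (- (((1 + (C' + H + 1)) / th) ^+ 2 / 2)) / 2 ->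
  H + 1 <= 2 * (4 * kap)^-1 -> 512 < c1 * (q%:R * kap * s ^+ 2) ->
  \sum_j X j x ^+ 2 <= 4 * ((4 * kap)^-1) ^+ 2 ->
  (forall f, ~ (0 < h f - lin X (u f) x < s)) ->
  #|[set f | (dot (u f - proj e (u f)) (u f - proj e (u f)) <= th2)%R]%SET|%:R <= M / 4 ->
  \sum_f (expR (lin X (proj e (u f)) x) + expR (lin X (- proj e (u f)) x)) < M / 2 * expR C' ->
  `|M^-1 * \sum_f devi X u h' e q kap f x| < c1 / (8 * kap) -> False.
Proof.
move=> h' M oe uu hH Mp kap0 th0 th2E C'0 /andP[s0 s1] q0 qk1 c10 c1E sdH qk512 ax miss small n1 n2.
pose dv f x := devi X u h' e q kap f x.
have h'H f : `|h' f| <= H + 1.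
  by apply: le_trans (ler_normB _ _) _; rewrite (@ger0_norm _ (s / 2)) ?divr_ge0 ?ltW//; have := hH f; lra.
set sd := (4 * kap)^-1 in sdH ax.
have sd0 : 0 < sd by rewrite invr_gt0 mulr_gt0.
have kapE : kap = (4 * sd)^-1 by rewrite /sd; field; rewrite gt_eqF.
pose B := [set f | C' < `|lin X (proj e (u f)) x|]%SET.
have cB : #|B|%:R <= M / 2.
  have : #|B|%:R * expR C' < M / 2 * expR C'; last by rewrite ltr_pM2r ?expR_gt0// => /ltW.
  apply: le_lt_trans n1.
  have -> : #|B|%:R * expR C' = \sum_(f in B) expR C' by rewrite sumr_const mulr_natl.
  rewrite [leRHS](bigID (mem B))/=; apply: ler_wpDr.
    by apply: sumr_ge0 => f _; rewrite addr_ge0 ?expR_ge0.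
  apply: ler_sum => f; rewrite inE linN ltr_normr => /orP[hf|hf].
    by apply: ler_wpDr; rewrite ?expR_ge0// ler_expR ltW.
  by apply: ler_wpDl; rewrite ?expR_ge0// ler_expR ltW.
pose S := [set f | (dot (u f - proj e (u f)) (u f - proj e (u f)) <= th2)%R]%SET.
have cG : M / 4 <= #|~: (S :|: B)%SET|%:R.
  have := cardsC (S :|: B)%SET => /(congr1 (fun n => n%:R : R)).
  rewrite natrD -/M => h1.
  have h2 : #|(S :|: B)%SET|%:R <= #|S|%:R + #|B|%:R :> R.
    by rewrite -natrD ler_nat; exact: (leq_card_setU _ _).1.
  rewrite -/S in small; lra.
have lowS : M / 4 * (c1 / kap) <= \sum_f smoothed X u h' e q kap f x.
  apply: (@le_trans _ _ (\sum_(f in ~: (S :|: B)%SET) (c1 / kap))).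
    by rewrite sumr_const -[leRHS]mulr_natl ler_pM2r// divr_gt0.
  rewrite [leRHS](bigID (mem (~: (S :|: B)%SET)))/=; apply: ler_wpDr.
    by apply: sumr_ge0 => f _; exact: smoothed_ge0.
  apply: ler_sum => f; rewrite !inE negb_or -ltNge -leNgt => /andP[fS fB].
  rewrite c1E; apply: (smoothed_lower oe uu th0) => //; first by rewrite th2E ltW.
  apply: le_trans (ler_normB _ _) _; have := h'H f; lra.
pose fs f := fejer q (kap * (lin X (u f) x - h' f)).
have sumE : \sum_f fs f = \sum_f dv f x + \sum_f smoothed X u h' e q kap f x.
  by rewrite -big_split; apply: eq_bigr => f _; rewrite /dv deviE /= subrK.
have lowF : M * (c1 / (8 * kap)) < \sum_f fs f.
  rewrite sumE.
  have : - (c1 / (8 * kap)) < M^-1 * \sum_f dv f x by move: n2; rewrite ltr_norml => /andP[].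
  rewrite -ltr_pdivrMl ?invr_gt0// invrK => h1.
  have -> : M * (c1 / (8 * kap)) = M * - (c1 / (8 * kap)) + M / 4 * (c1 / kap) by field; rewrite gt_eqF.
  by apply: ltr_leD.
(* A missed slab leaves distance at least s/2 from its centre, and [kap] is so small that the
   argument of the kernel stays in [-1, 1], the range of [fejer_off]. *)
have up f : fs f <= 64 / (q%:R * kap ^+ 2 * s ^+ 2).
  set y := lin X (u f) x - h' f.
  have ys : s / 2 <= `|y|.
    rewrite leNgt; apply/negP; rewrite ltr_norml /y /h' => /andP[y1 y2].
    by apply: (miss f); apply/andP; split; lra.
  have lu : `|lin X (u f) x| <= 2 * sd.
    have cs := dot_cauchy (u f) (\row_j X j x).
    have l1 : dot (u f) (\row_j X j x) = lin X (u f) x by apply: eq_bigr => j _; rewrite mxE.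
    have l2 : dot (\row_j X j x) (\row_j X j x) = \sum_j X j x ^+ 2 by apply: eq_bigr => j _; rewrite !mxE.
    rewrite l1 l2 uu mul1r in cs; apply: ler_of_sqr; first by rewrite mulr_ge0 ?ltW.
    by rewrite real_normK ?num_real// exprMn; apply: le_trans cs _; lra.
  have y0 : 0 < `|y| by apply: lt_le_trans ys; rewrite divr_gt0.
  have ky : `|kap * y| <= 1.
    rewrite normrM gtr0_norm// kapE ler_pdivrMl ?mulr_gt0// mulr1.
    apply: le_trans (ler_normB _ _) _; have := h'H f; lra.
  have ky0 : kap * y != 0 by rewrite -normr_gt0 normrM gtr0_norm// mulr_gt0.
  apply: le_trans (fejer_off _ ky0 ky) _.
  have yy : s ^+ 2 / 4 <= y ^+ 2.
    rewrite -[leRHS]real_normK ?num_real//; have -> : s ^+ 2 / 4 = (s / 2) ^+ 2 by field.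
    by apply: lerXn2r => //; rewrite nnegrE// divr_ge0// ltW.
  have k20 : 0 < kap ^+ 2 by exact: exprn_gt0.
  have s20 : 0 < s ^+ 2 by exact: exprn_gt0.
  have -> : 64 / (q%:R * kap ^+ 2 * s ^+ 2) = 16 / (q%:R * kap ^+ 2 * (s ^+ 2 / 4)) by field; rewrite !gt_eqF.
  have qk2 : 0 < q%:R * kap ^+ 2 by exact: mulr_gt0.
  have s24 : 0 < s ^+ 2 / 4 by exact: divr_gt0.
  have -> : q%:R * (kap * y) ^+ 2 = q%:R * kap ^+ 2 * y ^+ 2 by ring.
  have p2 : 0 < q%:R * kap ^+ 2 * (s ^+ 2 / 4) by exact: mulr_gt0.
  have yy' : q%:R * kap ^+ 2 * (s ^+ 2 / 4) <= q%:R * kap ^+ 2 * y ^+ 2 by rewrite ler_pM2l.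
  by rewrite ler_pM2l// lef_pV2// posrE//; exact: lt_le_trans yy'.
have : \sum_f fs f <= M * (64 / (q%:R * kap ^+ 2 * s ^+ 2)).
  have -> : M * (64 / (q%:R * kap ^+ 2 * s ^+ 2)) = \sum_(f : F) (64 / (q%:R * kap ^+ 2 * s ^+ 2)).
    by rewrite sumr_const -[RHS]mulr_natl.
  by apply: ler_sum => f _.
move=> /(lt_le_trans lowF); rewrite ltr_pM2l//.
have -> : 64 / (q%:R * kap ^+ 2 * s ^+ 2) = 512 / (q%:R * kap * s ^+ 2) / (8 * kap).
  by field; rewrite !gt_eqF.
rewrite ltr_pM2r ?invr_gt0 ?mulr_gt0// ltr_pdivlMr.
  by move=> /(lt_trans qk512); rewrite ltxx.
by apply: mulr_gt0; [exact: mulr_gt0|exact: exprn_gt0].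
Qed.

End cover.

Section cover.
Context {R : realType}.

Lemma dot_proj_le1 d (v : 'rV[R]_d) K (e : 'I_K -> 'rV[R]_d) : orthonormal_family e ->
  dot v v = 1 -> dot (proj e v) (proj e v) <= 1.
Proof.
move=> oe vv; have h := pythagoras v oe; have h2 := dot_ge0 (v - proj e v).
have h3 := dot_proj_res v v oe; have h4 : dot (proj e v) v = \sum_i dot (e i) v ^+ 2.
  by rewrite dotC dot_proj; apply: eq_bigr => i _; rewrite expr2.
by rewrite dotBr in h3; rewrite vv -h4 in h; lra.
Qed.

Lemma expR_half_le : expR (1 / 2) <= 2 :> R.
Proof.
have e0 := expR_gt0 (1 / 2 : R).
have h : 1 / 2 <= (expR (1 / 2))^-1 :> R.
  by rewrite -expRN; have := expR_ge1Dx (- (1 / 2) : R); lra.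
by move: h; rewrite -(ler_pM2l e0) mulfV ?gt_eqF//; lra.
Qed.

(** The scales, with E = exp(z^2 d / 64): the width is s = E^(-1/2), the degree q is between E^2 and
    2 E^2, and M >= E^8/4. Then q s^2 is of order at least E, so missed kernels are negligible, and
    q^2/M is of order at most E^(-4), so the diagonal of the second moment is negligible. *)
Lemma cover (z H xi : R) : 0 < z -> 0 <= H -> 0 < xi ->
  exists D : nat, forall d, (D <= d)%N ->
  forall disp (T : measurableType disp) (P : probability T R) (X : 'I_d -> T -> R),
  std_family P X -> forall (F : finType) (u : F -> 'rV[R]_d) (h : F -> R),
  (forall f, dot (u f) (u f) = 1) -> (forall f, `|h f| <= H) ->
  (forall f f', f != f' -> `|dot (u f) (u f')| <= 1 - z ^+ 2 / 2) ->
  expR (z ^+ 2 * d%:R / 8) / 4 <= #|F|%:R ->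
  (P [set w | (\sum_j X j w ^+ 2 <= 4 * d%:R)%R /\
      forall f, ~ (0 < h f - lin X (u f) w < expR (- (z ^+ 2 * d%:R / 128)))%R] <= xi%:E)%E.
Proof.
move=> z0 H0 xi0.
(* The numerals are kept abstract: 192 = 3 * 8^2 stems from a third of [xi] times the square of
   c1/(8 kap), 768 is 4 * 192, and 32 is the constant of [second_moment]. *)
have [N1 [N10 N1a N1b]] : exists N1 : R, [/\ 0 < N1, 4 * 512 < N1 & 16 * 768 <= N1].
  move: (4 * 512) (16 * 768) => a b; exists (`|a| + `|b| + 1).
  have := ler_norm a; have := ler_norm b; have := normr_ge0 a; have := normr_ge0 b.
  by move: `|a| `|b| => a' b' *; split; lra.
have [N2 N20 N2E] : exists2 N2 : R, 0 < N2 & N2 = 192.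
  by exists 192 => //; rewrite ltr0n.
have [N3 N30 N3E] : exists2 N3 : R, 0 < N3 & N3 = 32.
  by exists 32 => //; rewrite ltr0n.
pose tau := z ^+ 2 / 2; have tau0 : 0 < tau by rewrite divr_gt0// exprn_gt0.
pose th := Num.sqrt (tau / 4).
have th0 : 0 < th by rewrite sqrtr_gt0 divr_gt0.
have th2 : th ^+ 2 = tau / 4 by rewrite sqr_sqrtr// divr_ge0// ltW.
(* Markov's inequality will bound the probability of too many large projected forms by 8 exp(-C'),
   which is at most 8/C' = xi/3. *)
pose C' := 24 / xi; have C'0 : 0 < C' by rewrite divr_gt0.
have eC : 8 * expR (- C') <= xi / 3.
  rewrite expRN -ler_pdivlMl// -[leRHS]invrK lef_pV2 ?posrE ?expR_gt0//; last first.
    by rewrite invr_gt0; lra.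
  apply: le_trans (expR_ge1Dx _); rewrite /C'.
  have -> : (8^-1 * (xi / 3))^-1 = 24 / xi by field; rewrite gt_eqF.
  lra.
pose Y := C' + H + 1.
pose c1 : R := normal_peak 1 * expR (- (((1 + Y) / th) ^+ 2 / 2)) / 2.
have c10 : 0 < c1 by rewrite divr_gt0// mulr_gt0 ?expR_gt0// normal_peak_gt0.
(* Solves r (32/(tau kap))^2 = (c1/(8 kap))^2 xi/3. Both sides scale like kap^(-2), so [r] does not
   depend on d, nor does the bound r^(-2) on the number of projected directions. *)
pose r := xi * c1 ^+ 2 * tau ^+ 2 / (N2 * N3 ^+ 2).
have c120 : 0 < c1 ^+ 2 by exact: exprn_gt0.
have tau20 : 0 < tau ^+ 2 by exact: exprn_gt0.
have r0 : 0 < r by apply: divr_gt0; [apply: mulr_gt0 => //; exact: mulr_gt0|exact: mulr_gt0 (exprn_gt0 _ _)].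
have r20 : 0 < r ^+ 2 by exact: exprn_gt0.
pose Km := Num.truncn (r ^+ 2)^-1.
(* The number of bins per coordinate: K <= r^(-2) implies K < tau L^2, as [card_small_residual]
   requires. *)
pose L := (Num.truncn (((r ^+ 2)^-1 + 1) / tau)).+1.
have hL K : K%:R * r ^+ 2 <= 1 -> (K <= Km)%N /\ K%:R < tau * L%:R ^+ 2.
  rewrite -ler_pdivlMr// mul1r => hK; split.
    by rewrite /Km truncn_ge_nat// invr_ge0 ltW.
  have h1 : ((r ^+ 2)^-1 + 1) / tau < L%:R by exact: truncnS_gt.
  have L1 : 1 <= L%:R :> R by rewrite ler1n.
  have i0 : 0 < (r ^+ 2)^-1 by rewrite invr_gt0.
  rewrite ltr_pdivrMr// in h1; nra.
have [N0 N00 hN0] : exists2 N0 : R, 0 <= N0 & forall K, (K <= Km)%N -> (L.*2.+1 ^ K)%:R <= N0.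
  exists ((L.*2.+1 ^ Km)%:R) => // K hKm; rewrite ler_nat; exact: leq_pexp2l.
(* Collects all lower bounds that [E] has to satisfy; for large d even A d <= E, which absorbs the
   factor 1/kap = 4 sqrt d. *)
pose A := 4 + N1 / c1 + 16 * N0 + N1 / (c1 ^+ 2 * xi).
have a1 : 0 < N1 / c1 by rewrite divr_gt0.
have a2 : 0 < N1 / (c1 ^+ 2 * xi) by apply: divr_gt0 => //; exact: mulr_gt0.
have A0 : 0 < A by rewrite /A; lra.
pose g8 := z ^+ 2 / 64.
have g80 : 0 < g8 by rewrite divr_gt0// exprn_gt0.
have [D1 hD1] := expR_ge_lin A0 g80.
exists (maxn 1 (maxn D1 (Num.truncn ((H + 1) ^+ 2)).+1)) => d.
rewrite !geq_max => /and3P[d1 dD1 dH] disp T P X sX F u h uu hH sep hM.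
have {hD1 dD1} hE := hD1 d dD1.
set E := expR (g8 * d%:R) in hE.
have dp : 1 <= d%:R :> R by rewrite ler1n.
have E0 : 0 < E by exact: expR_gt0.
have AE : A <= E by apply: le_trans hE; rewrite ler_peMr// ltW.
have sd0 : 0 < Num.sqrt d%:R :> R by rewrite sqrtr_gt0 ltr0n.
have sd2 : Num.sqrt d%:R ^+ 2 = d%:R :> R by rewrite sqr_sqrtr.
have sd1 : 1 <= Num.sqrt d%:R :> R by apply: ler_of_sqr; [exact: ltW|rewrite sd2 expr1n].
have sdd : Num.sqrt d%:R <= d%:R :> R by apply: ler_of_sqr => //; rewrite sd2 expr2; apply: ler_peMr.
have sdH : H + 1 <= Num.sqrt d%:R.
  apply: ler_of_sqr; first exact: ltW.
  by rewrite sd2; apply: le_trans (ltW (truncnS_gt _)) _; rewrite ler_nat.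
pose kap := (4 * Num.sqrt d%:R)^-1 : R.
have kap0 : 0 < kap by rewrite invr_gt0 mulr_gt0.
have kapd : (4 * d%:R)^-1 <= kap by rewrite lef_pV2 ?posrE ?mulr_gt0// ?ler_pM2l// ltr0n.
have kap1 : kap <= 1 by rewrite invf_le1 ?mulr_gt0//; lra.
have E1 : 1 <= E by rewrite /A in AE; lra.
have E20 : 0 < E ^+ 2 by exact: exprn_gt0.
have [q qE qE2] : exists2 q : nat, E ^+ 2 <= q%:R & q%:R <= 2 * E ^+ 2.
  exists (Num.truncn (E ^+ 2)).+1; first exact: ltW (truncnS_gt _).
  have t1 : (Num.truncn (E ^+ 2))%:R <= E ^+ 2 by rewrite truncn_le ltW.
  rewrite -natr1; have : 1 <= E ^+ 2 by rewrite exprn_ege1.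
  lra.
have q0 : 0 < q%:R :> R by exact: lt_le_trans qE.
set s := expR (- (z ^+ 2 * d%:R / 128)).
have s0 : 0 < s by exact: expR_gt0.
have s2 : s ^+ 2 = E^-1.
  rewrite -expRN expr2 -expRD; congr expR; rewrite /g8; clear; lra.
have s1 : s <= 1.
  by rewrite -[leRHS]expR0 ler_expR oppr_le0 divr_ge0// mulr_ge0// sqr_ge0.
have EM : E ^+ 8 / 4 <= #|F|%:R.
  apply: le_trans hM; rewrite -expRM_natl (_ : 8%:R * (g8 * d%:R) = z ^+ 2 * d%:R / 8)//.
  by rewrite /g8; clear; lra.
set M := #|F|%:R in EM hM.
have E8 : E <= E ^+ 8 by rewrite -[leLHS]expr1 ler_weXn2l.
have Mp : 0 < M by apply: lt_le_trans EM; rewrite divr_gt0// exprn_gt0.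
have F0 : (0 < #|F|)%N by rewrite -(ltr_nat R).
have qk : E / (4 * d%:R) <= q%:R * kap * s ^+ 2.
  have -> : E / (4 * d%:R) = E ^+ 2 * (4 * d%:R)^-1 * s ^+ 2.
    by rewrite s2; field; rewrite !gt_eqF ?ltr0n.
  rewrite ler_pM2r ?exprn_gt0//; apply: ler_pM; [exact: ltW| |exact: qE|exact: kapd].
  by rewrite invr_ge0 mulr_ge0.
have qkA : A / 4 <= q%:R * kap * s ^+ 2.
  apply: le_trans qk; rewrite ler_pdivlMr ?mulr_gt0 ?ltr0n//.
  by have -> : A / 4 * (4 * d%:R) = A * d%:R by field.
have qk1 : 1 <= q%:R * kap.
  have s21 : s ^+ 2 <= 1 by rewrite exprn_ile1// ltW.
  have qkp : 0 < q%:R * kap by rewrite mulr_gt0.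
  have : q%:R * kap * s ^+ 2 <= q%:R * kap by rewrite ler_piMr// ltW.
  rewrite /A in qkA; clear -qkA a1 a2 N00; lra.
have qk512 : 512 < c1 * (q%:R * kap * s ^+ 2).
  apply: (@lt_le_trans _ _ (c1 * (A / 4))); last by rewrite ler_pM2l.
  have -> : c1 * (A / 4) = c1 * (A - N1 / c1) / 4 + N1 / 4 by field; rewrite gt_eqF.
  have : 0 <= c1 * (A - N1 / c1) by rewrite mulr_ge0 ?ltW// /A; clear -a2 N00; lra.
  clear -N1a; move: (c1 * _) => cA; lra.
have [K [e [oe hK hW]]] := greedy_orthonormal F0 uu r20.
have [KKm KL] := hL K hK.
have small : #|[set f | (dot (u f - proj e (u f)) (u f - proj e (u f)) <= tau / 4)%R]%SET|%:R <= M / 4.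
  apply: (@le_trans _ _ N0).
    apply: le_trans (hN0 K KKm); rewrite ler_nat.
    apply: card_small_residual => // f f' ff'; apply: le_trans (ler_norm _) (sep _ _ ff').
  have : 16 * N0 <= A by rewrite /A; clear -a1 a2; lra.
  by clear -AE E8 EM; lra.
pose h' f := h f - s / 2.
have h'H f : `|h' f| <= H + 1.
  by apply: le_trans (ler_normB _ _) _; rewrite (@ger0_norm _ (s / 2)) ?divr_ge0 ?ltW//; have := hH f; clear -s1; lra.
pose dv f x := devi X u h' e q kap f x.
pose E1s := [set x | (M / 2 * expR C' <= \sum_f (expR (lin X (proj e (u f)) x) + expR (lin X (- proj e (u f)) x)))%R].
pose E2s := [set x | (c1 / (8 * kap) <= `|M^-1 * \sum_f dv f x|)%R].
have mlin v : measurable_fun setT (lin X v) by exact: (measurable_lin sX).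
have me v : measurable_fun setT (fun x => expR (lin X v x)) by apply: measurableT_comp => //; exact: mlin.
have mE1 : measurable E1s.
  apply: measurable_le_fun => //; apply: measurable_sum_fin => f; apply: measurable_funD; exact: me.
have bdv : bmeas (fun x => M^-1 * \sum_f dv f x).
  by apply: bmeasZ; apply: bmeas_sum => f; exact: (bmeas_devi sX).
have mE2 : measurable E2s.
  by apply: measurable_le_fun => //; apply: measurableT_comp => //; exact: bdv.1.
have P1 : (P E1s <= (xi / 3)%:E)%E.
  have c0 : 0 < M / 2 * expR C' by rewrite mulr_gt0 ?expR_gt0// divr_gt0.
  have := @markov_ge0 R _ _ P E1s (fun x => \sum_f (expR (lin X (proj e (u f)) x) + expR (lin X (- proj e (u f)) x))) (M / 2 * expR C') mE1.
  move=> /(_ _ _ _ (fun x => id)) mk.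
  have {}mk : ((M / 2 * expR C')%:E * P E1s <= (M * (2 * expR (1 / 2)))%:E)%E.
    apply: le_trans (mk _ _ _) _.
    - by apply: measurable_sum_fin => f; apply: measurable_funD; exact: me.
    - by move=> x; apply: sumr_ge0 => f _; rewrite addr_ge0 ?expR_ge0.
    - exact: ltW.
    under eq_integral do rewrite -sumEFin.
    rewrite ge0_integral_sum//; last first.
      by move=> f; apply/measurable_EFinP; apply: measurable_funD; exact: me.
    have -> : M * (2 * expR (1 / 2)) = \sum_(f : F) (2 * expR (1 / 2)) :> R by rewrite sumr_const -[RHS]mulr_natl.
    rewrite -sumEFin; apply: lee_sum => f _.
    under eq_integral do rewrite EFinD.
    rewrite ge0_integralD//; try (by apply/measurable_EFinP; exact: me);
      try (by move=> x _; rewrite lee_fin expR_ge0).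
    rewrite !(lin_expR sX) dotNl dotNr opprK -EFinD lee_fin -mulr2n mulr_natl ler_wMn2r//.
    rewrite ler_expR ler_pM2r//; exact: dot_proj_le1.
  rewrite -lee_pdivlMl// -EFinM in mk; apply: le_trans mk _.
  rewrite lee_fin; apply: le_trans eC.
  have -> : (M / 2 * expR C')^-1 * (M * (2 * expR (1 / 2))) = 4 * expR (1 / 2) * expR (- C').
    by rewrite expRN; field; rewrite !gt_eqF ?expR_gt0.
  have -> : 8 * expR (- C') = 4 * 2 * expR (- C') by congr (_ * _); rewrite -natrM.
  rewrite ler_pM2r ?expR_gt0// ler_pM2l//; exact: expR_half_le.
have P2 : (P E2s <= (xi / 3 + xi / 3)%:E)%E.
  have c0 : 0 < c1 / (8 * kap) by rewrite divr_gt0// mulr_gt0.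
  apply: le_trans (chebyshev_bmeas P bdv c0) _; rewrite lee_fin.
  have := @second_moment R _ T P d X sX F u h' K e oe uu q kap tau r F0 kap0 tau0 r0 sep hW.
  rewrite -/M => sm; rewrite -ler_pdivlMl; last by rewrite invr_gt0 exprn_gt0.
  apply: le_trans sm _; rewrite invrK.
  have -> : (c1 / (8 * kap)) ^+ 2 * (xi / 3 + xi / 3) =
     c1 ^+ 2 * xi / (N2 * kap ^+ 2) + c1 ^+ 2 * xi / (N2 * kap ^+ 2) by rewrite N2E; field; rewrite gt_eqF.
  apply: lerD.
    apply: (@le_trans _ _ (c1 ^+ 2 * xi / N2)); last first.
      rewrite ler_pM2l; last by rewrite mulr_gt0.
      have k20 : 0 < kap ^+ 2 by exact: exprn_gt0.
      have k21 : kap ^+ 2 <= 1 by apply: exprn_ile1 => //; exact: ltW.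
      rewrite lef_pV2 ?posrE//; last exact: mulr_gt0.
      by apply: ler_piMr => //; exact: ltW.
    have q2 : q%:R ^+ 2 <= 4 * E ^+ 4.
      have -> : 4 * E ^+ 4 = (2 * E ^+ 2) ^+ 2 by ring.
      by apply: lerXn2r => //; rewrite nnegrE// mulr_ge0// ltW.
    rewrite ler_pdivrMr//; apply: (@le_trans _ _ (16 * E ^+ 4)); first by clear -q2; lra.
    apply: (@le_trans _ _ (c1 ^+ 2 * xi / N2 * (E ^+ 8 / 4))); last first.
      by rewrite ler_pM2l// divr_gt0// mulr_gt0.
    have -> : c1 ^+ 2 * xi / N2 * (E ^+ 8 / 4) = (c1 ^+ 2 * xi * E ^+ 4 / 768) * E ^+ 4 by rewrite N2E; field.
    rewrite ler_pM2r ?exprn_gt0//.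
    have E4 : E <= E ^+ 4 by rewrite -[leLHS]expr1 ler_weXn2l.
    have A2 : N1 / (c1 ^+ 2 * xi) <= E ^+ 4 by apply: le_trans E4; apply: le_trans AE; rewrite /A; clear -a1 N00; lra.
    have cx : 0 < c1 ^+ 2 * xi by exact: mulr_gt0.
    rewrite ler_pdivrMr// mulrC in A2.
    by rewrite ler_pdivlMr ?ltr0n//; apply: le_trans N1b A2.
  have -> : r * (32 / (tau * kap)) ^+ 2 = c1 ^+ 2 * xi / (N2 * kap ^+ 2); last by [].
  by rewrite /r -N3E; field; rewrite !gt_eqF.
apply: (@le_trans _ _ (P (E1s `|` E2s))); last first.
  apply: le_trans (measureU2 _ mE1 mE2) _.
  by apply: le_trans (leeD P1 P2) _; rewrite -EFinD lee_fin; clear; lra.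
apply: le_measure; rewrite ?inE; [exact: measurable_miss sX.1|exact: measurableU|].
move=> x /= [ax miss]; apply: contrapT => /not_orP[/negP n1 /negP n2].
rewrite -ltNge in n1; rewrite -ltNge in n2.
have sdE : (4 * kap)^-1 = Num.sqrt d%:R.
  by rewrite /kap; field; rewrite gt_eqF.
apply: (@no_miss R _ T d X x F u h K e q kap (tau / 4) th c1 C' H s oe uu hH Mp kap0 th0 th2 C'0 _ q0
  qk1 c10 erefl _ qk512 _ miss small n1 n2); first by rewrite s0 s1.
- by rewrite sdE; clear -sdH sd0; lra.
- by rewrite sdE sd2.
Qed.

End cover.

(** * Roundness of random polytopes *)

Section std_more.
Context {R : realType} {disp} {T : measurableType disp} (P : probability T R).

(** The same induction as for single coordinates, with the whole block [k0] read off the first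
    factor of the product space. *)
Lemma std_block_integral (I K : finType) (X : I -> T -> R) (b : I -> K)
   (f : K -> coords R I -> R) (r : seq K) : uniq r -> std_family P X ->
  (forall k, measurable_fun setT (f k)) -> (forall k x, 0 <= f k x) ->
  (forall k x y, (forall i, b i = k -> x i = y i) -> f k x = f k y) ->
  (\int[P]_w (\prod_(k <- r) f k (fun i => X i w))%:E =
   \prod_(k <- r) \int[P]_w (f k (fun i => X i w))%:E)%E.
Proof.
move=> ur sX mf f0 fb; elim: r ur => [_|k0 r IH /andP[k0r ur]].
  under eq_integral do rewrite big_nil.
  rewrite big_nil; have := expectation_cst P 1; by rewrite unlock.
rewrite big_cons -IH//.
pose F (x : coords R I) := (\prod_(k <- k0 :: r) f k x)%:E.
have mF : measurable_fun setT F by apply/measurable_EFinP; exact: measurable_prod.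
have F0 x : (0 <= F x)%E by rewrite lee_fin prodr_ge0.
have sY := std_split [pred i | b i == k0] sX.
rewrite (std_ge0_integral sX sY mF F0).
have mX := measurable_to_coords sX.1.
rewrite (@fubini_tonelli1 _ _ _ _ _ P P); last 2 first.
- apply: (measurableT_comp mF); apply: (measurable_to_coords sY.1).
- by move=> z; exact: F0.
rewrite /fubini_F /F.
have mr : measurable_fun setT (fun w => (\prod_(k <- r) f k (fun i => X i w))%:E).
  apply/measurable_EFinP; apply: measurable_prod => k _.
  exact: (measurableT_comp (mf k) mX).
have r0 w : (0 <= (\prod_(k <- r) f k (fun i => X i w))%:E)%E by rewrite lee_fin prodr_ge0.
transitivity (\int[P]_x ((f k0 (fun i => X i x))%:E * \int[P]_w (\prod_(k <- r) f k (fun i => X i w))%:E))%E.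
  apply: eq_integral => x _; rewrite -ge0_integralZl ?lee_fin//.
  apply: eq_integral => y _; rewrite big_cons/= -EFinM; congr (_ * _)%:E.
    by apply: fb => i ->; rewrite eqxx.
  apply: eq_big_seq => k kr; apply: fb => i bi.
  by case: eqP => // bk; rewrite -bk bi kr in k0r.
rewrite ge0_integralZr//.
- by apply/measurable_EFinP; exact: (measurableT_comp (mf k0) mX).
- by move=> x _; rewrite lee_fin.
- by apply: integral_ge0.
Qed.

Lemma std_sub (I J : finType) (X : I -> T -> R) (s : J -> I) : injective s ->
  std_family P X -> std_family P (fun j => X (s j)).
Proof.
move=> si [mX sX]; split=> [j|B mB]; first exact: mX.
pose B' i := if [pick j | s j == i] is Some j then B j else setT.
have B's j : B' (s j) = B j.
  rewrite /B'; case: pickP => [j' /eqP/si -> //|/(_ j)]; by rewrite eqxx.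
have mB' i : measurable (B' i) by rewrite /B'; case: pickP.
have -> : [set w | forall j, B j (X (s j) w)] = [set w | forall i, B' i (X i w)].
  apply/seteqP; split => w /= h => [i|j]; last by have := h (s j); rewrite B's.
  by rewrite /B'; case: pickP => // j /eqP <-; exact: h.
rewrite sX// (bigID (mem (codom s)))/= [X in (_ * X)%E]big1 ?mule1; last first.
  move=> i; rewrite /B'; case: pickP => [j /eqP <-|_ _]; first by rewrite codom_f.
  exact: probability_setT.
rewrite -big_uniq/=; last by rewrite map_inj_uniq ?enum_uniq.
by rewrite big_map enumT; apply: eq_bigr => j _; rewrite B's.
Qed.

Lemma union_le (I : eqType) (r : seq I) (E : I -> set T) (c : R) : (forall i, measurable (E i)) ->
  (forall i, i \in r -> (P (E i) <= c%:E)%E) ->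
  measurable [set w | exists2 i, i \in r & E i w] /\
  (P [set w | exists2 i, i \in r & E i w] <= ((size r)%:R * c)%:E)%E.
Proof.
move=> mE; elim: r => [|i r IH] hE.
  have -> : [set w | exists2 i, i \in [::] & E i w] = set0 by apply/seteqP; split => w // [].
  by rewrite measure0 mul0r.
have [|m1 p1] := IH; first by move=> j jr; apply: hE; rewrite in_cons jr orbT.
have -> : [set w | exists2 j, j \in i :: r & E j w] = E i `|` [set w | exists2 j, j \in r & E j w].
  apply/seteqP; split => w /=.
    by move=> [j]; rewrite in_cons => /predU1P[->|jr] Ej; [left|right; exists j].
  by move=> [Ei|[j jr Ej]]; [exists i; rewrite ?mem_head|exists j; rewrite // in_cons jr orbT].
split; first exact: measurableU.
apply: le_trans (measureU2 _ (mE i) m1) _.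
have hi : (P (E i) <= c%:E)%E by apply: hE; rewrite mem_head.
apply: le_trans (leeD hi p1) _.
by rewrite -EFinD lee_fin /= -(addn1 (size r)) natrD mulrDl mul1r addrC.
Qed.

Section rows.
Context {d : nat} (X : 'I_d -> T -> R) (sX : std_family P X).

(** Anticoncentration from the characteristic function alone: the Fejer kernel is at least q/4 on
    the interval, and its mean is a sum of Gaussian values, compared with geometric ones. *)
Lemma lin_interval (v : 'rV[R]_d) (sg s c : R) : 0 < sg -> dot v v = sg ^+ 2 -> 0 < s ->
  (P [set w | (`|lin X v w - c| <= s)%R] <= (64 * s / sg)%:E)%E.
Proof.
(* With kap = 1/(q s) the kernel is large on exactly the right scale, and q >= sg/s makes the decay
   rate t = kap sg/2 at most 1. *)
move=> sg0 vv s0; pose q := (Num.truncn (sg / s)).+1.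
have qs : sg / s <= q%:R by exact: ltW (truncnS_gt _).
have q0 : 0 < q%:R :> R by rewrite ltr0n.
pose kap := (q%:R * s)^-1.
have qs0 : 0 < q%:R * s by exact: mulr_gt0.
have kap0 : 0 < kap by rewrite invr_gt0.
set A := [set w | _].
have mA : measurable A.
  apply: measurable_le_fun => //; apply: measurableT_comp => //.
  by apply: measurable_funB => //; exact: (measurable_lin sX).
have bc k : bmeas (fun w => cos (k * (lin X v w - c))) by exact: (bmeas_kcos sX).
have fE w : fejer q (kap * (lin X v w - c)) =
    q%:R^-1 * \sum_(i : 'I_q * 'I_q) cos (freq kap i * (lin X v w - c)).
  by congr (_ * _); apply: eq_bigr => i _; rewrite mulrA.
have bf : bmeas (fun w => fejer q (kap * (lin X v w - c))).
  have -> : (fun w => fejer q (kap * (lin X v w - c))) = (fun w => q%:R^-1 * \sum_(i : 'I_q * 'I_q) cos (freq kap i * (lin X v w - c))).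
    by apply/funext.
  by apply: bmeasZ; apply: bmeas_sum.
have q4 : 0 <= q%:R / 4 :> R by rewrite divr_ge0// ltW.
have mk := @markov_ge0 R _ T P A (fun w => fejer q (kap * (lin X v w - c))) (q%:R / 4) mA bf.1
  (fun w => fejer_ge0 _ _) q4.
have {}mk : ((q%:R / 4)%:E * P A <= (\int[P]_w fejer q (kap * (lin X v w - c)))%:E)%E.
  rewrite (bmeas_EFin P bf); apply: mk => w Aw; apply: fejer_ge.
  rewrite mulrA normrM gtr0_norm; last exact: mulr_gt0.
  apply: (@le_trans _ _ (q%:R * kap * s)); first by rewrite ler_pM2l// mulr_gt0.
  by rewrite /kap le_eqVlt; apply/orP; left; apply/eqP; field; rewrite !gt_eqF.
have int : \int[P]_w fejer q (kap * (lin X v w - c)) <= 16 * (q%:R * s) / sg.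
  under eq_Rintegral do rewrite fE.
  rewrite (RintZ P); last exact: bmeas_sum.
  rewrite (Rint_sum P)//.
  pose t := kap * sg / 2.
  have t0 : 0 < t by rewrite divr_gt0// mulr_gt0.
  have t1 : t <= 1.
    rewrite /t /kap ler_pdivrMr// mul1r ler_pdivrMl//.
    rewrite ler_pdivrMr// in qs; have := mulr_gt0 q0 s0; lra.
  have term (i : 'I_q * 'I_q) : \int[P]_w cos (freq kap i * (lin X v w - c)) <=
      2 * expR (- t * `|i.1%:R - i.2%:R|).
    have -> : \int[P]_w cos (freq kap i * (lin X v w - c)) =
        expR (- (freq kap i ^+ 2 * sg ^+ 2 / 2)) * cos (- (freq kap i * c)).
      under eq_Rintegral do rewrite mulrBr -linZ.
      by rewrite (lin_cos sX) dotZl dotZr vv mulrA -expr2.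
    apply: (@le_trans _ _ (expR (- (freq kap i ^+ 2 * sg ^+ 2 / 2)))).
      by rewrite ler_piMr ?expR_ge0// cos_le1.
    apply: (@le_trans _ _ (expR (1 / 2 + - t * `|i.1%:R - i.2%:R|))); last first.
      by rewrite expRD ler_pM2r ?expR_gt0// expR_half_le.
    rewrite ler_expR /freq.
    have -> : ((i.1%:R - i.2%:R) * kap) ^+ 2 * sg ^+ 2 / 2 = 2 * (t * `|i.1%:R - i.2%:R|) ^+ 2.
      by rewrite [(t * _) ^+ 2]exprMn real_normK ?num_real// /t; field.
    rewrite mulNr; move: (t * _) => y; have := sqr_ge0 (2 * y - 1 / 2); nra.
  rewrite mulrC ler_pdivrMr//.
  apply: (@le_trans _ _ (\sum_(i : 'I_q * 'I_q) 2 * expR (- t * `|i.1%:R - i.2%:R|))).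
    exact: ler_sum.
  rewrite -(pair_bigA _ (fun i j : 'I_q => 2 * expR (- t * `|i%:R - j%:R|)))/= exchange_big/=.
  have -> : 16 * (q%:R * s) / sg * q%:R = \sum_(j < q) (8 / t).
    rewrite sumr_const card_ord -[RHS]mulr_natr; congr (_ * _).
    by rewrite /t /kap; field; rewrite !gt_eqF.
  apply: ler_sum => j _; rewrite -mulr_sumr.
  have := geo_sum_abs (j : nat)%:R q t0 => h.
  apply: (@le_trans _ _ (2 * (2 * ((1 + t) / t)))); first by rewrite ler_pM2l.
  have -> : 2 * (2 * ((1 + t) / t)) = 4 * (1 + t) / t by ring.
  by rewrite ler_pM2r ?invr_gt0//; lra.
have q40 : 0 < q%:R / 4 :> R by rewrite divr_gt0.
rewrite -(lee_pmul2l _ (_ : 0 < (q%:R / 4)%:E)%E)// ?lte_fin//.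
apply: le_trans mk _; rewrite -EFinM lee_fin; apply: le_trans int _.
by rewrite le_eqVlt; apply/orP; left; apply/eqP; field; rewrite gt_eqF.
Qed.

Lemma norm_tail : (0 < d)%N ->
  (P [set w | (4 * d%:R < \sum_j X j w ^+ 2)%R] <= (expR (- (d%:R / 2)))%:E)%E.
Proof.
move=> d0; set A := [set w | _].
have msq : measurable_fun setT (fun w => \sum_j X j w ^+ 2).
  by apply: measurable_sum_fin => j; apply: measurable_funM; exact: sX.1.
have mA : measurable A.
  have -> : A = ~` [set w | \sum_j X j w ^+ 2 <= 4 * d%:R].
    by apply/seteqP; split => w /=; rewrite /A/= ltNge => /negP.
  by apply: measurableC; apply: measurable_le_fun => //; exact: measurable_cst.
have mk := @markov_ge0 R _ T P A (fun w => expR ((\sum_j X j w ^+ 2) / 4)) (expR d%:R) mA.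
have {}mk : ((expR d%:R)%:E * P A <= (expR (d%:R / 2))%:E)%E.
  apply: le_trans (mk _ _ _ _) _.
  - by apply: measurableT_comp => //; exact: measurable_funM.
  - by move=> w; exact: expR_ge0.
  - exact: expR_ge0.
  - by move=> w /= Aw; rewrite ler_expR; rewrite /A/= in Aw; lra.
  rewrite (eq_integral (fun w => (\prod_j expR (X j w ^+ 2 / 4))%:E)); last first.
    by move=> w _; rewrite mulr_suml expR_sum.
  rewrite (@std_prod_integral R _ _ T P X (fun _ x => expR (x ^+ 2 / 4)) (index_enum 'I_d)
    (index_enum_uniq _) sX); last 2 first.
  - by move=> j; apply: measurableT_comp => //; apply: measurable_funM.
  - by move=> j x; exact: expR_ge0.
  have -> : d%:R / 2 = \sum_(j < d) (1 / 2 : R).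
    by rewrite sumr_const card_ord -[RHS]mulr_natl mul1r.
  have nq : (\int[normal_prob 0 1]_x (expR (x ^+ 2 / 4 : R))%:E = (Num.sqrt 2)%:E)%E.
    have := @normal_quad_integral R (- (1 / 2)) 0.
    rewrite expr0n/= mul0r expR0 mulr1.
    have -> : 1 + - (1 / 2) = 2^-1 :> R by lra.
    rewrite sqrtrV// invrK => <-; last lra.
    by apply: eq_integral => x _; congr (expR _)%:E; lra.
  rewrite (eq_bigr (fun=> (Num.sqrt 2)%:E)) => [|j _]; last exact: nq.
  rewrite prodEFin lee_fin expR_sum; apply: ler_prod => j _.
  rewrite sqrtr_ge0/=; apply: ler_of_sqr; first exact: expR_ge0.
  rewrite sqr_sqrtr// expr2 -expRD; have := expR_ge1Dx (1 / 2 + 1 / 2 : R); lra.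
rewrite -(lee_pmul2l _ (_ : 0 < (expR d%:R)%:E)%E)// ?lte_fin ?expR_gt0//.
apply: le_trans mk _; rewrite -EFinM -expRD lee_fin ler_expR; lra.
Qed.

End rows.

End std_more.

(** * Flat directions and their roundings *)

Section net_reduction.
Context {R : realType}.

(** The scale t/sqrt d makes a rounding error of at most 1 per entry amount to length at most t. *)
Definition netvec d K (t : R) (z : {ffun 'I_d -> 'I_K.*2.+1}) : 'rV[R]_d :=
  \row_j (t / Num.sqrt d%:R * zdec z j).

(** The rounding of [u] is adapted to the columns of the matrix of points, so that the errors dot(u
    - u', A i) have mean square at most t^2 without any bound on an operator norm. The position
    dot(u, g) is rounded to a multiple of t. Flatness contributes 2 t m to the l^1 distance, the two
    roundings t m each. *)
Lemma net_reduction (d m K N : nat) (A : 'I_m -> 'rV[R]_d) (g u : 'rV[R]_d) (t C : R) :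
  (0 < d)%N -> (0 < m)%N -> 0 < t <= 1 / 2 -> (t^-1 + 1) * d%:R <= K%:R -> C / t + 1 <= N%:R ->
  g = m%:R^-1 *: \sum_i A i -> (forall i, dot (A i) (A i) <= 4 * d%:R) ->
  0 <= C -> dot g g <= C ^+ 2 -> dot u u = 1 -> (forall i, dot u (A i - g) < t) ->
  exists (z : {ffun 'I_d -> 'I_K.*2.+1}) (k : 'I_N.*2.+1),
    [/\ z \in znet d K (t^-1 + 1), 1 / 4 <= dot (netvec t z) (netvec t z) &
      \sum_i `|dot (netvec t z) (A i) - (k%:R - N%:R) * t| <= 4 * t * m%:R].
Proof.
move=> d0 m0 /andP[t0 t12] hK hN gE hA C0 hg uu hu.
have dp : 0 < d%:R :> R by rewrite ltr0n.
have mp : 0 < m%:R :> R by rewrite ltr0n.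
set sd := Num.sqrt d%:R : R.
have sd0 : 0 < sd by rewrite sqrtr_gt0.
have sd2 : sd ^+ 2 = d%:R by rewrite sqr_sqrtr.
pose x j := u 0 j * sd / t.
pose y (j : 'I_d) : 'rV[R]_m := \row_i (t / sd * A i 0 j).
have hx : \sum_j `|x j| <= t^-1 * d%:R.
  have -> : \sum_j `|x j| = (\sum_j `|u 0 j|) * (sd / t).
    by rewrite mulr_suml; apply: eq_bigr => j _; rewrite /x -mulrA normrM [`|_ / _|]gtr0_norm// divr_gt0.
  apply: (@le_trans _ _ (sd * (sd / t))); last first.
    by rewrite mulrA -expr2 sd2 mulrC.
  rewrite ler_pM2r ?divr_gt0//.
  apply: ler_of_sqr; first exact: ltW.
  apply: le_trans (cauchy_sum _) _; rewrite sd2.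
  have -> : \sum_j u 0 j ^+ 2 = dot u u by apply: eq_bigr => j _; rewrite expr2.
  by rewrite uu mulr1.
have [z zN [zx zd]] := @round_net R d m K x y t^-1 hx hK.
set u' := netvec t z.
have du j : (u - u') 0 j = t / sd * (x j - zdec z j).
  by rewrite !mxE /x -/sd; field; rewrite !gt_eqF.
have sE i : (\sum_j (x j - zdec z j) *: y j) 0 i = dot (u - u') (A i).
  rewrite summxE; apply: eq_bigr => j _; rewrite du !mxE; ring.
have q1 : \sum_i dot (u - u') (A i) ^+ 2 <= t ^+ 2 * m%:R.
  have -> : \sum_i dot (u - u') (A i) ^+ 2 = dot (\sum_j (x j - zdec z j) *: y j) (\sum_j (x j - zdec z j) *: y j).
    by apply: eq_bigr => i _; rewrite sE expr2.
  apply: le_trans zd _.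
  have -> : \sum_j dot (y j) (y j) / 4 = (t / sd) ^+ 2 / 4 * \sum_i dot (A i) (A i).
    rewrite -mulr_suml /dot exchange_big/= mulrAC mulr_sumr; congr (_ / _).
    apply: eq_bigr => i _; rewrite mulr_sumr; apply: eq_bigr => j _; rewrite !mxE; ring.
  apply: (@le_trans _ _ ((t / sd) ^+ 2 / 4 * \sum_(i < m) (4 * d%:R))).
    by rewrite ler_pM2l ?divr_gt0 ?exprn_gt0 ?divr_gt0//; exact: ler_sum.
  rewrite sumr_const card_ord -[_ *+ m]mulr_natr expr_div_n sd2.
  by rewrite le_eqVlt; apply/orP; left; apply/eqP; field; rewrite gt_eqF.
have q2 : \sum_i `|dot (u - u') (A i)| <= t * m%:R.
  apply: (@le_trans _ _ (\sum_i (dot (u - u') (A i) ^+ 2 / t + t) / 2)).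
    apply: ler_sum => i _; move: (dot _ _) => a; rewrite ler_pdivlMr// -(ler_pM2r t0) mulrDl mulfVK ?gt_eqF//.
    have := sqr_ge0 (`|a| - t); rewrite -[a ^+ 2]real_normK ?num_real//; nra.
  rewrite -mulr_suml big_split/= -mulr_suml sumr_const card_ord -[t *+ m]mulr_natr.
  have : (\sum_i dot (u - u') (A i) ^+ 2) / t <= t * m%:R by rewrite ler_pdivrMr// mulrAC -expr2.
  lra.
have q3 : dot (u - u') (u - u') <= t ^+ 2.
  apply: (@le_trans _ _ (\sum_(j < d) (t ^+ 2 / d%:R))); last first.
    by rewrite sumr_const card_ord -[leLHS]mulr_natr divfK// gt_eqF.
  apply: ler_sum => j _; rewrite du -expr2 exprMn expr_div_n sd2 ler_piMr//.
    by rewrite divr_ge0 ?sqr_ge0// ltW.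
  have := zx j; rewrite distrC ler_norml => /andP[]; move: (_ - _) => a; nra.
have q4 : 1 / 4 <= dot u' u'.
  have := dot_ge0 (u' - (u - u')); move: q3; rewrite !(dotBl, dotBr) uu (dotC u' u); nra.
have hc : `|dot u g| <= C.
  have := dot_cauchy u g; rewrite uu mul1r => cs; apply: ler_of_sqr => //.
  by rewrite real_normK ?num_real//; exact: le_trans cs hg.
set c := dot u g in hc.
have ct0 : 0 <= c / t + N%:R.
  move: hc; rewrite ler_norml => /andP[c1 c2].
  have : - (C / t) <= c / t by rewrite -mulNr ler_pM2r ?invr_gt0.
  lra.
have /andP[k1 k2] := truncn_itv ct0; set k := Num.truncn _ in k1 k2.
have kN : (k < N.*2.+1)%N.
  rewrite ltnS -(ler_nat R); apply: le_trans k1 _.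
  have : c / t <= C / t by rewrite ler_pM2r ?invr_gt0//; exact: le_trans (ler_norm _) hc.
  rewrite -addnn natrD; lra.
exists z, (Ordinal kN); split => //=.
rewrite -natr1 in k2.
have ck : `|c - (k%:R - N%:R) * t| <= t.
  have -> : c - (k%:R - N%:R) * t = (c / t - (k%:R - N%:R)) * t by field; rewrite gt_eqF.
  rewrite normrM (gtr0_norm t0) -[leRHS]mul1r ler_pM2r// ler_norml; apply/andP; split; lra.
have s0 : \sum_i dot u (A i - g) = 0.
  rewrite -dot_sumr sumrB sumr_const card_ord.
  have -> : \sum_i A i - g *+ m = 0.
    by rewrite gE -scaler_nat scalerA mulfV ?gt_eqF// scale1r subrr.
  exact: dot0r.
(* Terms below t with sum 0 have l^1 norm at most 2 t m, since |a| <= 2 t - a. *)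
have s1 : \sum_i `|dot u (A i - g)| <= 2 * t * m%:R.
  apply: (@le_trans _ _ (\sum_i (2 * t - dot u (A i - g)))).
    apply: ler_sum => i _; have := hu i; move: (dot _ _) => a ha.
    have [a0|a0] := leP 0 a; [rewrite ger0_norm//|rewrite ltr0_norm//]; lra.
  by rewrite sumrB s0 subr0 sumr_const card_ord mulr_natr.
apply: (@le_trans _ _ (\sum_i (`|dot (u - u') (A i)| + `|dot u (A i - g)| + t))).
  apply: ler_sum => i _.
  have -> : dot u' (A i) - (k%:R - N%:R) * t =
     - dot (u - u') (A i) + dot u (A i - g) + (c - (k%:R - N%:R) * t).
    rewrite dotBl dotBr -/c; ring.
  apply: le_trans (ler_normD _ _) _; apply: lerD => //.
  by apply: le_trans (ler_normD _ _) _; rewrite normrN.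
rewrite !big_split/= sumr_const card_ord -[t *+ m]mulr_natr; lra.
Qed.

End net_reduction.

Section random_rows.
Context {R : realType} {disp} {T : measurableType disp} (P : probability T R) {m d : nat}
  (Y : 'I_m * 'I_d -> T -> R) (sY : std_family P Y).

Definition rowv i w : 'rV[R]_d := \row_j Y (i, j) w.

Lemma dot_rowv v i w : dot v (rowv i w) = lin (fun j => Y (i, j)) v w.
Proof. by apply: eq_bigr => j _; rewrite mxE. Qed.

Lemma std_row i : std_family P (fun j => Y (i, j)).
Proof. by apply: (std_sub (s := fun j => (i, j))) => // j j' []. Qed.

Lemma std_col j : std_family P (fun i => Y (i, j)).
Proof. by apply: (std_sub (s := fun i => (i, j))) => // i i' []. Qed.

Lemma eprod_le (I : Type) (r : seq I) (F : I -> \bar R) (c : R) : 0 <= c ->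
  (forall i, (0 <= F i)%E) -> (forall i, (F i <= c%:E)%E) ->
  (\prod_(i <- r) F i <= (c ^+ size r)%:E)%E.
Proof.
move=> c0 F0 Fc; suff : (0 <= \prod_(i <- r) F i)%E /\ (\prod_(i <- r) F i <= (c ^+ size r)%:E)%E by case.
elim: r => [|i r [IH0 IH]]; first by rewrite big_nil expr0.
rewrite big_cons; split; first exact: mule_ge0.
by rewrite /= exprS EFinM; apply: lee_pmul.
Qed.

(** Exponential Markov with exp(-lam |x|/(t V)), majorised by the function that is 1 for |x| <= t V
    and t = exp(-lam) elsewhere, so only small ball probabilities enter. The result is of order t^m,
    up to factors C^m and exp(4 lam m/V), against a net of order t^(-d). *)
Lemma rows_concentrate (v : 'rV[R]_d) (c lam V : R) : 0 < lam -> 0 < V -> 1 / 4 <= dot v v ->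
  (P [set w | (\sum_i `|dot v (rowv i w) - c| <= 4 * expR (- lam) * m%:R)%R] <=
    (expR (lam * (4 * m%:R / V)) * ((128 * V + 1) * expR (- lam)) ^+ m)%:E)%E.
Proof.
move=> l0 V0 hv; set t := expR (- lam); have t0 : 0 < t by exact: expR_gt0.
have t1 : t <= 1 by rewrite -[leRHS]expR0 ler_expR oppr_le0 ltW.
have mL i w : dot v (rowv i w) = \sum_j v 0 j * Y (i, j) w by exact: dot_rowv.
pose A (i : 'I_m) : set (coords R ('I_m * 'I_d)%type) := [set x | `|\sum_j v 0 j * x (i, j) - c| <= t * V].
have mA i : measurable (A i).
  apply: measurable_le_fun => //; apply: measurableT_comp => //; apply: measurable_funB => //.
  by apply: measurable_sum_fin => j; apply: measurable_funM => //; exact: measurable_coord.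
pose f i (x : coords R ('I_m * 'I_d)%type) : R := t + (1 - t) * \1_(A i) x.
have f1 i x : A i x -> f i x = 1 by move=> Ax; rewrite /f indicE mem_set//= mulr1 addrC subrK.
have f2 i x : ~ A i x -> f i x = t by move=> Ax; rewrite /f indicE memNset//= mulr0 addr0.
have mf i : measurable_fun setT (f i).
  by apply: measurable_funD => //; apply: measurable_funM => //; exact: measurable_indic.
have f0 i x : 0 <= f i x.
  by have [/f1 ->|/f2 ->] := pselect (A i x) => //; exact: ltW.
have fb i x y : (forall ij, ij.1 = i -> x ij = y ij) -> f i x = f i y.
  move=> xy; rewrite /f; congr (_ + _ * _); rewrite !indicE; congr (_ %:R); congr nat_of_bool.
  have E : \sum_j v 0 j * x (i, j) = \sum_j v 0 j * y (i, j) by apply: eq_bigr => j _; rewrite xy.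
  by rewrite /A; apply/idP/idP; rewrite !inE/= E.
have BI := std_block_integral (index_enum_uniq _) sY mf f0 fb.
have mYc := measurable_to_coords sY.1.
set E := [set w | _].
have mE : measurable E.
  apply: measurable_le_fun => //; apply: measurable_sum_fin => i.
  apply: measurableT_comp => //; apply: measurable_funB => //.
  under eq_fun do rewrite mL.
  by apply: measurable_sum_fin => j; apply: measurable_funM => //; exact: sY.1.
have mk := @markov_ge0 R _ T P E (fun w => \prod_i f i (fun ij => Y ij w)) (expR (- (lam * (4 * m%:R / V)))) mE.
have {}mk : ((expR (- (lam * (4 * m%:R / V))))%:E * P E <= ((((128 * V + 1) * t) ^+ m)%:E))%E.
  apply: le_trans (mk _ _ _ _) _.
  - by apply: measurable_prod => i _; exact: (measurableT_comp (mf i) mYc).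
  - by move=> w; apply: prodr_ge0.
  - exact: expR_ge0.
  - move=> w Ew.
    apply: (@le_trans _ _ (\prod_i expR (- (lam * (`|dot v (rowv i w) - c| / (t * V)))))).
      rewrite -expR_sum ler_expR sumrN lerN2 -mulr_sumr ler_pM2l// -mulr_suml.
      rewrite ler_pdivrMr ?mulr_gt0//; apply: le_trans Ew _.
      by rewrite le_eqVlt; apply/orP; left; apply/eqP; field; rewrite gt_eqF.
    apply: ler_prod => i _; rewrite expR_ge0/=.
    have [Ai|nA] := pselect (A i (fun ij => Y ij w)).
      rewrite f1// -[leRHS]expR0 ler_expR oppr_le0 mulr_ge0 ?(ltW l0)// divr_ge0// mulr_ge0// ltW//.
    rewrite f2// ler_expR lerN2 -[leLHS]mulr1 ler_pM2l// ler_pdivlMr ?mulr_gt0// mul1r mL.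
    by rewrite leNgt; apply/negP => h; apply: nA; rewrite /A/=; exact: ltW.
  rewrite BI; apply: le_trans (eprod_le _ (c := (128 * V + 1) * t) _ _ _) _.
  - by rewrite mulr_ge0 ?(ltW t0)// addr_ge0// mulr_ge0// ltW.
  - by move=> i; apply: integral_ge0 => w _; rewrite lee_fin.
  - move=> i; rewrite /f; under eq_integral do rewrite EFinD EFinM.
    have mI : measurable_fun setT (fun w => \1_(A i) (fun ij => Y ij w) : R).
      by apply: (measurableT_comp _ mYc); exact: measurable_indic.
    rewrite ge0_integralD//; try (by move=> w _; rewrite lee_fin ltW);
      try (by move=> w _; rewrite mule_ge0// lee_fin subr_ge0);
      try (by apply: measurable_funeM; exact/measurable_EFinP).
    rewrite ge0_integralZl//; try (exact/measurable_EFinP);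
      try (by move=> w _; rewrite lee_fin indicE); try (by rewrite lee_fin subr_ge0).
    have Et : (\int[P]_w t%:E = t%:E)%E.
      by have := expectation_cst P t; rewrite unlock.
    rewrite Et.
    have -> : (\int[P]_w (\1_(A i) (fun ij => Y ij w) : R)%:E = P [set w | A i (fun ij => Y ij w)])%E.
      rewrite -[in RHS](setIT [set w | _]) -integral_indic//.
      by rewrite -[X in measurable X]setTI; exact: mYc.
    have sg0 : 0 < Num.sqrt (dot v v) by rewrite sqrtr_gt0; lra.
    have sg2 : Num.sqrt (dot v v) ^+ 2 = dot v v by rewrite sqr_sqrtr// dot_ge0.
    have sgh : 1 / 2 <= Num.sqrt (dot v v) by apply: ler_of_sqr; rewrite ?sg2; [exact: ltW|lra].
    have li := @lin_interval R _ T P d _ (std_row i) v _ (t * V) c sg0 (esym sg2) (mulr_gt0 t0 V0).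
    have hP : (P [set w | A i (fun ij => Y ij w)] <= (128 * (t * V))%:E)%E.
      apply: le_trans li _; rewrite lee_fin ler_pdivrMr//.
      have : 0 < t * V by exact: mulr_gt0.
      move: (t * V) => tV tV0; nra.
    have -> : (128 * V + 1) * t = t + 1 * (128 * (t * V)) by ring.
    rewrite [leRHS]EFinD; apply: leeD => //; rewrite [leRHS]EFinM; apply: lee_pmul => //; rewrite ?lee_fin ?subr_ge0//; lra.
  by rewrite lee_fin /index_enum -enumT size_enum_ord.
rewrite -(lee_pmul2l _ (_ : 0 < (expR (- (lam * (4 * m%:R / V))))%:E)%E)// ?lte_fin ?expR_gt0//.
by apply: le_trans mk _; rewrite -EFinM lee_fin [leRHS]mulrA -expRD addNr expR0 mul1r.
Qed.

Lemma mean_tail (B : R) : (0 < m)%N -> (d <= m)%N -> 0 < B ->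
  (P [set w | (B < dot (m%:R^-1 *: \sum_i rowv i w) (m%:R^-1 *: \sum_i rowv i w))%R] <= (16 / B)%:E)%E.
Proof.
move=> m0 dm B0; have mp : 0 < m%:R :> R by rewrite ltr0n.
set sm := Num.sqrt m%:R : R.
have sm0 : 0 < sm by rewrite sqrtr_gt0.
have sm2 : sm ^+ 2 = m%:R by rewrite sqr_sqrtr.
pose v : 'rV[R]_m := \row_i sm^-1.
have vv : dot v v = 1.
  rewrite /dot; under eq_bigr do rewrite !mxE.
  by rewrite sumr_const card_ord -[LHS]mulr_natr -sm2; field; rewrite gt_eqF.
pose t j w := lin (fun i => Y (i, j)) v w.
have tE w : dot (m%:R^-1 *: \sum_i rowv i w) (m%:R^-1 *: \sum_i rowv i w) = m%:R^-1 * \sum_j t j w ^+ 2.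
  rewrite mulr_sumr; apply: eq_bigr => j _.
  have -> : (m%:R^-1 *: \sum_i rowv i w) 0 j = sm^-1 * t j w.
    rewrite mxE summxE /t /lin !mulr_sumr; apply: eq_bigr => i _; rewrite !mxE mulrA; congr (_ * _).
    by rewrite -sm2; field; rewrite gt_eqF.
  by rewrite -sm2; field; rewrite gt_eqF.
(* Second moments are bounded by exponential ones, which [lin_expR] provides. *)
have sq (x : R) : x ^+ 2 <= 4 * (expR x + expR (- x)).
  wlog x0 : x / 0 <= x.
    move=> H; have [/H //|/ltW x0] := leP 0 x.
    by have := H (- x); rewrite sqrrN opprK addrC oppr_ge0; exact.
  have -> : expR x = expR (x / 2) ^+ 2 by rewrite expr2 -expRD; congr expR; lra.
  have := expR_ge1Dx (x / 2); have := expR_ge0 (- x); nra.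
set A := [set w | _].
have mt j : measurable_fun setT (t j) by exact: (measurable_lin (std_col j)).
have mtN j : measurable_fun setT (fun w => lin (fun i => Y (i, j)) (- v) w) by exact: (measurable_lin (std_col j)).
have mA : measurable A.
  have -> : A = ~` [set w | m%:R^-1 * \sum_j t j w ^+ 2 <= B].
    by apply/seteqP; split => w /=; rewrite /A/= tE ltNge => /negP.
  apply: measurableC; apply: measurable_le_fun => //; apply: measurable_funM => //.
  by apply: measurable_sum_fin => j; exact: measurable_funM.
have me j : measurable_fun setT (fun w => expR (t j w)) by apply: measurableT_comp.
have meN j : measurable_fun setT (fun w => expR (lin (fun i => Y (i, j)) (- v) w)) by apply: measurableT_comp.
have mk := @markov_ge0 R _ T P A (fun w => \sum_j (expR (t j w) + expR (lin (fun i => Y (i, j)) (- v) w))) (B * m%:R / 4) mA.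
have {}mk : ((B * m%:R / 4)%:E * P A <= (d%:R * 4)%:E)%E.
  apply: le_trans (mk _ _ _ _) _.
  - by apply: measurable_sum_fin => j; apply: measurable_funD.
  - by move=> w; apply: sumr_ge0 => j _; rewrite addr_ge0// expR_ge0.
  - by rewrite divr_ge0// mulr_ge0// ltW.
  - move=> w; rewrite /A/= tE ltr_pdivlMl// => h.
    rewrite ler_pdivrMr//; apply: le_trans (_ : \sum_j t j w ^+ 2 <= _); first by rewrite mulrC ltW.
    by rewrite mulr_suml; apply: ler_sum => j _; rewrite linN mulrC; exact: sq.
  under eq_integral do rewrite -sumEFin.
  rewrite ge0_integral_sum//; last first.
    by move=> j; apply/measurable_EFinP; apply: measurable_funD.
  have -> : d%:R * 4 = \sum_(j < d) (2 + 2) :> R by rewrite sumr_const card_ord -[RHS]mulr_natl; congr (_ * _); ring.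
  rewrite -sumEFin; apply: lee_sum => j _.
  under eq_integral do rewrite EFinD.
  rewrite ge0_integralD//; try (by apply/measurable_EFinP); try (by move=> x _; rewrite lee_fin expR_ge0).
  rewrite !(lin_expR (std_col j)) dotNl dotNr opprK vv -EFinD lee_fin.
  have := @expR_half_le R; lra.
have B4 : 0 < B * m%:R / 4 by rewrite divr_gt0// mulr_gt0.
rewrite -(lee_pmul2l _ (_ : 0 < (B * m%:R / 4)%:E)%E)// ?lte_fin//.
apply: le_trans mk _; rewrite -EFinM lee_fin.
have -> : B * m%:R / 4 * (16 / B) = m%:R * 4 by field; rewrite gt_eqF.
by rewrite ler_pM2r// ler_nat.
Qed.

End random_rows.

Section good_event.
Context {R : realType}.

(** [h0] is chosen before [xi]: the constant c of the theorem derives from it, while the failure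
    probability tends to 0. Only [Cg] and the threshold on d depend on [xi]. *)
Lemma good_event (delta : R) (Lam : nat) : 0 < delta -> delta < 1 -> (0 < Lam)%N ->
  exists2 h0 : R, 0 < h0 & forall xi, 0 < xi -> exists (Cg : R) (D : nat), 0 <= Cg /\
  forall d m, (0 < d)%N -> (D <= d)%N -> d%:R <= delta * m%:R -> (m <= Lam * d)%N ->
  forall disp (T : measurableType disp) (P : probability T R) (Y : 'I_m * 'I_d -> T -> R),
  std_family P Y -> exists N : set T, [/\ measurable N, (P N <= xi%:E)%E &
    forall w, ~ N w -> let g := m%:R^-1 *: \sum_i rowv Y i w in
     [/\ forall i, dot (rowv Y i w) (rowv Y i w) <= 4 * d%:R, dot g g <= Cg ^+ 2 &
         forall u, dot u u = 1 -> exists i, h0 <= dot u (rowv Y i w - g)]].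
Proof.
(* Half of the gap 1 - delta. With V = 4/b the exponents of lam m are delta from the net, b from
   Markov's inequality and -1 from the small balls, in total -b. *)
move=> de0 de1 Lam0; pose b := (1 - delta) / 2.
have b0 : 0 < b by rewrite /b; lra.
have b1 : b <= 1 by rewrite /b; lra.
pose V := 4 / b; have V0 : 0 < V by rewrite divr_gt0.
pose k0 := 24 * (128 * V + 1).
have k01 : 1 <= k0 by rewrite /k0; lra.
(* Makes k0 exp(-lam b) = k0 exp(-4 k0), which is below 1/4; [k0] collects the constants of the net
   and of the small ball bound. *)
pose lam := 4 * k0 / b.
have lam4 : 4 <= lam by rewrite /lam ler_pdivlMr//; lra.
have lam0 : 0 < lam by lra.
pose t := expR (- lam); have t0 : 0 < t by exact: expR_gt0.
have tV : t^-1 = expR lam by rewrite /t expRN invrK.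
have tV2 : 2 <= t^-1 by rewrite tV; have := expR_ge1Dx lam; lra.
have t12 : t <= 1 / 2.
  have : t * 2 <= t * t^-1 by rewrite ler_pM2l.
  rewrite mulfV ?gt_eqF//; lra.
have Lp : 0 < Lam%:R :> R by rewrite ltr0n.
exists t => // xi xi0.
have x3 : 0 < xi / 3 by rewrite divr_gt0.
pose B := 16 / (xi / 3); have B0 : 0 < B by rewrite divr_gt0.
pose Cg := Num.sqrt B; have Cg0 : 0 <= Cg by exact: sqrtr_ge0.
have Cg2 : Cg ^+ 2 = B by rewrite sqr_sqrtr// ltW.
have [N hN] : exists N : nat, Cg / t + 1 <= N%:R.
  by exists (Num.truncn (Cg / t + 1)).+1; exact: ltW (truncnS_gt _).
have [D1 hD1] := @expR_ge_lin R (Lam%:R / (xi / 3)) (1 / 2) (divr_gt0 Lp x3) ltac:(by []).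
have [D2 hD2] : exists D2 : nat, N.*2.+1%:R / (xi / 3) <= D2%:R.
  by exists (Num.truncn (N.*2.+1%:R / (xi / 3))).+1; exact: ltW (truncnS_gt _).
exists Cg, (maxn D1 D2); split => // d m d0 + dm mL disp T P Y sY.
rewrite geq_max => /andP[dD1 dD2].
have dp : 0 < d%:R :> R by rewrite ltr0n.
have dmn : (d <= m)%N.
  have dm0 : 0 < delta * m%:R by exact: lt_le_trans dm.
  rewrite pmulr_rgt0// in dm0.
  by rewrite -(ler_nat R); apply: le_trans dm _; rewrite ger_pMl// ltW.
have m0 : (0 < m)%N by exact: leq_trans dmn.
have mp : 0 < m%:R :> R by rewrite ltr0n.
have mrow i j : measurable_fun setT (fun w => rowv Y i w 0 j).
  by under eq_fun do rewrite mxE; exact: sY.1.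
pose E1 i := [set w | (4 * d%:R < \sum_j Y (i, j) w ^+ 2)%R].
have mE1 i : measurable (E1 i).
  have -> : E1 i = ~` [set w | \sum_j Y (i, j) w ^+ 2 <= 4 * d%:R].
    by apply/seteqP; split => w /=; rewrite /E1/= ltNge => /negP.
  apply: measurableC; apply: measurable_le_fun => //; apply: measurable_sum_fin => j.
  by apply: measurable_funM; exact: sY.1.
have [mN1 pN1] := @union_le R _ T P _ (enum 'I_m) E1 (expR (- (d%:R / 2))) mE1
  (fun i _ => norm_tail (std_row sY i) d0).
set N1 := [set w | _] in mN1 pN1.
pose gw w := m%:R^-1 *: \sum_i rowv Y i w.
pose N2 := [set w | (B < dot (gw w) (gw w))%R].
have mN2 : measurable N2.
  have -> : N2 = ~` [set w | dot (gw w) (gw w) <= B].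
    by apply/seteqP; split => w /=; rewrite /N2/= ltNge => /negP.
  apply: measurableC; apply: measurable_le_fun => //.
  have mg j : measurable_fun setT (fun w => gw w 0 j).
    under eq_fun do rewrite mxE summxE.
    by apply: measurable_funM => //; apply: measurable_sum_fin.
  by apply: measurable_fun_dot.
have pN2 := mean_tail sY m0 dmn B0.
pose K := (Num.truncn ((t^-1 + 1) * d%:R)).+1.
have hK : (t^-1 + 1) * d%:R <= K%:R by exact: ltW (truncnS_gt _).
pose IX := ({ffun 'I_d -> 'I_K.*2.+1} * 'I_N.*2.+1)%type.
pose E3 (p : IX) := [set w | (\sum_i `|dot (netvec t p.1) (rowv Y i w) - (p.2%:R - N%:R) * t| <= 4 * t * m%:R)%R].
have mE3 p : measurable (E3 p).
  apply: measurable_le_fun => //; apply: measurable_sum_fin => i.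
  apply: measurableT_comp => //; apply: measurable_funB => //.
  by apply: measurable_fun_dot.
pose r3 := enum [pred p : IX | (p.1 \in znet d K (t^-1 + 1)) && (1 / 4 <= dot (netvec t p.1) (netvec t p.1))].
pose Q := expR (lam * (4 * m%:R / V)) * ((128 * V + 1) * t) ^+ m.
have [|mN3 pN3] := @union_le R _ T P _ r3 E3 Q mE3.
  move=> p; rewrite mem_enum inE => /andP[_ hp].
  exact: rows_concentrate.
set N3 := [set w | _] in mN3 pN3.
have Q0 : 0 <= Q by rewrite mulr_ge0 ?expR_ge0// exprn_ge0// mulr_ge0 ?(ltW t0)//; lra.
have e4 : expR 1 <= 4 :> R.
  have -> : 1 = 1 / 2 + 1 / 2 :> R by lra.
  rewrite expRD; have := @expR_half_le R; have := expR_ge0 (1 / 2 : R); nra.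
have size3 : (size r3)%:R <= (24 * expR lam) ^+ d * N.*2.+1%:R.
  apply: (@le_trans _ _ (#|znet (R:=R) d K (t^-1 + 1)|%:R * N.*2.+1%:R)).
    rewrite -natrM ler_nat -cardE.
    apply: (@leq_trans #|finset.setX (znet d K (t^-1 + 1)) [set: 'I_N.*2.+1]%SET|).
      apply: subset_leq_card; apply/fintype.subsetP => -[p1 p2]; rewrite inE => /andP[h _].
      by rewrite finset.in_setX h finset.in_setT.
    by rewrite cardsX cardsT card_ord.
  rewrite ler_pM2r ?ltr0n//; apply: le_trans (card_znet _ _ _) _; first lra.
  apply: lerXn2r; rewrite ?nnegrE.
  - by rewrite mulr_ge0// ?mulr_ge0 ?expR_ge0//; lra.
  - by rewrite mulr_ge0// expR_ge0.
  rewrite -tV; have := expR_ge0 (1 : R); nra.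
have tot : (24 * expR lam) ^+ d * Q <= m%:R^-1.
  have k00 : 0 < k0 by lra.
  have h1 : (24 * expR lam) ^+ d <= 24 ^+ m * expR (lam * (delta * m%:R)).
    rewrite exprMn; apply: ler_pM; rewrite ?exprn_ge0 ?expR_ge0//.
      by apply: ler_weXn2l => //; rewrite ler1n.
    by rewrite -expRM_natr ler_expR ler_pM2l.
  apply: (@le_trans _ _ (24 ^+ m * expR (lam * (delta * m%:R)) * Q)); first by rewrite ler_wpM2r.
  have -> : 24 ^+ m * expR (lam * (delta * m%:R)) * Q = (k0 * expR (- (lam * b))) ^+ m.
    rewrite /Q exprMn /t /k0 !exprMn -!expRM_natr.
    have -> : expR (- (lam * b) * m%:R) = expR (lam * (delta * m%:R)) * expR (lam * (4 * m%:R / V)) * expR (- lam * m%:R).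
      rewrite -!expRD; congr expR; rewrite /V /b; field; rewrite !gt_eqF//; lra.
    ring.
  have -> : lam * b = 4 * k0 by rewrite /lam divfK// gt_eqF.
  apply: (@le_trans _ _ (4^-1 ^+ m)).
    apply: lerXn2r; [rewrite nnegrE; apply: mulr_ge0; [exact: ltW|exact: expR_ge0]|by rewrite nnegrE invr_ge0|].
    rewrite expRN ler_pdivrMr ?expR_gt0//; have := expR_ge1Dx (4 * k0); lra.
  rewrite exprVn lef_pV2 ?posrE ?exprn_gt0// -natrX ler_nat.
  by apply: ltnW; exact: ltn_expl.
exists (N1 `|` (N2 `|` N3)); split.
- by apply: measurableU => //; exact: measurableU.
- apply: le_trans (measureU2 _ mN1 (measurableU _ _ mN2 mN3)) _.
  have -> : xi = xi / 3 + (xi / 3 + xi / 3) by lra.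
  rewrite [leRHS]EFinD; apply: leeD.
    apply: le_trans pN1 _; rewrite lee_fin size_enum_ord.
    rewrite expRN ler_pdivrMr ?expR_gt0//.
    apply: (@le_trans _ _ (Lam%:R * d%:R)); first by rewrite -natrM ler_nat.
    have h := hD1 d dD1; have e : 1 / 2 * d%:R = d%:R / 2 :> R by lra.
    by rewrite e mulrAC ler_pdivrMr// in h; rewrite [leRHS]mulrC.
  apply: le_trans (measureU2 _ mN2 mN3) _; rewrite [leRHS]EFinD; apply: leeD.
    apply: le_trans pN2 _; rewrite lee_fin /B invf_div mulrCA divff// mulr1//.
  apply: le_trans pN3 _; rewrite lee_fin.
  apply: (@le_trans _ _ ((24 * expR lam) ^+ d * N.*2.+1%:R * Q)); first by rewrite ler_wpM2r.
  rewrite mulrAC; apply: (@le_trans _ _ (m%:R^-1 * N.*2.+1%:R)); first by rewrite ler_wpM2r.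
  rewrite ler_pdivrMl//.
  rewrite ler_pdivrMr// in hD2; apply: le_trans hD2 _; rewrite ler_pM2r// ler_nat.
  exact: leq_trans dD2 dmn.
move=> w /not_orP[n1 /not_orP[n2 n3]] g.
have hA i : dot (rowv Y i w) (rowv Y i w) <= 4 * d%:R.
  rewrite leNgt; apply/negP => h; apply: n1; exists i; first by rewrite mem_enum.
  by rewrite /E1/=; apply: lt_le_trans h _; apply: ler_sum => j _; rewrite !mxE expr2.
have hg : dot g g <= Cg ^+ 2 by rewrite Cg2 leNgt; apply/negP.
split => // u uu; apply: contrapT => hno.
have hu i : dot u (rowv Y i w - g) < t.
  by rewrite ltNge; apply/negP => h; apply: hno; exists i.
have [|z [k [zN z4 zs]]] := @net_reduction R d m K N (rowv Y ^~ w) g u t Cg d0 m0 _ hK hN erefl hA Cg0 hg uu hu.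
  by rewrite t0 t12.
by apply: n3; exists (z, k); rewrite // mem_enum inE zN z4.
Qed.

End good_event.

(** * The last point *)

Section tails.
Context {R : realType} {disp} {T : measurableType disp} (P : probability T R).

(** That is, ln 2 >= 5/8, so 1/sqrt 2 <= exp(-5/16). The difference 5/16 - 1/4 = 1/16 is the rate in
    [norm_lower_tail], and over n/2 pairs of points it gives the constant 32 of the diameter
    bound. *)
Lemma expR_five_eighths_le : expR (5 / 8) <= 2 :> R.
Proof.
have h : 59 / 64 <= expR (- (5 / 64)) :> R.
  by have := expR_ge1Dx (- (5 / 64) : R); lra.
have h8 : (59 / 64 : R) ^+ 8 <= expR (- (5 / 64)) ^+ 8.
  by apply: lerXn2r => //; rewrite nnegrE ?expR_ge0// divr_ge0.
have e : expR (5 / 8) * expR (- (5 / 64)) ^+ 8 = 1 :> R.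
  rewrite -expRM_natl -expRD -[RHS]expR0; congr expR; lra.
have : 1 / 2 <= (59 / 64 : R) ^+ 8 by rewrite !exprS expr0; lra.
have := expR_ge0 (5 / 8 : R); move: h8 e; set x := expR (5 / 8); set y := expR _ ^+ 8; nra.
Qed.

Lemma norm_lower_tail d (X : 'I_d -> T -> R) : std_family P X ->
  (P [set w | (\sum_j X j w ^+ 2 <= d%:R / 2)%R] <= (expR (- (d%:R / 16)))%:E)%E.
Proof.
move=> sX; set A := [set w | _].
have mA : measurable A.
  by apply: measurable_le_fun => //; apply: measurable_sum_fin => j; apply: measurable_funM; exact: sX.1.
have mk := @markov_ge0 R _ T P A (fun w => \prod_j expR (- (X j w ^+ 2 / 2))) (expR (- (d%:R / 4))) mA.
have {}mk : ((expR (- (d%:R / 4)))%:E * P A <= (expR (- (5 * d%:R / 16)))%:E)%E.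
  apply: le_trans (mk _ _ _ _) _.
  - apply: measurable_prod => j _; apply: measurableT_comp => //; apply: measurable_funN.
    by apply: measurable_funM => //; apply: measurable_funM; exact: sX.1.
  - by move=> w; apply: prodr_ge0 => j _; exact: expR_ge0.
  - exact: expR_ge0.
  - by move=> w; rewrite /A/= => h; rewrite -expR_sum ler_expR sumrN -mulr_suml; lra.
  rewrite (@std_prod_integral R _ _ T P X (fun _ x => expR (- (x ^+ 2 / 2))) (index_enum 'I_d)
    (index_enum_uniq _) sX); last 2 first.
  - move=> j; apply: measurableT_comp => //; apply: measurable_funN; exact: measurable_funM.
  - by move=> j x; exact: expR_ge0.
  have nq : (\int[normal_prob 0 1]_x (expR (- (x ^+ 2 / 2) : R))%:E = ((Num.sqrt 2)^-1)%:E)%E.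
    have := @normal_quad_integral R 1 0.
    rewrite expr0n/= mul0r expR0 mulr1.
    have -> : 1 + 1 = 2 :> R by lra.
    move=> <-; last lra.
    by apply: eq_integral => x _; congr (expR _)%:E; lra.
  rewrite (eq_bigr (fun=> ((Num.sqrt 2)^-1)%:E)) => [|j _]; last exact: nq.
  have -> : - (5 * d%:R / 16) = \sum_(j < d) (- (5 / 16) : R).
    by rewrite sumr_const card_ord -[RHS]mulr_natl; lra.
  rewrite prodEFin lee_fin expR_sum; apply: ler_prod => j _.
  rewrite invr_ge0 sqrtr_ge0/= expRN lef_pV2 ?posrE ?expR_gt0 ?sqrtr_gt0//.
  apply: ler_of_sqr; first exact: sqrtr_ge0.
  rewrite sqr_sqrtr// expr2 -expRD; have -> : 5 / 16 + 5 / 16 = 5 / 8 :> R by lra.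
  exact: expR_five_eighths_le.
rewrite -(lee_pmul2l _ (_ : 0 < (expR (- (d%:R / 4)))%:E)%E)// ?lte_fin ?expR_gt0//.
apply: le_trans mk _; rewrite -EFinM -expRD lee_fin ler_expR; lra.
Qed.

Lemma lin_tail d (X : 'I_d -> T -> R) (v : 'rV[R]_d) (a : R) : std_family P X ->
  (P [set w | (a <= lin X v w)%R] <= (expR (dot v v / 2 - a))%:E)%E.
Proof.
move=> sX; set A := [set w | _].
have ml : measurable_fun setT (lin X v) by exact: (measurable_lin sX).
have mA : measurable A by exact: measurable_le_fun.
have mk := @markov_ge0 R _ T P A (fun w => expR (lin X v w)) (expR a) mA.
have {}mk : ((expR a)%:E * P A <= (expR (dot v v / 2))%:E)%E.
  rewrite -(lin_expR sX); apply: mk => [|w||w].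
  - exact: measurableT_comp.
  - exact: expR_ge0.
  - exact: expR_ge0.
  - by rewrite ler_expR.
rewrite -(lee_pmul2l _ (_ : 0 < (expR a)%:E)%E)// ?lte_fin ?expR_gt0//.
by apply: le_trans mk _; rewrite -EFinM -expRD lee_fin ler_expR; lra.
Qed.

Lemma prod_bound (B : set (T * T)) (N : set T) (al be : R) : measurable B -> measurable N ->
  0 <= be -> (P N <= al%:E)%E -> (forall x, ~ N x -> (P (xsection B x) <= be%:E)%E) ->
  ((P \x P)%E B <= (al + be)%:E)%E.
Proof.
move=> mB mN be0 hN hB; rewrite /product_measure1.
have mI : measurable_fun setT (fun x => (\1_N x : R)%:E).
  by apply/measurable_EFinP; exact: measurable_indic.
apply: (@le_trans _ _ (\int[P]_x ((\1_N x : R)%:E + be%:E))%E).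
  apply: ge0_le_integral => //.
  - exact: (measurable_fun_xsection P mB).
  - by apply: emeasurable_funD => //; exact: measurable_cst.
  move=> x _ /=; rewrite indicE; have [Nx|Nx] := pselect (N x).
    rewrite mem_set//=; apply: (@le_trans _ _ 1%E).
      by apply: probability_le1; exact: measurable_xsection.
    by rewrite leeDl// lee_fin.
  by rewrite memNset//= add0e; exact: hB.
rewrite ge0_integralD//; try (by move=> x _; rewrite lee_fin).
have -> : (\int[P]_x be%:E = be%:E)%E by have := expectation_cst P be; rewrite unlock.
rewrite EFinD; apply: leeD => //.
by rewrite integral_indic// setIT.
Qed.

(** Since the last point is strictly beneath the facet, the same hyperplane supports the larger
    polytope and meets it in the same points, with the same rank. *)
Lemma hit_vf m d (p : 'I_m.+1 -> 'rV[R]_d) (u : 'rV[R]_d) (h s : R) :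
  facet_data (fun i => p (lift ord_max i)) u h -> 0 < h - dot u (p ord_max) < s ->
  (forall i, dot (p ord_max) (p (lift ord_max i)) < dot (p ord_max) (p ord_max)) ->
  vf (conv_hull (range p)) < s.
Proof.
move=> [uu le [i0 hi0 rk]] /andP[h1 h2] vert.
pose J := [set k | dot u (p k) == h]%SET.
apply: (@vf_lt_slab R d m.+1 p u h J (lift ord_max i0) ord_max s) => //.
- split=> i; rewrite inE; first by move/eqP.
  case: (unliftP ord_max i) => [j ->|->] nh; first by rewrite lt_neqAle nh le.
  by lra.
- by rewrite inE hi0.
- by rewrite inE; apply/eqP; lra.
- by apply: is_vert_self => j; case: (unliftP ord_max j) => [k -> _|-> /eqP].
- apply: leq_trans rk _; rewrite ltnS; apply: mxrankS; apply/row_subP => i.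
  rewrite rowK inE; case: eqP => hi; last exact: sub0mx.
  have -> : p (lift ord_max i) - p (lift ord_max i0) = row (lift ord_max i) (diffmx p J (lift ord_max i0)).
    by rewrite rowK inE hi eqxx.
  exact: row_sub.
- by rewrite gtr0_norm.
Qed.

End tails.

(** Here m + 1 points are given, the first m of which form the inner polytope. As before [z]
    precedes [xi]. *)
Lemma vf_small (R : realType) (delta : R) (Lam : nat) : 0 < delta -> delta < 1 -> (0 < Lam)%N ->
  exists2 z : R, 0 < z & forall xi, 0 < xi -> exists D : nat,
  forall d m, (0 < d)%N -> (D <= d)%N -> d%:R <= delta * m%:R -> (m <= Lam * d)%N ->
  forall disp (T : measurableType disp) (P : probability T R) (Z : 'I_m.+1 * 'I_d -> T -> R),
  std_family P Z ->
  ((1 - xi)%:E <= P [set w | (vf (conv_hull (range (fun i => rowv Z i w)))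
     <= expR (- (z ^+ 2 * d%:R / 128)))%R])%E.
Proof.
move=> de0 de1 Lam0; have [h0 h00 good] := good_event de0 de1 Lam0.
have [z [C [z0 C0 fam]]] := facet_family Lam0 h00.
exists z => // xi xi0; pose x5 := xi / 5.
have x50 : 0 < x5 by rewrite divr_gt0.
have [Cg [D1 [Cg0 hgood]]] := good x5 x50.
have [D2 hcov] := cover z0 (addr_ge0 (ltW C0) Cg0) x50.
have Lp : 0 < Lam%:R :> R by rewrite ltr0n.
have [D3 hD3] := @expR_ge_lin R (Lam%:R / x5) (1 / 32) (divr_gt0 Lp x50) ltac:(by []).
exists (maxn D1 (maxn D2 D3)) => d m d0; rewrite !geq_max => /and3P[dD1 dD2 dD3].
move=> dm mL disp T P Z sZ.
have dp : 0 < d%:R :> R by rewrite ltr0n.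
have dmn : (d <= m)%N.
  have dm0 : 0 < delta * m%:R by exact: lt_le_trans dm.
  rewrite pmulr_rgt0// in dm0.
  by rewrite -(ler_nat R); apply: le_trans dm _; rewrite ger_pMl// ltW.
set s := expR _; have s0 : 0 < s by exact: expR_gt0.
have tail : m%:R * expR (- (d%:R / 32)) <= x5.
  rewrite expRN ler_pdivrMr ?expR_gt0//; apply: (@le_trans _ _ (Lam%:R * d%:R)).
    by rewrite -natrM ler_nat.
  have h := hD3 d dD3; have e : 1 / 32 * d%:R = d%:R / 32 :> R by lra.
  by rewrite e mulrAC ler_pdivrMr// in h; rewrite [leRHS]mulrC.
have tail1 : expR (- (d%:R / 32)) <= x5.
  apply: le_trans tail; rewrite ler_peMl ?expR_ge0// ler1n; exact: leq_trans dmn.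
pose I := ('I_m.+1 * 'I_d)%type.
pose E : set (coords R I) := [set x | vf (conv_hull (range (fun i => \row_j x (i, j) : 'rV[R]_d))) <= s].
have mE : measurable E.
  apply: (@measurable_vf_le _ (coords R I) R d m.+1 (fun x i => \row_j x (i, j) : 'rV[R]_d)) => // i j.
  have -> : (fun w : coords R I => (\row_j' w (i, j') : 'rV[R]_d) 0 j) = (fun w : coords R I => w (i, j)).
    by apply/funext => w; rewrite mxE.
  exact: measurable_coord.
(* On the product space the first component carries the inner polytope and the second the last
   point, so the facets are fixed while the last point is random. *)
pose J : pred I := [pred ij | ij.1 != ord_max].
have sS := std_split J sZ.
pose Zs (ij : I) (w : T * T) := if J ij then Z ij w.1 else Z ij w.2.
pose B := [set w : T * T | ~ E (fun ij => Zs ij w)].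
have mB : measurable B.
  have mc := measurable_to_coords sS.1.
  rewrite -[X in measurable X]setTI.
  exact: (mc measurableT _ (measurableC mE)).
have lawE : P [set w | E (fun ij => Z ij w)] = (P \x P)%E [set w | E (fun ij => Zs ij w)].
  exact: (std_law sZ sS mE).
pose Y (ij : 'I_m * 'I_d) := Z (lift ord_max ij.1, ij.2).
have sY : std_family P Y.
  by apply: (std_sub (s := fun ij : 'I_m * 'I_d => (lift ord_max ij.1, ij.2)) _ sZ) => -[i j] [i' j'] /= /eqP;
    rewrite xpair_eqE => /andP[/eqP/lift_inj -> /eqP ->].
pose X (j : 'I_d) := Z (ord_max, j).
have sX : std_family P X.
  by apply: (std_sub (s := fun j : 'I_d => (ord_max, j)) _ sZ) => j j' [].
have [N [mN pN hN]] := hgood d m d0 dD1 dm mL disp T P Y sY.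
have PB : ((P \x P)%E B <= xi%:E)%E.
  have -> : xi = x5 + 4 * x5 by rewrite /x5; lra.
  apply: (prod_bound mB mN _ pN); first by rewrite mulr_ge0// ltW.
  move=> w1 nN; have [hA hg hin] := hN w1 nN.
  set g := _ *: _ in hg hin.
  have [F [u [h [fd fh fsep fcard]]]] := fam d m (rowv Y ^~ w1) g d0 dmn mL hA hin.
  have uu f : dot (u f) (u f) = 1 by have [] := fd f.
  have hH f : `|h f| <= C + Cg.
    have -> : h f = (h f - dot (u f) g) + dot (u f) g by ring.
    apply: le_trans (ler_normD _ _) _; apply: lerD => //.
    apply: ler_of_sqr => //; rewrite real_normK ?num_real//.
    by apply: le_trans (dot_cauchy _ _) _; rewrite uu mul1r.
  have cov := hcov d dD2 disp T P X sX F u h uu hH fsep fcard.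
  set Ms := [set w | _ /\ _] in cov.
  have mMs : measurable Ms by exact: measurable_miss sX.1.
  pose V1 := [set w | (4 * d%:R < \sum_j X j w ^+ 2)%R].
  pose V2 := [set w | (\sum_j X j w ^+ 2 <= d%:R / 2)%R].
  (* The factor 1/8 is the minimiser of 2 a^2 d - a d/2, the Chernoff exponent for dot(A i, x) >=
     d/2 given |A i|^2 <= 4 d; it yields -d/32. Together with |x|^2 > d/2 this makes the last point
     a vertex. *)
  pose V3 i := [set w | (d%:R / 16 <= lin X (8^-1 *: rowv Y i w1) w)%R].
  have msq : measurable_fun setT (fun w => \sum_j X j w ^+ 2).
    by apply: measurable_sum_fin => j; apply: measurable_funM; exact: sX.1.
  have mV1 : measurable V1.
    have -> : V1 = ~` [set w | \sum_j X j w ^+ 2 <= 4 * d%:R].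
      by apply/seteqP; split => w /=; rewrite /V1/= ltNge => /negP.
    by apply: measurableC; apply: measurable_le_fun => //; exact: measurable_cst.
  have mV2 : measurable V2 by apply: measurable_le_fun => //; exact: measurable_cst.
  have mV3 i : measurable (V3 i) by apply: measurable_le_fun => //; exact: (measurable_lin sX).
  have pV1 := norm_tail sX d0; have pV2 := norm_lower_tail sX.
  have pV3 i : i \in enum 'I_m -> (P (V3 i) <= (expR (- (d%:R / 32)))%:E)%E.
    move=> _; apply: le_trans (lin_tail _ _ sX) _; rewrite lee_fin ler_expR dotZl dotZr.
    have := hA i; lra.
  have [mU pU] := union_le mV3 pV3; set U := [set w | _] in mU pU.
  have sub : xsection B w1 `<=` (Ms `|` V1) `|` (V2 `|` U).
    move=> w2; rewrite /xsection/= inE => nE; apply: contrapT => /not_orP[/not_orP[nM n1] /not_orP[n2 n3]].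
    apply: nE; rewrite /E/=; apply: ltW.
    have a4 : \sum_j X j w2 ^+ 2 <= 4 * d%:R by rewrite leNgt; apply/negP.
    have [f hf] : exists f, 0 < h f - lin X (u f) w2 < s.
      by apply: contrapT => nf; apply: nM; split => // f hf; apply: nf; exists f.
    set p := fun i => _.
    have pl i : p (lift ord_max i) = rowv Y i w1.
      apply/rowP => j; rewrite !mxE /Zs /J/= eq_sym (negbTE (neq_lift _ _))//.
    have pm : p ord_max = \row_j X j w2 by apply/rowP => j; rewrite !mxE /Zs /J/= eqxx.
    have dl v : dot v (p ord_max) = lin X v w2 by rewrite pm; apply: eq_bigr => j _; rewrite mxE.
    apply: (@hit_vf R m d p (u f) (h f)); last first.
    - move=> i; have -> : dot (p ord_max) (p ord_max) = \sum_j X j w2 ^+ 2.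
        by rewrite pm; apply: eq_bigr => j _; rewrite !mxE expr2.
      rewrite dotC dl pl; apply: (@lt_trans _ _ (d%:R / 2)).
        rewrite ltNge; apply/negP => hle; apply: n3; exists i; first by rewrite mem_enum.
        by rewrite /V3/= linZ; lra.
      by rewrite ltNge; apply/negP.
    - by rewrite dl.
    - have -> : (fun i => p (lift ord_max i)) = rowv Y ^~ w1 by apply/funext.
      exact: fd.
  apply: le_trans (le_measure _ _ _ sub) _.
  - by apply/mem_set; exact: (measurable_xsection w1 mB).
  - by rewrite inE; apply: measurableU; apply: measurableU.
  apply: le_trans (measureU2 _ (measurableU _ _ mMs mV1) (measurableU _ _ mV2 mU)) _.
  have -> : 4 * x5 = (x5 + x5) + (x5 + x5) by lra.
  rewrite [leRHS]EFinD; apply: leeD.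
    apply: le_trans (measureU2 _ mMs mV1) _; rewrite [leRHS]EFinD; apply: leeD => //.
    apply: le_trans pV1 _; rewrite lee_fin; apply: le_trans tail1; rewrite ler_expR; lra.
  apply: le_trans (measureU2 _ mV2 mU) _; rewrite [leRHS]EFinD; apply: leeD => //.
    apply: le_trans pV2 _; rewrite lee_fin; apply: le_trans tail1; rewrite ler_expR; lra.
  by apply: le_trans pU _; rewrite lee_fin size_enum_ord.
change ((1 - xi)%:E <= P [set w | E (fun ij => Z ij w)])%E.
rewrite lawE.
have -> : [set w | E (fun ij => Zs ij w)] = ~` B.
  by apply/seteqP; split => w; rewrite /B/=; [move=> h; exact|move=> /contrapT].
by rewrite (probability_setC (P \x P)%E mB) EFinB; apply: leeB.
Qed.

(** * Diameter and conclusion *)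

Section gaussian_vectors.
Context {R : realType} {disp} {T : measurableType disp} (P : probability T R).

(** Links the two sigma-algebras: independence of vectors is stated for the one generated by open
    sets, the product rule is needed on boxes. *)
Lemma box_measurable d (B : 'I_d -> set R) : (forall j, measurable (B j)) ->
  <<s [set V : set 'rV[R]_d | open V] >> [set v | forall j, B j (v 0 j)].
Proof.
move=> mB; pose U := g_sigma_algebraType [set V : set 'rV[R]_d | open V].
have mc j : measurable_fun (setT : set U) (fun v : U => (v : 'rV[R]_d) 0 j).
  move=> mD; apply: (measurability _ (RGenOInfty.measurableE R)) => // _ [_ [x ->] <-]; rewrite setTI.
  apply: sub_sigma_algebra => /=.
  have -> : (fun v : U => (v : 'rV[R]_d) 0 j) @^-1` `]x, +oo[ =
      (fun v : 'rV[R]_d => v 0 j) @^-1` `]x, +oo[%classic by [].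
  apply: open_comp; last exact: rray_open.
  by move=> v _; exact: coord_continuous.
have m : measurable (\bigcap_(j in [set: 'I_d]) ((fun v : U => (v : 'rV[R]_d) 0 j) @^-1` B j)).
  apply: fin_bigcap_measurable => [|j _]; first exact: finite_finset.
  by rewrite -[X in measurable X]setTI; exact: mc.
have E : \bigcap_(j in [set: 'I_d]) ((fun v : U => (v : 'rV[R]_d) 0 j) @^-1` B j) =
    [set v : U | forall j, B j ((v : 'rV[R]_d) 0 j)].
  by apply/seteqP; split => v /= h j; [|move=> _]; exact: h.
by rewrite E in m.
Qed.

Lemma iid_std_family m d (A : 'I_m -> T -> 'rV[R]_d) : iid_std_gaussian P A ->
  std_family P (fun ij w => A ij.1 w 0 ij.2).
Proof.
move=> [gA iA]; split => [ij|B mB]; first exact: ((gA ij.1).1 ij.2).1.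
pose C i := [set v : 'rV[R]_d | forall j, B (i, j) (v 0 j)].
have mC i : <<s [set V : set 'rV[R]_d | open V] >> (C i).
  by apply: (@box_measurable d (fun j => B (i, j))) => j; exact: mB.
have := iA [set: 'I_m]%SET C mC.
have -> : [set w | forall i, i \in [set: 'I_m]%SET -> C i (A i w)] =
   [set w | forall ij : 'I_m * 'I_d, B ij (A ij.1 w 0 ij.2)].
  by apply/seteqP; split => w /= h => [[i j]|i _ j]; [exact: (h i (finset.in_setT i) j)|exact: (h (i, j))].
move=> ->; rewrite (eq_bigl xpredT); last by move=> i; exact: finset.in_setT.
rewrite [RHS](eq_bigr (fun p => normal_prob 0 1 (B (p.1, p.2)))); last by case.
rewrite -(pair_bigA _ (fun i j => normal_prob 0 1 (B (i, j))))/=; apply: eq_bigr => i _.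
have [gi ii] := gA i; have := ii [set: 'I_d]%SET (fun j => B (i, j)) (fun j => mB _).
have -> : [set w | forall j, j \in [set: 'I_d]%SET -> B (i, j) (A i w 0 j)] = A i @^-1` C i.
  by apply/seteqP; split => w /= h j; [exact: (h j (finset.in_setT j))|move=> _; exact: h].
move=> ->; apply: eq_big => [j|j _]; first by rewrite finset.in_setT.
exact: (gi j).2.
Qed.

End gaussian_vectors.

Section floor.
Context {R : realType} (delta : R) (delta_gt0 : 0 < delta).

Lemma floor_dim_itv n : (floor_dim delta n)%:R <= delta * n%:R < (floor_dim delta n).+1%:R.
Proof.
have h : 0 <= delta * n%:R by rewrite mulr_ge0// ltW.
by have := truncn_itv h; rewrite truncn_floor h.
Qed.

Lemma floor_dim_ge (D : nat) : exists N, forall n, (N <= n)%N -> (D <= floor_dim delta n)%N.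
Proof.
exists (Num.truncn (D%:R / delta)).+1 => n hn.
have /andP[_ h] := floor_dim_itv n.
have : D%:R < (floor_dim delta n).+1%:R :> R; last by rewrite ltr_nat.
apply: le_lt_trans h; rewrite mulrC -ler_pdivrMr//.
by apply: le_trans (ltW (truncnS_gt _)) _; rewrite ler_nat.
Qed.

End floor.

Section diameter.
Context {R : realType} {d n : nat} (p : 'I_n.+1 -> 'rV[R]_d).
Let H := conv_hull (range p).

(** Convexity of a ball, through dot(y, v) <= (|y|^2 + |v|^2)/2 applied to each term. *)
Lemma hull_dist_le (q : 'rV[R]_d) (M : R) : (forall i, dot (p i - q) (p i - q) <= M) ->
  forall x, H x -> dot (x - q) (x - q) <= M.
Proof.
move=> hM x; rewrite /H conv_hull_range => -[a [a0 _ a1 ->]].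
have -> : \sum_i a i *: p i - q = \sum_i a i *: (p i - q).
  under [RHS]eq_bigr do rewrite scalerBr.
  by rewrite sumrB -scaler_suml a1 scale1r.
have gen (v w : 'rV[R]_d) : dot v w <= (dot v v + dot w w) / 2.
  by have := dot_ge0 (v - w); rewrite dotBl !dotBr (dotC w v); lra.
set y := \sum_i a i *: (p i - q).
have E : dot y y = \sum_i a i * dot y (p i - q).
  by rewrite {2}/y dot_sumr; apply: eq_bigr => i _; rewrite dotZr.
have : dot y y <= \sum_i a i * ((dot y y + M) / 2).
  rewrite {1}E; apply: ler_sum => i _; apply: ler_wpM2l => //.
  by apply: le_trans (gen _ _) _; have := hM i; lra.
rewrite -mulr_suml a1 mul1r; lra.
Qed.

Lemma hull_diam_le (M : R) : (forall i k, dot (p i - p k) (p i - p k) <= M) ->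
  forall x y, H x -> H y -> enorm (x - y) <= Num.sqrt M.
Proof.
move=> hM x y Hx Hy; rewrite /enorm ler_wsqrtr//.
apply: hull_dist_le => // i; rewrite -(opprB y) dotNl dotNr opprK.
by apply: hull_dist_le => // k.
Qed.

(** The diameter of a hull is attained at a pair of the generating points. The converse direction is
    used for measurability, the other for the probability bound. *)
Lemma le_diamP (r : R) : 0 <= r ->
  (Num.sqrt r <= diam H) <-> exists i k, r <= dot (p i - p k) (p i - p k).
Proof.
move=> r0; pose pr := [arg max_(x > (ord0, ord0) : 'I_n.+1 * 'I_n.+1) dot (p x.1 - p x.2) (p x.1 - p x.2)]%O.
have prmax i k : dot (p i - p k) (p i - p k) <= dot (p pr.1 - p pr.2) (p pr.1 - p pr.2).
  by rewrite /pr; case: arg_maxP => // x _ hx; exact: (hx (i, k)).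
set M := dot (p pr.1 - p pr.2) (p pr.1 - p pr.2) in prmax.
have ub : ubound [set r | exists x y, [/\ H x, H y & r = enorm (x - y)]] (Num.sqrt M).
  by move=> _ [x [y [Hx Hy ->]]]; exact: hull_diam_le.
have ne i k : [set r | exists x y, [/\ H x, H y & r = enorm (x - y)]] (enorm (p i - p k)).
  by exists (p i), (p k); split => //; exact: p_conv.
split=> [h|[i [k h]]].
  exists pr.1, pr.2; rewrite leNgt; apply/negP => hM.
  have : Num.sqrt r <= Num.sqrt M.
    by apply: le_trans h _; apply: ge_sup => //; exists (enorm (p ord0 - p ord0)).
  by rewrite ler_sqrt ?dot_ge0// leNgt -/M hM.
apply: (@le_trans _ _ (enorm (p i - p k))); first by rewrite ler_wsqrtr.
by apply: ub_le_sup => //; exists (Num.sqrt M).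
Qed.

End diameter.

Section diameter_probability.
Context {R : realType} {disp} {T : measurableType disp} (P : probability T R).

(** The two variables are integrated out one after the other, which avoids the law of their
    difference. *)
Lemma normal_pair_integral (X : bool -> T -> R) : std_family P X ->
  (\int[P]_w (expR (- ((X true w - X false w) ^+ 2 / 4)))%:E = ((Num.sqrt 2)^-1)%:E)%E.
Proof.
move=> sX; pose F (x : coords R bool) := (expR (- ((x true - x false) ^+ 2 / 4)))%:E.
have mF : measurable_fun setT F.
  apply/measurable_EFinP; apply: measurableT_comp => //; apply: measurable_funN.
  have mB : measurable_fun setT (fun x : coords R bool => x true - x false).
    by apply: measurable_funB; exact: measurable_coord.
  by apply: measurable_funM => //; exact: measurable_funM.
have F0 x : (0 <= F x)%E by rewrite lee_fin expR_ge0.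
have sY := std_split [pred b : bool | b] sX.
rewrite (std_ge0_integral sX sY mF F0).
rewrite (@fubini_tonelli1 _ _ _ _ _ P P); last 2 first.
- apply: (measurableT_comp mF); apply: (measurable_to_coords sY.1).
- by move=> z; exact: F0.
rewrite /fubini_F /F /=.
have m1 a : measurable_fun setT (fun x : R => (expR (- ((a - x) ^+ 2 / 4)))%:E).
  apply/measurable_EFinP; apply: measurableT_comp => //; apply: measurable_funN.
  have mB : measurable_fun setT (fun x : R => a - x) by exact: measurable_funB.
  by apply: measurable_funM => //; exact: measurable_funM.
have s0 (x y : R) : 0 < x -> 0 < y -> (Num.sqrt x)^-1 * (Num.sqrt y)^-1 = (Num.sqrt (x * y))^-1.
  by move=> x0 y0; rewrite sqrtrM ?invfM// ltW.
(* The inner integral leaves the exponent -a^2/4 + a^2/12 = -a^2/6; the two normalising factors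
   multiply to (3/2) (4/3) = 2. *)
transitivity (\int[P]_x ((Num.sqrt (1 + 1 / 2))^-1 * expR (- (1 / 3 * X true x ^+ 2 / 2) + 0 * X true x))%:E)%E.
  apply: eq_integral => x _.
  rewrite (std_coord_ge0_integral sX false (F := fun y => (expR (- ((X true x - y) ^+ 2 / 4)))%:E)) //;
    try (by move=> y; rewrite lee_fin expR_ge0); try exact: m1.
  set a := X true x.
  have nq := @normal_quad_integral R (1 / 2) (a / 2) ltac:(lra).
  transitivity (\int[normal_prob 0 1]_y ((expR (- (a ^+ 2 / 4)))%:E *
      (expR (- (1 / 2 * y ^+ 2 / 2) + a / 2 * y))%:E))%E.
    by apply: eq_integral => y _; rewrite -EFinM -expRD; congr (expR _)%:E; field.
  rewrite ge0_integralZl//; try (by rewrite lee_fin expR_ge0);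
    try (by move=> y _; rewrite lee_fin expR_ge0); last first.
    apply/measurable_EFinP; apply: measurableT_comp => //; apply: measurable_funD; last exact: measurable_funM.
    by apply: measurable_funN; do 2 apply: measurable_funM => //; exact: measurable_funM.
  by rewrite nq -EFinM mulrCA -expRD; congr (_ * expR _)%:E; field.
under eq_integral do rewrite EFinM.
have mq : measurable_fun setT (fun y : R => (expR (- (1 / 3 * y ^+ 2 / 2) + 0 * y))%:E).
  apply/measurable_EFinP; apply: measurableT_comp => //; apply: measurable_funD; last exact: measurable_funM.
  by apply: measurable_funN; do 2 apply: measurable_funM => //; exact: measurable_funM.
rewrite ge0_integralZl//; try (by rewrite lee_fin invr_ge0);
  try (by move=> y _; rewrite lee_fin expR_ge0); last first.
  exact: (measurableT_comp mq (sX.1 true)).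
rewrite (std_coord_ge0_integral sX true (F := fun y => (expR (- (1 / 3 * y ^+ 2 / 2) + 0 * y))%:E)) //;
  try (by move=> y; rewrite lee_fin expR_ge0); try exact: mq.
rewrite normal_quad_integral; last lra.
rewrite expr0n/= mul0r expR0 mulr1 -EFinM s0; [|lra|lra].
by congr (Num.sqrt _)^-1%:E; field.
Qed.

Lemma diam_ge_probability n d (A : 'I_n.+1 -> T -> 'rV[R]_d) : iid_std_gaussian P A ->
  ((1 - expR (- (n%:R * d%:R / 32)))%:E <=
    P [set w | (Num.sqrt d%:R <= diam (random_polytope A w))%R])%E.
Proof.
move=> iA; have sZ := iid_std_family iA.
(* The n + 1 points contain h disjoint pairs, and 2 h >= n whatever the parity of n. *)
set G := [set w | _]; pose h := n.+1./2.
have hn : (n <= h.*2)%N by rewrite /h; have := odd_double_half n.+1; lia.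
have hlt (k : 'I_h) (b : bool) : (k.*2 + b < n.+1)%N.
  have := ltn_ord k; have := odd_double_half n.+1; rewrite -/h; case: b => /=; lia.
pose s (kbj : ('I_h * bool) * 'I_d) : 'I_n.+1 * 'I_d := (Ordinal (hlt kbj.1.1 kbj.1.2), kbj.2).
have si : injective s.
  move=> [[k b] j] [[k' b'] j'] [/= e ->].
  have bb : b = b'.
    by have := congr1 odd e; rewrite !oddD !odd_double /=; case: b {e}; case: b'.
  by subst b'; congr (_, _, _); apply: val_inj => /=; move: e; move: (nat_of_bool b); lia.
have sY := std_sub si sZ.
pose Y kbj w := A (s kbj).1 w 0 (s kbj).2.
pose D k w := \sum_j (Y (k, true, j) w - Y (k, false, j) w) ^+ 2.
have mY kbj : measurable_fun setT (Y kbj) by exact: sY.1.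
have mD k : measurable_fun setT (D k).
  by apply: measurable_sum_fin => j; apply: measurable_funM; exact: measurable_funB.
pose E := [set w | forall k, (D k w <= d%:R)%R].
have mE : measurable E.
  have -> : E = \bigcap_(k in [set: 'I_h]) [set w | D k w <= d%:R].
    by apply/seteqP; split => w /= H k; [move=> _|]; exact: H.
  apply: fin_bigcap_measurable => [|k _]; first exact: finite_finset.
  by apply: measurable_le_fun => //; exact: measurable_cst.
have GE w : G w <-> exists ik : 'I_n.+1 * 'I_n.+1, d%:R <= dot (A ik.1 w - A ik.2 w) (A ik.1 w - A ik.2 w).
  rewrite /G/= /random_polytope le_diamP//.
  by split => [[i [k hh]]|[[i k] hh]]; [exists (i, k)|exists i, k].
have mG : measurable G.
  have -> : G = \bigcup_(ik in [set: 'I_n.+1 * 'I_n.+1]) [set w | d%:R <= dot (A ik.1 w - A ik.2 w) (A ik.1 w - A ik.2 w)].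
    by apply/seteqP; split => w; rewrite GE => -[ik]; [exists ik|move=> _ hh; exists ik].
  apply: fin_bigcup_measurable => [|ik _]; first exact: finite_finset.
  apply: measurable_le_fun => //; apply: measurable_fun_dot => j;
    by under eq_fun do rewrite !mxE; apply: measurable_funB; [exact: (sZ.1 (ik.1, j))|exact: (sZ.1 (ik.2, j))].
have sub : ~` G `<=` E.
  move=> w nG k; rewrite leNgt; apply/negP => hk; apply: nG; apply/GE.
  exists (Ordinal (hlt k true), Ordinal (hlt k false)); apply: le_trans (ltW hk) _.
  by apply: ler_sum => j _; rewrite !mxE expr2.
pose f (kj : 'I_h * 'I_d) (x : coords R (('I_h * bool) * 'I_d)%type) : R :=
  expR (- ((x (kj.1, true, kj.2) - x (kj.1, false, kj.2)) ^+ 2 / 4)).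
have mf kj : measurable_fun setT (f kj).
  apply: measurableT_comp => //; apply: measurable_funN; apply: measurable_funM => //.
  by apply: measurable_funM; apply: measurable_funB; exact: measurable_coord.
have f0 kj x : 0 <= f kj x by exact: expR_ge0.
have BI := @std_block_integral R _ T P _ ('I_h * 'I_d)%type _ (fun kbj => (kbj.1.1, kbj.2)) f
  (index_enum _) (index_enum_uniq _) sY mf f0.
have mYc := measurable_to_coords sY.1.
have hd : (size (index_enum ('I_h * 'I_d)%type))%:R = h%:R * d%:R :> R.
  by rewrite /index_enum -enumT -cardE card_prod !card_ord natrM.
have mk := @markov_ge0 R _ T P E (fun w => \prod_kj f kj (fun kbj => Y kbj w)) (expR (- (h%:R * d%:R / 4))) mE.
have {}mk : ((expR (- (h%:R * d%:R / 4)))%:E * P E <= (expR (- (5 * (h%:R * d%:R) / 16)))%:E)%E.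
  apply: le_trans (mk _ _ _ _) _.
  - by apply: measurable_prod => kj _; exact: (measurableT_comp (mf kj) mYc).
  - by move=> w; apply: prodr_ge0.
  - exact: expR_ge0.
  - move=> w Ew; rewrite -expR_sum ler_expR sumrN lerN2 -mulr_suml ler_pM2r//.
    rewrite -(pair_bigA _ (fun k j => (Y (k, true, j) w - Y (k, false, j) w) ^+ 2))/=.
    apply: (@le_trans _ _ (\sum_(k < h) d%:R)); first by apply: ler_sum => k _; exact: Ew.
    by rewrite sumr_const card_ord mulr_natl.
  rewrite BI; last first.
    by move=> [k j] x y xy; rewrite /f /= !xy.
  have e1 kj : (\int[P]_w (f kj (fun i => Y i w))%:E = ((Num.sqrt 2)^-1)%:E)%E.
    have sb : std_family P (fun b : bool => Y (kj.1, b, kj.2)).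
      by apply: (std_sub (s := fun b : bool => (kj.1, b, kj.2)) _ sY) => b b' [].
    exact: normal_pair_integral sb.
  have -> : - (5 * (h%:R * d%:R) / 16) = - (5 / 16) * (size (index_enum ('I_h * 'I_d)%type))%:R :> R.
    by rewrite hd; lra.
  rewrite expRM_natr; apply: eprod_le; first exact: expR_ge0.
  - by move=> kj; rewrite e1 lee_fin invr_ge0.
  - move=> kj; rewrite e1 lee_fin expRN lef_pV2 ?posrE ?expR_gt0 ?sqrtr_gt0//.
    apply: ler_of_sqr; first exact: sqrtr_ge0.
    rewrite sqr_sqrtr// expr2 -expRD; have -> : 5 / 16 + 5 / 16 = 5 / 8 :> R by lra.
    exact: expR_five_eighths_le.
have PE : (P E <= (expR (- (n%:R * d%:R / 32)))%:E)%E.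
  rewrite -(lee_pmul2l _ (_ : 0 < (expR (- (h%:R * d%:R / 4)))%:E)%E)// ?lte_fin ?expR_gt0//.
  apply: le_trans mk _; rewrite -EFinM -expRD lee_fin ler_expR.
  have : n%:R * d%:R <= 2 * h%:R * d%:R :> R.
    by rewrite ler_wpM2r// -natrM ler_nat mul2n.
  lra.
have -> : G = ~` (~` G) by rewrite setCK.
rewrite probability_setC; last exact: measurableC.
rewrite EFinB; apply: leeB => //; apply: le_trans PE.
by apply: le_measure => //; rewrite inE//; exact: measurableC.
Qed.

End diameter_probability.

Unset Implicit Arguments.

Theorem theorem1p3 (R : realType) (delta : R) (delta_gt0 : 0 < delta)
    (delta_lt1 : delta < 1) :
  (forall (n : nat) (disp : measure_display) (T : measurableType disp)
      (Pr : probability T R) (A : 'I_n.+1 -> T -> 'rV[R]_(floor_dim delta n)),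
    iid_std_gaussian Pr A ->
    ((1 - expR (- (n%:R * (floor_dim delta n)%:R / 32)))%:E <=
      Pr [set w | (Num.sqrt (floor_dim delta n)%:R
                    <= diam (random_polytope A w))%R])%E) /\
  (exists c c' : R, [/\ 0 < c < 1, 0 < c' < 1 &
    forall (disp : nat -> measure_display)
      (T : forall n, measurableType (disp n))
      (Pr : forall n, probability (T n) R)
      (A : forall n, 'I_n.+1 -> T n -> 'rV[R]_(floor_dim delta n)),
    (forall n, iid_std_gaussian (Pr n) (A n)) ->
    exists l : R,
      (fun n => Pr n [set w | vf (random_polytope (A n) w)
                                <= c ^+ floor_dim delta n]) @ \oo --> l%:E
      /\ c' <= l]).
Proof.
split; first by move=> n disp T Pr A; exact: diam_ge_probability.
(* As soon as d >= 1, delta n < d + 1 <= 2 d, hence n <= Lam d. *)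
pose Lam := (Num.truncn (2 / delta)).+1.
have hLam : 2 / delta <= Lam%:R by exact: ltW (truncnS_gt _).
have [z z0 hz] := vf_small delta_gt0 delta_lt1 (ltn0Sn _ : (0 < Lam)%N).
(* The power c^d is then the slab width of [vf_small]. Since the probabilities tend to 1, any c'
   below 1 would do. *)
exists (expR (- (z ^+ 2 / 128))), (1 / 2); split; [|lra|].
  have z2 : 0 < z ^+ 2 by exact: exprn_gt0.
  by rewrite expR_gt0/= -[ltRHS]expR0 ltr_expR; lra.
move=> disp T Pr A iA; exists 1; split; last lra.
pose S n := [set w | vf (random_polytope (A n) w) <= expR (- (z ^+ 2 / 128)) ^+ floor_dim delta n].
have mS n : measurable (S n).
  apply: (@measurable_vf_le _ (T n) R _ n.+1 (fun w i => A n i w)); last by rewrite exprn_gt0// expR_gt0.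
  by move=> i j; exact: (iid_std_family (iA n)).1 (i, j).
apply: cvg_EFin; first by apply: nearW => n; exact: (fin_num_measure (Pr n) _ (mS n)).
apply/cvgrPdist_le => eps eps0.
have [D hD] := hz eps eps0.
have [N hN] := floor_dim_ge delta_gt0 (maxn 1 D).
exists N => // n /= Nn.
have := hN n Nn; set d := floor_dim delta n; rewrite geq_max => /andP[d1 dD].
have /andP[dle dgt] := floor_dim_itv delta_gt0 n; rewrite -/d in dle dgt.
have nL : (n <= Lam * d)%N.
  rewrite -(ler_nat R) natrM; apply: (@le_trans _ _ (2 / delta * d%:R)); last by rewrite ler_wpM2r.
  rewrite mulrAC ler_pdivlMr// mulrC; apply: le_trans (ltW dgt) _.
  by rewrite -natr1; have : 1 <= d%:R :> R; [rewrite ler1n|lra].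
pose Z (ij : 'I_n.+1 * 'I_d) w := A n ij.1 w 0 ij.2.
have sZ : std_family (Pr n) Z := iid_std_family (iA n).
have := hD d n d1 dD dle nL _ _ (Pr n) Z sZ.
have -> : [set w | vf (conv_hull (range (fun i => rowv Z i w))) <= expR (- (z ^+ 2 * d%:R / 128))] = S n.
  apply/seteqP; rewrite /S /random_polytope -expRM_natr.
  have -> : - (z ^+ 2 / 128) * (floor_dim delta n)%:R = - (z ^+ 2 * d%:R / 128) by rewrite /d; lra.
  have E w : (fun i => rowv Z i w) = (fun i => A n i w).
    by apply/funext => i; apply/rowP => j; rewrite !mxE.
  by split => w /=; rewrite E.
have f := fin_num_measure (Pr n) _ (mS n).
have := probability_le1 (Pr n) (mS n).
rewrite -/(S n) -(fineK f) !lee_fin => p1 p2.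
rewrite /comp ger0_norm; [|by rewrite subr_ge0].
by rewrite lerBlDl -lerBlDr.
Qed.
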